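(* Let $k$ be an arbitrary field. The set $\mathrm{TSpec}\, kS_\infty$ of non-zero T-prime ideals of $kS_\infty$ (including the ideal $kS_\infty$ itself), equipped with addition $\dagger$ and multiplication $\Join$, is a commutative semiring.
   Context: $S_n$ is the symmetric group on $\{1,\dots,n\}$, with the canonical inclusions $S_n\subset S_{n+1}$; $S_\infty=\bigcup_n S_n$ and $kS_\infty=\bigcup_n kS_n$. All ideals are two-sided; for an ideal $I$ of $kS_\infty$ put $I_n:=I\cap kS_n$ for $n\ge 1$. By the Young subgroup $S_m\times S_n\subset S_{m+n}$ we view $kS_m\otimes kS_n\subset kS_{m+n}$. An ideal $I$ of $kS_\infty$ is T-prime if for all $m,n\in\mathbb{Z}_{>0}$ $$I_{m+n}\cap (kS_m\otimes kS_n)=I_m\otimes kS_n+kS_m\otimes I_n .$$ The ideal $kS_\infty$ is T-prime. $\mathrm{TSpec}\,kS_\infty$ denotes the set of all T-prime ideals except the zero ideal (and including $kS_\infty$). For ideals $I,J$ of $kS_\infty$: $I\Join J$ is the preimage of $I\otimes kS_\infty+kS_\infty\otimes J$ under the comultiplication $\Delta:kS_\infty\to kS_\infty\otimes kS_\infty$, $\Delta(\sigma)=\sigma\otimes\sigma$ for $\sigma\in S_\infty$. The ideal $I\dagger J$ is given by $$(I\dagger J)_n=\bigcap_{i=0}^n \mathrm{Ann}_{kS_n}\,\mathrm{Ind}^{S_n}_{S_i\times S_{n-i}}\left(kS_i/I_i\boxtimes kS_{n-i}/J_{n-i}\right),\quad n\ge 1,$$ where $S_0$ is trivial, $kS_0=k$,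 and $I_0=J_0=0$ by convention. A semiring has an additive commutative monoid structure with a zero element, and an associative multiplication with identity element that distributes over addition and for which the additive zero is absorbing. *)

(* Defs.v *)
From HB Require Import structures.
From mathcomp Require Import all_boot all_order all_algebra all_fingroup.
From mathcomp Require Import generic_quotient ring_quotient finmap.
From mathcomp Require Import boolp classical_sets.
From mathcomp Require Import monalg.

Set Implicit Arguments.
Unset Strict Implicit.
Unset Printing Implicit Defensive.

Import GRing.Theory.
Local Open Scope ring_scope.
Local Open Scope classical_set_scope.
Local Open Scope quotient_scope.

Section Subspaces.
Context {k : fieldType} {V : lmodType k}.

Definition is_subspace (W : set V) : Prop :=
  W 0 /\ forall (c : k) u v, W u -> W v -> W (c *: u + v).

Definition span (U : set V) : set V := smallest is_subspace U.

Definition sum_subspace (A B : set V) : set V := [set a + b | a in A & b in B].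

Lemma span_subspace (U : set V) : is_subspace (span U).
Proof.
split=> [W [[W0 _] _] //|c u v Uu Uv W WU].
by case: (WU) => -[_ Wlin] _; apply: Wlin; [apply: Uu|apply: Uv].
Qed.

Lemma sub_span (U : set V) u : U u -> span U u.
Proof. by move=> Uu W [_ /(_ u Uu)]. Qed.

Lemma span_ind (U W : set V) : is_subspace W -> U `<=` W -> span U `<=` W.
Proof. by move=> sW UW u; apply. Qed.

Definition span_pred (U : set V) : {pred V} := fun v => `[< span U v >].

Lemma span_predP (U : set V) v : reflect (span U v) (v \in span_pred U).
Proof. exact: asboolP. Qed.

Lemma span_zmod_closed (U : set V) : zmod_closed (span_pred U).
Proof.
have [U0 Ulin] := span_subspace U; split; first exact/span_predP.
move=> u v /span_predP Uu /span_predP Uv; apply/span_predP.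
by rewrite addrC -scaleN1r; apply: Ulin.
Qed.

HB.instance Definition _ (U : set V) :=
  GRing.isZmodClosed.Build V (span_pred U) (span_zmod_closed U).

End Subspaces.

(* The quotient V / span U; U is not required to be a subspace. *)
Definition lquot (k : fieldType) (V : lmodType k) (U : set V) :=
  Quotient.quot (span_pred U).

HB.instance Definition _ (k : fieldType) (V : lmodType k) (U : set V) :=
  GRing.Zmodule.on (lquot U).
HB.instance Definition _ (k : fieldType) (V : lmodType k) (U : set V) :=
  EqQuotient.on (lquot U).

(* lpi, lrepr, lext and tensor are locked only to keep unification from
   unfolding them. *)
HB.lock Definition lpi (k : fieldType) (V : lmodType k) (U : set V) (v : V) :
  lquot U := \pi_(lquot U) v.

HB.lock Definition lrepr (k : fieldType) (V : lmodType k) (U : set V)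
  (x : lquot U) : V := repr x.

Section QuotientSpace.
Context {k : fieldType} {V : lmodType k} (U : set V).

Local Notation lquot := (lquot U).
Local Notation lpi := (lpi U).

Lemma lreprK (x : lquot) : lpi (lrepr x) = x.
Proof. by rewrite lpi.unlock lrepr.unlock; apply: reprK. Qed.

Lemma lpiP u v : lpi u = lpi v <-> span U (u - v).
Proof.
rewrite lpi.unlock; split=> [|Huv]; first by move/eqP; rewrite -Quotient.idealrBE => /span_predP.
by apply/eqP; rewrite -Quotient.idealrBE; apply/span_predP.
Qed.

Lemma lpiD u v : lpi (u + v) = lpi u + lpi v.
Proof. by rewrite lpi.unlock; apply: Quotient.pi_add. Qed.

Definition lquot_scale (c : k) (x : lquot) : lquot := lpi (c *: lrepr x).

Lemma lpiZ c v : lpi (c *: v) = lquot_scale c (lpi v).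
Proof.
apply/lpiP; rewrite -scalerBr -[c *: _]addr0.
have [U0 Ulin] := span_subspace U; apply: Ulin => //.
by apply/lpiP; rewrite lreprK.
Qed.

Fact lquot_scalerA a b x :
  lquot_scale a (lquot_scale b x) = lquot_scale (a * b) x.
Proof. by rewrite -[x]lreprK -!lpiZ scalerA. Qed.

Fact lquot_scale1r : left_id 1 lquot_scale.
Proof. by move=> x; rewrite -[x]lreprK -lpiZ scale1r. Qed.

Fact lquot_scalerDr : right_distributive lquot_scale +%R.
Proof.
move=> c x y; rewrite -[x]lreprK -[y]lreprK.
by rewrite -lpiD -!lpiZ -lpiD scalerDr.
Qed.

Fact lquot_scalerDl x : {morph lquot_scale^~ x : a b / a + b}.
Proof. by move=> a b; rewrite -[x]lreprK -!lpiZ -lpiD scalerDl. Qed.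

HB.instance Definition _ := GRing.Zmodule_isLmodule.Build k lquot
  lquot_scalerA lquot_scale1r lquot_scalerDr lquot_scalerDl.

Fact lpi_linear : linear lpi.
Proof. by move=> c u v; rewrite lpiD lpiZ. Qed.
HB.instance Definition _ := GRing.isLinear.Build k V lquot *:%R lpi lpi_linear.

Lemma lpi_eq0 v : lpi v = 0 <-> span U v.
Proof. by rewrite -(raddf0 lpi) lpiP subr0. Qed.

End QuotientSpace.

Lemma lpi_lrepr (k : fieldType) (V W : lmodType k) (U : set V) (T : set W)
    (F : V -> W) : linear F -> (forall u, U u -> span T (F u)) ->
  forall v, lpi T (F (lrepr (lpi U v))) = lpi T (F v).
Proof.
move=> Flin FU v; have [T0 Tlin] := span_subspace T.
have F0 : F 0 = 0.
  by have := Flin (-1) 0 0; rewrite scaler0 addr0 scaleN1r addNr.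
have FB u u' : F (u - u') = F u - F u'.
  by rewrite addrC -scaleN1r Flin scaleN1r addrC.
apply/lpiP; rewrite -FB.
have: span U (lrepr (lpi U v) - v) by apply/lpiP; rewrite lreprK.
apply: (@span_ind _ _ _ [set u | span T (F u)]) => //.
split=> [|c u u' Tu Tu'] /=; first by rewrite F0.
by rewrite Flin; apply: Tlin.
Qed.

HB.lock Definition lext (k : fieldType) (K : choiceType) (V : lmodType k)
    (f : K -> V) (x : {malg k[K]}) : V :=
  \sum_(g <- msupp x) x@_g *: f g.

Section LinearExtension.
Context {k : fieldType} {K : choiceType} {V : lmodType k} (f : K -> V).

Local Notation lext := (lext f).

Lemma lextE x : lext x = \sum_(g <- msupp x) x@_g *: f g.
Proof. by rewrite lext.unlock. Qed.

Lemma lext_sub (D : {fset K}) x : (msupp x `<=` D)%fset ->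
  lext x = \sum_(g <- D) x@_g *: f g.
Proof.
move=> sxD; rewrite lextE; apply/big_fset_incl => // g _ gx.
by rewrite mcoeff_outdom // scale0r.
Qed.

Fact lext_linear : linear lext.
Proof.
move=> c x y; pose D := (msupp x `|` msupp y `|` msupp (c *: x + y))%fset.
rewrite !(@lext_sub D); first last.
- by apply/fsubsetP => g; rewrite !inE => ->; rewrite ?orbT.
- by apply/fsubsetP => g; rewrite !inE => ->; rewrite ?orbT.
- by apply/fsubsetP => g; rewrite !inE => ->; rewrite ?orbT.
rewrite scaler_sumr -big_split; apply: eq_bigr => g _ /=.
by rewrite mcoeffD mcoeffZ scalerDl scalerA.
Qed.
HB.instance Definition _ :=
  GRing.isLinear.Build k {malg k[K]} V *:%R lext lext_linear.

Lemma lextU g : lext << g >> = f g.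
Proof. by rewrite lextE msuppU oner_eq0 big_seq_fset1 mcoeffUU scale1r. Qed.

End LinearExtension.

Lemma lext_id (k : fieldType) (K : choiceType) (x : {malg k[K]}) :
  lext (fun g => << g >>) x = x.
Proof.
rewrite [RHS]monalgE lextE; apply: eq_bigr => g _.
by apply/malgP => h; rewrite mcoeffZ !mcoeffU; case: eqP; rewrite ?mulr1 ?mulr0.
Qed.

Lemma eq_linear_malg (k : fieldType) (K : choiceType) (V : lmodType k)
    (f g : {linear {malg k[K]} -> V}) :
  (forall b, f << b >> = g << b >>) -> f =1 g.
Proof.
move=> fg x; rewrite -(lext_id x) lextE !linear_sum.
by apply: eq_bigr => b _; rewrite !linearZ fg.
Qed.

Section TensorSpace.
Context {k : fieldType}.

Definition bilinear2 (V W X : lmodType k) (b : V -> W -> X) : Prop :=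
  (forall w, linear (b^~ w)) /\ (forall v, linear (b v)).

Definition bilin_rel (V W : lmodType k) : set {malg k[(V * W)%type]} :=
  [set r | (exists (c : k) v v' w,
              r = << (c *: v + v', w) >> - c *: << (v, w) >> - << (v', w) >>)
        \/ (exists (c : k) v w w',
              r = << (v, c *: w + w') >> - c *: << (v, w) >> - << (v, w') >>)].

Definition tens (V W : lmodType k) : lmodType k := lquot (@bilin_rel V W).

End TensorSpace.

Arguments bilin_rel {k} V W.
Arguments tens {k} V W.

HB.lock Definition tensor (k : fieldType) (V W : lmodType k) (v : V) (w : W) :
  tens V W := lpi _ << (v, w) >>.

Section Tensor.
Context {k : fieldType}.

(* The linear map V ⊗ W -> X, v ⊗ w |-> b v w; meaningful for bilinear b. *)
Definition tlift (V W X : lmodType k) (b : V -> W -> X) (t : tens V W) : X :=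
  lext (fun p : V * W => b p.1 p.2) (lrepr t).

(* The image in V ⊗ W of A ⊗ B, for subspaces A of V and B of W. *)
Definition tens_sub (V W : lmodType k) (A : set V) (B : set W) :
  set (tens V W) := span [set tensor a b | a in A & b in B].

Lemma tensor_bilinear (V W : lmodType k) : bilinear2 (@tensor k V W).
Proof.
split=> [w c v v'|v c w w']; apply/eqP; rewrite -subr_eq0 tensor.unlock -linearZ.
  rewrite opprD addrA -!raddfB; apply/eqP/lpi_eq0; apply: sub_span; rewrite /bilin_rel /=; left.
  by exists c, v, v', w.
rewrite opprD addrA -!raddfB; apply/eqP/lpi_eq0; apply: sub_span; rewrite /bilin_rel /=; right.
by exists c, v, w, w'.
Qed.

Section Lift.
Context {V W X : lmodType k} (b : V -> W -> X) (b_bil : bilinear2 b).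

Lemma tlift_pi x :
  tlift b (lpi _ x) = lext (fun p : V * W => b p.1 p.2) x.
Proof.
apply/eqP; rewrite -subr_eq0 /tlift -raddfB; apply/eqP.
move: (_ - _) (iffLR (lpiP (bilin_rel V W) _ _) (lreprK (lpi _ x))).
apply: (@span_ind _ _ _ [set z | lext (fun p : V * W => b p.1 p.2) z = 0]).
  split=> [|c u v u0 v0] /=; first exact: raddf0.
  by rewrite linearP /= u0 v0 scaler0 addr0.
case: b_bil => b1 b2 r [[c [v [v' [w ->]]]]|[c [v [w [w' ->]]]]] /=.
  by rewrite !raddfB /= linearZ /= !lextU /= b1 addrAC addrK subrr.
by rewrite !raddfB /= linearZ /= !lextU /= b2 addrAC addrK subrr.
Qed.

Lemma tlift_tensor v w : tlift b (tensor v w) = b v w.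
Proof. by rewrite tensor.unlock tlift_pi lextU. Qed.

Lemma tlift_linear : linear (tlift b).
Proof.
move=> c t u; rewrite -[t]lreprK -[u]lreprK -linearP !tlift_pi.
by rewrite linearP.
Qed.

End Lift.

End Tensor.

Definition galg (k : fieldType) (G : groupType) := {malg k[G]}.

Section GroupAlgebra.
Context {k : fieldType} {G : groupType}.

HB.instance Definition _ := GRing.Lmodule.on (galg k G).

Definition gelt (g : G) : galg k G := << g >>.

Definition galg_mul (x y : galg k G) : galg k G :=
  lext (fun g => lext (fun h => gelt (g * h)%g) y) x.

Fact galg_mulP c x x' y :
  galg_mul (c *: x + x') y = c *: galg_mul x y + galg_mul x' y.
Proof. exact: linearP. Qed.

Fact galg_mulPr c x y y' :
  galg_mul x (c *: y + y') = c *: galg_mul x y + galg_mul x y'.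
Proof.
rewrite /galg_mul.
rewrite !(@lextE _ _ _ _ x) scaler_sumr -big_split; apply: eq_bigr => g _ /=.
by rewrite linearP scalerDr !scalerA mulrC.
Qed.

Fact galg_mulUU g h : galg_mul (gelt g) (gelt h) = gelt (g * h)%g.
Proof. by rewrite /galg_mul !lextU. Qed.

Lemma galg_ind (P : galg k G -> Prop) : P 0 ->
  (forall c x y, P x -> P y -> P (c *: x + y)) -> (forall g, P (gelt g)) ->
  forall x, P x.
Proof.
move=> P0 Plin Pg x; rewrite -(lext_id x) lextE.
by apply: (big_rec P) => // g y _ Py; apply: Plin => //; apply: Pg.
Qed.

Fact galg_mul0l y : galg_mul 0 y = 0.
Proof. exact: raddf0. Qed.

Fact galg_mul0r x : galg_mul x 0 = 0.
Proof. by have := galg_mulPr (-1) x 0 0; rewrite scaler0 addr0 scaleN1r addNr. Qed.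

Fact galg_mulA : associative galg_mul.
Proof.
move=> x y z; elim/galg_ind: x => [|c x x' IH IH'|g].
- by rewrite !galg_mul0l.
- by rewrite !galg_mulP IH IH'.
elim/galg_ind: y => [|c x x' IH IH'|h].
- by rewrite !(galg_mul0l, galg_mul0r).
- by rewrite !(galg_mulP, galg_mulPr) IH IH'.
elim/galg_ind: z => [|c x x' IH IH'|l].
- by rewrite !(galg_mul0l, galg_mul0r).
- by rewrite !(galg_mulP, galg_mulPr) IH IH'.
by rewrite !galg_mulUU mulgA.
Qed.

Fact galg_mul1l : left_id (gelt 1%g) galg_mul.
Proof.
move=> x; elim/galg_ind: x => [|c x x' IH IH'|h]; first exact: galg_mul0r.
  by rewrite galg_mulPr IH IH'.
by rewrite galg_mulUU mul1g.
Qed.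

Fact galg_mul1r : right_id (gelt 1%g) galg_mul.
Proof.
move=> x; elim/galg_ind: x => [|c x x' IH IH'|h]; first exact: galg_mul0l.
  by rewrite galg_mulP IH IH'.
by rewrite galg_mulUU mulg1.
Qed.

Fact galg_mulDl : left_distributive galg_mul +%R.
Proof. by move=> x y z; have := galg_mulP 1 x y z; rewrite !scale1r. Qed.

Fact galg_mulDr : right_distributive galg_mul +%R.
Proof. by move=> x y z; have := galg_mulPr 1 x y z; rewrite !scale1r. Qed.

Fact galg_1neq0 : gelt 1%g != 0.
Proof. by rewrite monalgU_eq0 oner_eq0. Qed.

HB.instance Definition _ := GRing.Zmodule_isNzRing.Build (galg k G)
  galg_mulA galg_mul1l galg_mul1r galg_mulDl galg_mulDr galg_1neq0.

Fact galg_scalerAl (c : k) (x y : galg k G) : c *: (x * y) = (c *: x) * y.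
Proof. by have := galg_mulP c x 0 y; rewrite galg_mul0l !addr0. Qed.
HB.instance Definition _ :=
  GRing.Lmodule_isLalgebra.Build k (galg k G) galg_scalerAl.

Fact galg_scalerAr (c : k) (x y : galg k G) : c *: (x * y) = x * (c *: y).
Proof. by have := galg_mulPr c x y 0; rewrite galg_mul0r !addr0. Qed.
HB.instance Definition _ :=
  GRing.Lalgebra_isAlgebra.Build k (galg k G) galg_scalerAr.

Lemma geltM (g h : G) : gelt (g * h)%g = gelt g * gelt h.
Proof. by rewrite -galg_mulUU. Qed.

End GroupAlgebra.

Arguments gelt k {G} g.

Definition galg_map (k : fieldType) (G H : groupType) (f : G -> H)
  (x : galg k G) : galg k H := lext (fun g => gelt k (f g)) x.

Definition comult (k : fieldType) (G : groupType) (x : galg k G) :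
  tens (galg k G) (galg k G) := lext (fun g => tensor (gelt k g) (gelt k g)) x.

Definition is_ideal (R : pzRingType) (I : set R) : Prop :=
  [/\ I 0, forall x y, I x -> I y -> I (x + y)
    & forall r x, I x -> I (r * x) /\ I (x * r)].

(* The finitely supported permutations of nat, i.e. the union of the S_n. As for
   {perm T}, the product is (s * t) x = t (s x); points are numbered from 0. *)
Record Sinf : predArgType := MkSinf {
  sinf_fun :> nat -> nat;
  sinf_subproof :
    `[< bijective sinf_fun /\ exists n, forall i, (n <= i)%N -> sinf_fun i = i >]
}.

HB.instance Definition _ := [isSub for sinf_fun].
HB.instance Definition _ := [Choice of Sinf by <:].

Section SinfGroup.

Lemma sinfP (s t : Sinf) : s =1 t <-> s = t.
Proof. by split=> [st|->//]; apply/val_inj/funext. Qed.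

Lemma sinf_bij (s : Sinf) : bijective s.
Proof. by have /asboolP[] := sinf_subproof s. Qed.

Lemma sinf_bound (s : Sinf) : exists n, forall i, (n <= i)%N -> s i = i.
Proof. by have /asboolP[] := sinf_subproof s. Qed.

Fact sinf_one_subproof :
  `[< bijective (@id nat) /\ exists n, forall i, (n <= i)%N -> i = i >].
Proof. by apply/asboolP; split; [exists id|exists 0%N]. Qed.
Definition sinf_one : Sinf := MkSinf sinf_one_subproof.

Fact sinf_mul_subproof (s t : Sinf) :
  `[< bijective (t \o s) /\ exists n, forall i, (n <= i)%N -> (t \o s) i = i >].
Proof.
apply/asboolP; split; first exact: bij_comp (sinf_bij t) (sinf_bij s).
have [[m sm] [n tn]] := (sinf_bound s, sinf_bound t).
by exists (maxn m n) => i; rewrite geq_max => /andP[/sm /= -> /tn].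
Qed.
Definition sinf_mul s t : Sinf := MkSinf (sinf_mul_subproof s t).

Lemma sinf_inv_ex (s : Sinf) : exists t : Sinf, cancel s t /\ cancel t s.
Proof.
have [g sK gK] := sinf_bij s; have [n sn] := sinf_bound s.
have Pg : `[< bijective g /\ exists n, forall i, (n <= i)%N -> g i = i >].
  apply/asboolP; split; first by exists s.
  by exists n => i /sn {1}<-; rewrite sK.
by exists (MkSinf Pg).
Qed.
Definition sinf_inv (s : Sinf) : Sinf := sval (cid (sinf_inv_ex s)).

Fact sinf_mulA : associative sinf_mul.
Proof. by move=> s t u; apply/sinfP. Qed.
Fact sinf_mul1 : left_id sinf_one sinf_mul.
Proof. by move=> s; apply/sinfP. Qed.
Fact sinf_mulr1 : right_id sinf_one sinf_mul.
Proof. by move=> s; apply/sinfP. Qed.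
Fact sinf_mulV : left_inverse sinf_one sinf_inv sinf_mul.
Proof.
by move=> s; apply/sinfP => i; have [_] := svalP (cid (sinf_inv_ex s)); apply.
Qed.
Fact sinf_mulrV : right_inverse sinf_one sinf_inv sinf_mul.
Proof.
by move=> s; apply/sinfP => i; have [+ _] := svalP (cid (sinf_inv_ex s)); apply.
Qed.

End SinfGroup.

HB.instance Definition _ := isGroup.Build Sinf
  sinf_mulA sinf_mul1 sinf_mulr1 sinf_mulV sinf_mulrV.

Definition ext_perm_fun n (s : 'S_n) (i : nat) : nat :=
  if insub i is Some j then val (s j) else i.

Lemma ext_perm_lt n (s : 'S_n) (i : 'I_n) : ext_perm_fun s i = s i.
Proof. by rewrite /ext_perm_fun valK. Qed.

Lemma ext_perm_ge n (s : 'S_n) (i : nat) : (n <= i)%N -> ext_perm_fun s i = i.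
Proof. by rewrite /ext_perm_fun leqNgt => /negbTE lni; case: insubP; rewrite ?lni. Qed.

Lemma ext_permM n (s t : 'S_n) :
  ext_perm_fun (s * t)%g =1 ext_perm_fun t \o ext_perm_fun s.
Proof.
move=> i /=; case: (ltnP i n) => [lt_i_n|le_n_i]; last by rewrite !ext_perm_ge.
by rewrite -[i]/(val (Ordinal lt_i_n)) !ext_perm_lt permM.
Qed.

Lemma ext_perm1 n : ext_perm_fun (1%g : 'S_n) =1 id.
Proof.
move=> i /=; case: (ltnP i n) => [lt_i_n|le_n_i]; last by rewrite !ext_perm_ge.
by rewrite -[i]/(val (Ordinal lt_i_n)) !ext_perm_lt perm1.
Qed.

Fact ext_perm_subproof n (s : 'S_n) :
  `[< bijective (ext_perm_fun s) /\
      exists m, forall i, (m <= i)%N -> ext_perm_fun s i = i >].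
Proof.
apply/asboolP; split; last by exists n => i; apply: ext_perm_ge.
by exists (ext_perm_fun s^-1%g) => i;
  rewrite -[LHS]ext_permM ?mulgV ?mulVg ext_perm1.
Qed.
Definition ext_perm n (s : 'S_n) : Sinf := MkSinf (ext_perm_subproof s).

Lemma ext_perm_morph n : {morph @ext_perm n : s t / (s * t)%g}.
Proof. by move=> s t; apply/sinfP; apply: ext_permM. Qed.

(* The Young embedding: s acts on the first m points and t on the last n. *)
Definition young_fun (m n : nat) (s : 'S_m) (t : 'S_n) (i : 'I_(m + n)%N) :
    'I_(m + n)%N :=
  match split i with
  | inl a => lshift n (s a)
  | inr b => rshift m (t b)
  end.

Lemma young_fun_lshift m n (s : 'S_m) (t : 'S_n) a :
  young_fun s t (lshift n a) = lshift n (s a).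
Proof. by rewrite /young_fun -[lshift n a]/(unsplit (inl a)) unsplitK. Qed.

Lemma young_fun_rshift m n (s : 'S_m) (t : 'S_n) b :
  young_fun s t (rshift m b) = rshift m (t b).
Proof. by rewrite /young_fun -[rshift m b]/(unsplit (inr b)) unsplitK. Qed.

Fact young_inj m n (s : 'S_m) (t : 'S_n) : injective (young_fun s t).
Proof.
apply: (can_inj (g := young_fun s^-1%g t^-1%g)) => i.
by case: (split_ordP i) => a ->;
  rewrite !(young_fun_lshift, young_fun_rshift) permK.
Qed.

Definition young (m n p : nat) (e : (m + n)%N = p) (s : 'S_m) (t : 'S_n) : 'S_p :=
  cast_perm e (perm (young_inj (s := s) (t := t))).

Lemma youngM (m n p : nat) (e : (m + n)%N = p) (s s' : 'S_m) (t t' : 'S_n) :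
  young e (s * s')%g (t * t')%g = (young e s t * young e s' t')%g.
Proof.
case: p / e; rewrite /young !cast_perm_id; apply/permP => i.
rewrite permM !permE; case: (split_ordP i) => a ->.
  by rewrite !young_fun_lshift permM.
by rewrite !young_fun_rshift permM.
Qed.

Section TIdeals.
Context (k : fieldType).

Definition kS (n : nat) := galg k 'S_n.
Definition kSinf := galg k Sinf.

Definition kS_incl n : kS n -> kSinf := galg_map (@ext_perm n).

(* The embedding of kS_m ⊗ kS_n in kS_p, p = m + n. *)
Definition young_tens (m n p : nat) (e : (m + n)%N = p) (z : tens (kS m) (kS n)) :
    kS p :=
  tlift (fun x y => lext (fun s => lext (fun t => gelt k (young e s t)) y) x) z.

(* I_n, with the convention I_0 = 0. *)
Definition level (I : set kSinf) (n : nat) : set (kS n) :=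
  if n is 0 then [set 0] else [set x | I (kS_incl x)].

Arguments level I n : clear implicits.

Lemma lext2_bilinear m n p (f : 'S_m -> 'S_n -> kS p) :
  bilinear2 (fun (x : kS m) (y : kS n) =>
    lext (fun s => lext (fun t => f s t) y) x : kS p).
Proof.
split=> [y c x x'|x c y y']; first exact: linearP.
rewrite !(@lextE _ _ _ _ x) scaler_sumr -big_split; apply: eq_bigr => g _ /=.
by rewrite linearP scalerDr !scalerA mulrC.
Qed.

Lemma young_tens_gelt m n p (e : (m + n)%N = p) (s : 'S_m) (t : 'S_n) :
  young_tens e (tensor (gelt k s) (gelt k t)) = gelt k (young e s t).
Proof. by rewrite /young_tens (tlift_tensor (lext2_bilinear _)) !lextU. Qed.

Definition T_prime (I : set kSinf) : Prop :=
  forall m n : nat, (0 < m)%N -> (0 < n)%N ->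
    level I (m + n)%N `&` range (young_tens (erefl (m + n)%N))
    = young_tens (erefl (m + n)%N) @`
        sum_subspace (tens_sub (level I m) setT) (tens_sub setT (level I n)).

Definition TSpec : set (set kSinf) :=
  [set I | [/\ is_ideal I, T_prime I & I <> [set 0]]].

Definition bowtie (I J : set kSinf) : set kSinf :=
  (@comult k Sinf) @^-1`
    sum_subspace (tens_sub I setT) (tens_sub setT J).

End TIdeals.

Arguments level {k} I n.
Arguments TSpec k : clear implicits.

Section Induced.
Context {k : fieldType} {G : groupType} {H : Type} (phi : H -> G).
Context {M : lmodType k} (act : H -> M -> M).

(* kG ⊗_{kH} M, where H acts on M by act and maps to G by phi. *)
Definition ind_rel : set (tens (galg k G) M) :=
  [set r | exists x h m,
     r = tensor (x * gelt k (phi h)) m - tensor x (act h m)].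

Definition Ind : lmodType k := lquot ind_rel.

Definition ind_act (x : galg k G) (w : Ind) : Ind :=
  lpi _ (tlift (fun y m => tensor (x * y) m) (lrepr w)).

Definition Ann_Ind : set (galg k G) := [set x | forall w, ind_act x w = 0].

Lemma ind_act_tensor x y m :
  ind_act x (lpi _ (tensor y m)) = lpi _ (tensor (x * y) m).
Proof.
have [tl tr] := @tensor_bilinear k (galg k G) M.
have bil : bilinear2 (fun y m => tensor (x * y) m : tens (galg k G) M).
  by split=> [w c v v'|v c w w'];
    rewrite ?mulrDr -?scalerAr; [apply: tl|apply: tr].
rewrite -[in RHS](tlift_tensor bil).
apply: (lpi_lrepr (tlift_linear bil)) => _ [y' [h [m' ->]]].
have -> u v : tlift (fun y m => tensor (x * y) m) (u - v) =
    tlift (fun y m => tensor (x * y) m) u -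
    tlift (fun y m => tensor (x * y) m) v :> tens (galg k G) M.
  by rewrite addrC -scaleN1r tlift_linear // scaleN1r addrC.
rewrite !(tlift_tensor bil) mulrA.
by apply: sub_span; exists (x * y'), h, m'.
Qed.

End Induced.

Section Dagger.
Context (k : fieldType).

(* The action of S_i on kS_i/U by left multiplication; well defined when U is
   a left ideal. *)
Definition quot_act i (U : set (kS k i)) (s : 'S_i) (a : lquot U) : lquot U :=
  lpi U (gelt k s * lrepr a).

Lemma quot_act_lpi i (U : set (kS k i)) :
  (forall (s : 'S_i) x, U x -> U (gelt k s * x)) ->
  forall (s : 'S_i) x, quot_act s (lpi U x) = lpi U (gelt k s * x).
Proof.
move=> Us s x; apply: (lpi_lrepr (F := fun y => gelt k s * y)) => [c u v|u Uu].
  by rewrite mulrDr scalerAr.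
by apply: sub_span; apply: Us.
Qed.

(* The action of G x H on the outer tensor product A ⊠ B. *)
Definition box_act (G H : Type) (A B : lmodType k) (actA : G -> A -> A)
    (actB : H -> B -> B) (g : G * H) : tens A B -> tens A B :=
  tlift (fun a b => tensor (actA g.1 a) (actB g.2 b)).

(* (I † J)_n, for n > 0. An ideal of kS_oo is determined by its intersections
   with the kS_n, n > 0. *)
Definition dagger_level (I J : set (kSinf k)) (n : nat) : set (kS k n) :=
  [set x | forall (i : nat) (le_i_n : (i <= n)%N),
     Ann_Ind (fun g : 'S_i * 'S_(n - i) => young (subnKC le_i_n) g.1 g.2)
       (box_act (quot_act (U := level I i)) (quot_act (U := level J (n - i))))
       x].

End Dagger.

Arguments dagger_level {k} I J n.

(* Main.v *)
Require Import Defs.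
From HB Require Import structures.
From mathcomp Require Import all_boot all_order all_algebra all_fingroup.
From mathcomp Require Import finmap boolp classical_sets monalg ring.

(** Everything is dualised. A linear form on the group algebra of a finite group
    is a function on the group, so an ideal I is known from the spaces A(X) of
    functions on Sym(X), X a finite set of natural numbers, that kill the part of
    I supported on Sym(X) ([perp] and [ideal_of]). Under this duality:

    - I is an ideal when the A(X) are stable under translations and relabelling
      and compatible with restriction;
    - I is T-prime when, for disjoint X and Y, the functions (x, y) |-> f (x y) on
      Sym(X) x Sym(Y) with f in A(X u Y) are exactly the sums of products
      a(x) b(y) with a in A(X) and b in A(Y);
    - the product of two ideals corresponds to the spans of the pointwise products
      a b ([bowtieE]);
    - the sum corresponds to the spans of the translates of the functions
      s |-> a (s restricted to P) b (s restricted to X \ P), extended by zero to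
      the s that do not preserve P. These are the matrix coefficients of the
      induced representations whose annihilators define the sum
      ([dagger_levelE]).

    A family A with the first two properties is called a [Tsystem] here, and
    ideals and systems determine each other by taking annihilators twice. Because
    the systems include restriction and extension for disjoint sets, the semiring
    laws become identities between explicit functions: pointwise multiplication is
    commutative and associative, splitting a set in three does not depend on the
    order of the two splittings ([sumsA]), and multiplying a product a b supported
    on the stabiliser of P by a function c only involves the restriction of c to
    Sym(P) x Sym(X \ P), which splits ([prods_sumsDl]). That sums of systems are
    again systems is a form of Mackey's formula ([sums_Tsystem]).

    What is left is that sums and products of nonzero ideals are nonzero. This is
    a growth argument of Regev. If I contains a nonzero element of the group
    algebra of S_m, then a function in A(X) is determined by its values on the
    permutations without decreasing subsequences of length m, since any other
    permutation can be rewritten modulo I in terms of lexicographically smaller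
    ones. There are at most C^|X| such permutations, with C independent of X
    ([perp_exp_bounded]). Exponential bounds on dimensions are inherited by
    products and sums, and n! outgrows every C^n, so the resulting ideals cannot
    vanish ([ideal_of_neq0]). *)

Set Implicit Arguments.
Unset Strict Implicit.
Unset Printing Implicit Defensive.

Import GRing.Theory.
Local Open Scope ring_scope.
Local Open Scope classical_set_scope.

(** * Finitary permutations of the natural numbers *)

Lemma sinfM (s t : Sinf) i : (s * t)%g i = t (s i).
Proof. by []. Qed.

Lemma sinfK (s : Sinf) : cancel s s^-1%g.
Proof. by move=> i; rewrite -sinfM mulgV. Qed.

Lemma sinfKV (s : Sinf) : cancel s^-1%g s.
Proof. by move=> i; rewrite -sinfM mulVg. Qed.

Lemma sinf_inj (s : Sinf) : injective s.
Proof. exact: can_inj (sinfK s). Qed.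

Definition Sym (X : {fset nat}) : set Sinf :=
  [set s | forall i, i \notin X -> s i = i].

Definition maps (s : Sinf) (X Y : {fset nat}) : Prop :=
  forall i, (s i \in Y) = (i \in X).

Lemma SymP X s : Sym X s -> maps s X X.
Proof.
move=> sX i; case iX: (i \in X); last by rewrite sX ?iX.
by case siX: (s i \in X) => //; rewrite -(sinf_inj (sX _ (negbT siX))) siX in iX.
Qed.

Lemma Sym1 X : Sym X 1%g.
Proof. by []. Qed.

Lemma SymM X s t : Sym X s -> Sym X t -> Sym X (s * t)%g.
Proof. by move=> sX tX i iX; rewrite sinfM sX // tX. Qed.

Lemma SymV X s : Sym X s -> Sym X s^-1%g.
Proof. by move=> sX i iX; apply: (sinf_inj (s := s)); rewrite sinfKV sX. Qed.

Lemma Sym_sub (X Y : {fset nat}) s : {subset X <= Y} -> Sym X s -> Sym Y s.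
Proof. by move=> XY sX i iY; apply: sX; apply: contra iY => /XY. Qed.

Lemma SymI (X Y : {fset nat}) s : Sym X s -> Sym Y s -> Sym (X `&` Y)%fset s.
Proof.
by move=> sX sY i; rewrite inE negb_and => /orP[/sX|/sY].
Qed.

Lemma Sym0 s : Sym fset0 s -> s = 1%g.
Proof. by move=> s0; apply/sinfP => i; rewrite s0. Qed.

Lemma Sym_comm X Y s t : [disjoint X & Y]%fset -> Sym X s -> Sym Y t ->
  (s * t = t * s)%g.
Proof.
move=> /fdisjointP XY sX tY; apply/sinfP => i; rewrite !sinfM.
case iX: (i \in X).
  by rewrite (tY i) ?XY // tY // XY // (SymP sX).
rewrite (sX i) ?iX //; case iY: (i \in Y); last by rewrite tY ?iY // sX ?iX.
rewrite [RHS]sX //; apply/negP => /XY; by rewrite (SymP tY) iY.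
Qed.

Lemma Sym_setU X Y s t : Sym X s -> Sym Y t -> Sym (X `|` Y)%fset (s * t)%g.
Proof.
by move=> sX tY; apply: SymM; [apply: Sym_sub sX|apply: Sym_sub tY] => i;
  rewrite inE => ->; rewrite ?orbT.
Qed.

Lemma mapsM s t X Y Z : maps s X Y -> maps t Y Z -> maps (s * t)%g X Z.
Proof. by move=> sXY tYZ i; rewrite sinfM tYZ sXY. Qed.

Lemma mapsV s X Y : maps s X Y -> maps s^-1%g Y X.
Proof. by move=> sXY i; rewrite -sXY sinfKV. Qed.

Definition img (s : Sinf) (X : {fset nat}) : {fset nat} :=
  [fset s i | i in X]%fset.

Lemma maps_img s X : maps s X (img s X).
Proof. by move=> i; rewrite /img mem_imfset //; apply: sinf_inj. Qed.

Lemma mapsD s X Y P Q : maps s X Y -> maps s P Q ->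
  maps s (X `\` P)%fset (Y `\` Q)%fset.
Proof. by move=> sXY sPQ i; rewrite !inE sXY sPQ. Qed.

Lemma maps_subset s X Y P Q : maps s X Y -> maps s P Q ->
  {subset P <= X} -> {subset Q <= Y}.
Proof.
by move=> sXY sPQ PX i; rewrite -(sinfKV s i) sPQ sXY => /PX.
Qed.

Lemma maps_card s X Y : maps s X Y -> #|` X| = #|` Y|.
Proof.
move=> sXY; suff -> : Y = img s X by rewrite card_imfset //; apply: sinf_inj.
by apply/fsetP => i; rewrite -(sinfKV s i) sXY maps_img.
Qed.

Lemma Sym_conj s X Y t : maps s X Y -> Sym Y t -> Sym X (s * t * s^-1)%g.
Proof.
by move=> sXY tY i iX; rewrite !sinfM tY ?sinfK // sXY.
Qed.

Lemma Sym_conjV s X Y t : maps s X Y -> Sym X t -> Sym Y (s^-1 * t * s)%g.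
Proof. by move=> /mapsV sYX /(Sym_conj sYX); rewrite invgK. Qed.

(** When [s] does not preserve [P], no permutation agrees with [s] on [P] and
    is trivial elsewhere, and the value is the identity. *)
Definition restr (P : {fset nat}) (s : Sinf) : Sinf :=
  if pselect (exists t : Sinf, forall i, t i = if i \in P then s i else i)
    is left h then sval (cid h) else 1%g.

Lemma restrE P s i : maps s P P -> restr P s i = if i \in P then s i else i.
Proof.
move=> sP; rewrite /restr; case: pselect => [h|[]]; first by case: (cid h) => /= t.
pose f r i := if i \in P then sinf_fun r i else i.
have fK (r r' : Sinf) : maps r P P -> cancel r r' -> cancel (f r) (f r').
  by move=> rP rK j; rewrite /f; case jP: (j \in P); rewrite ?rP ?jP.
have sf : `[< bijective (f s) /\ exists n, forall i, (n <= i)%N -> f s i = i >].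
  apply/asboolP; split.
    by exists (f s^-1%g); apply: fK => //; [exact: sinfK|exact: mapsV|exact: sinfKV].
  by have [n sn] := sinf_bound s; exists n => j /sn sj; rewrite /f sj if_same.
by exists (MkSinf sf).
Qed.

Lemma restr_Sym P s : maps s P P -> Sym P (restr P s).
Proof. by move=> sP i /negbTE iP; rewrite restrE // iP. Qed.

Lemma restr_id P s : Sym P s -> restr P s = s.
Proof.
move=> sP; apply/sinfP => i; rewrite restrE; last exact: SymP.
by case: ifPn => // /sP.
Qed.

Lemma restr1 P : restr P 1%g = 1%g.
Proof. exact: restr_id. Qed.

Lemma restrM P s t : maps s P P -> maps t P P ->
  restr P (s * t)%g = (restr P s * restr P t)%g.
Proof.
move=> sP tP; apply/sinfP => i; rewrite sinfM !restrE //; last exact: mapsM tP.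
by case: (boolP (i \in P)) => iP; rewrite ?sP ?iP ?sinfM // (negbTE iP).
Qed.

Lemma Sym_disj_maps P Q s : [disjoint P & Q]%fset -> Sym Q s -> maps s P P.
Proof.
move=> /fdisjointP PQ sQ i; case iP: (i \in P); first by rewrite sQ ?PQ.
apply/negP => siP; move/(_ _ siP): PQ; rewrite (SymP sQ) => /sQ sii.
by rewrite -sii siP in iP.
Qed.

Lemma restr_disj P Q s : [disjoint P & Q]%fset -> Sym Q s -> restr P s = 1%g.
Proof.
move=> PQ sQ; apply/sinfP => i; rewrite restrE; last exact: Sym_disj_maps sQ.
by case: ifPn => // iP; rewrite sQ // (fdisjointP PQ).
Qed.

Lemma restr_conj s P Q t : maps s P Q -> maps t Q Q ->
  restr P (s * t * s^-1)%g = (s * restr Q t * s^-1)%g.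
Proof.
move=> sPQ tQ; apply/sinfP => i; rewrite !sinfM !restrE //; last first.
  by apply: mapsM (mapsV sPQ); apply: mapsM tQ.
by rewrite sPQ; case: ifP => // _; rewrite sinfK.
Qed.

Lemma mapsC X P s : {subset P <= X} -> Sym X s -> maps s P P ->
  maps s (X `\` P)%fset (X `\` P)%fset.
Proof. by move=> PX sX sP; apply: mapsD => //; apply: SymP. Qed.

Lemma restr_split X P s : Sym X s -> maps s P P ->
  s = (restr P s * restr (X `\` P)%fset s)%g.
Proof.
move=> sX sP; apply/sinfP => i; rewrite sinfM !restrE //; last first.
  by apply: mapsD => //; apply: SymP.
case: (boolP (i \in P)) => iP.
  by rewrite inE sP iP.
by rewrite inE iP /=; case: ifPn => // /sX.
Qed.

Lemma mapsU s P Q : maps s P P -> maps s Q Q ->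
  maps s (P `|` Q)%fset (P `|` Q)%fset.
Proof. by move=> sP sQ i; rewrite !inE sP sQ. Qed.

Lemma restr_restr (P Q : {fset nat}) s : {subset Q <= P} -> maps s P P ->
  maps s Q Q -> restr Q (restr P s) = restr Q s.
Proof.
move=> QP sP sQ; have rQ : maps (restr P s) Q Q.
  by move=> i; rewrite restrE //; case: ifP.
apply/sinfP => i; rewrite !restrE //; case: ifP => // /QP iP.
by rewrite iP.
Qed.

Lemma maps_restr (P Q : {fset nat}) s : {subset Q <= P} -> maps s P P ->
  maps (restr P s) Q Q <-> maps s Q Q.
Proof.
move=> QP sP; split=> sQ i.
  have := sQ i; rewrite restrE //; case: (boolP (i \in P)) => // iP _.
  have iQ : (i \in Q) = false by apply/negP => /QP; rewrite (negbTE iP).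
  by rewrite iQ; apply/negP => /QP; rewrite sP (negbTE iP).
by rewrite restrE //; case: ifP.
Qed.

(** Both lists are completed to enumerations of [X], which are then matched
    position by position. *)
Lemma sym_ext_seq (X : {fset nat}) (a b : seq nat) :
  uniq a -> uniq b -> size a = size b ->
  {subset a <= X} -> {subset b <= X} ->
  exists2 s, Sym X s & forall i, (i < size a)%N -> s (nth 0%N a i) = nth 0%N b i.
Proof.
move=> ua ub sab aX bX.
pose cpl (c : seq nat) := c ++ [seq x <- X | x \notin c].
have cpl_perm (c : seq nat) : uniq c -> {subset c <= X} -> perm_eq (cpl c) X.
  move=> uc cX; apply: uniq_perm => [||x]; last 2 first.
  - exact: fset_uniq.
  - by rewrite mem_cat mem_filter; case: (boolP (x \in c)) => //= /cX ->.
  rewrite cat_uniq uc filter_uniq ?fset_uniq // andbT /=.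
  by apply/hasPn => x; rewrite mem_filter => /andP[].
have pa := cpl_perm _ ua aX; have pb := cpl_perm _ ub bX.
have Ua : uniq (cpl a) by rewrite (perm_uniq pa) fset_uniq.
have Ub : uniq (cpl b) by rewrite (perm_uniq pb) fset_uniq.
have Sab : size (cpl a) = size (cpl b) by rewrite (perm_size pa) (perm_size pb).
pose tr c d i := nth i (cpl d) (index i (cpl c)).
have trout c d i : size (cpl c) = size (cpl d) -> perm_eq (cpl c) X ->
    i \notin X -> tr c d i = i.
  move=> scd pc iX; rewrite /tr nth_default // -scd leqNgt index_mem.
  by rewrite (perm_mem pc).
have trin c d i : size (cpl c) = size (cpl d) -> perm_eq (cpl c) X ->
    perm_eq (cpl d) X -> i \in X -> tr c d i \in X.
  move=> scd pc pd iX; rewrite /tr -(perm_mem pd) mem_nth // -scd index_mem.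
  by rewrite (perm_mem pc).
have trK c d : size (cpl c) = size (cpl d) -> perm_eq (cpl c) X ->
    perm_eq (cpl d) X -> uniq (cpl d) -> cancel (tr c d) (tr d c).
  move=> scd pc pd ud i; case: (boolP (i \in X)) => iX; last first.
    by rewrite !trout.
  have ic : (index i (cpl c) < size (cpl d))%N.
    by rewrite -scd index_mem (perm_mem pc).
  have e : index (tr c d i) (cpl d) = index i (cpl c) by rewrite index_uniq.
  have ici : (index i (cpl c) < size (cpl c))%N by rewrite scd.
  rewrite {1}/tr e (set_nth_default i) // nth_index //.
  by rewrite (perm_mem pc).
have trb : `[< bijective (tr a b) /\
    exists n, forall i, (n <= i)%N -> tr a b i = i >].
  apply/asboolP; split; first by exists (tr b a); apply: trK.
  exists (\max_(x <- X) x.+1) => i lei; apply: trout => //.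
  apply/negP => iX; move: lei; rewrite leqNgt => /negP; apply.
  by rewrite (big_rem i) //= leq_max ltnSn.
exists (MkSinf trb) => [i iX|i ia] /=; first exact: trout.
rewrite /tr [in index _ _](_ : nth 0%N a i = nth 0%N (cpl a) i); last first.
  by rewrite nth_cat ia.
rewrite index_uniq //; last by rewrite size_cat ltn_addr.
rewrite nth_cat -sab ia; apply: set_nth_default; by rewrite -sab.
Qed.

Lemma sym_transitive (X P Q : {fset nat}) : {subset P <= X} -> {subset Q <= X} ->
  #|` P| = #|` Q| -> exists2 s, Sym X s & maps s P Q.
Proof.
move=> PX QX cPQ.
have [s sX sPQ] := sym_ext_seq (fset_uniq P) (fset_uniq Q) cPQ PX QX.
have hom i : i \in P -> s i \in Q.
  by move=> iP; rewrite -(nth_index 0%N iP) sPQ ?index_mem // mem_nth // -cPQ index_mem.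
have eQ : img s P = Q.
  apply/eqP; rewrite eqEfcard card_imfset; last exact: sinf_inj.
  rewrite cPQ leqnn andbT; apply/fsubsetP => _ /imfsetP[i iP ->]; exact: hom.
by exists s => // i; rewrite -{1}eQ maps_img.
Qed.

Lemma Sym_ltn_ext n (s : Sinf) : (forall i, (n <= i)%N -> s i = i) ->
  exists t : 'S_n, ext_perm t = s.
Proof.
move=> sn.
have sX : forall i : 'I_n, (s i < n)%N.
  move=> i; rewrite ltnNge; apply/negP => le; have := sn _ le.
  move/(sinf_inj (s := s)) => e; have := ltn_ord i; rewrite -{1}e ltnNge le //.
pose f i := Ordinal (sX i).
have fI : injective f by move=> i j [/(sinf_inj (s := s))/val_inj].
exists (perm fI); apply/sinfP => i.
case: (ltnP i n) => lin; last by rewrite sn //; exact: ext_perm_ge.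
by have /= := ext_perm_lt (perm fI) (Ordinal lin); rewrite permE.
Qed.

Lemma ext_perm_inj n : injective (@ext_perm n).
Proof.
move=> s t st; apply/permP => i; have: ext_perm s i = ext_perm t i by rewrite st.
by rewrite /= !ext_perm_lt => /val_inj.
Qed.

Lemma ext_permV n (s : 'S_n) : ext_perm s^-1%g = (ext_perm s)^-1%g.
Proof.
apply: (mulgI (ext_perm s)); rewrite mulgV -ext_perm_morph mulgV.
by apply/sinfP => i; rewrite /= ext_perm1.
Qed.

Definition ival (m n : nat) : {fset nat} := [fset i in iota m n]%fset.

Lemma in_ival m n i : (i \in ival m n) = (m <= i < m + n)%N.
Proof. by rewrite in_fset mem_iota. Qed.

Lemma card_ival m n : #|` ival m n| = n.
Proof. by rewrite card_fseq undup_id ?iota_uniq // size_iota. Qed.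

Lemma Sym_ext n (t : 'S_n) : Sym (ival 0 n) (ext_perm t).
Proof. by move=> i; rewrite in_ival /= -leqNgt; apply: ext_perm_ge. Qed.

Lemma Sym_extP n s : Sym (ival 0 n) s -> exists t : 'S_n, ext_perm t = s.
Proof.
move=> sn; apply: Sym_ltn_ext => i ni; apply: sn.
by rewrite in_ival /= add0n -leqNgt.
Qed.

Lemma fset_bounded (X : {fset nat}) : exists2 n, (0 < n)%N &
  forall m, (n <= m)%N -> {subset X <= ival 0 m}.
Proof.
exists (\max_(x <- X) x.+1).+1 => // m nm i iX; rewrite in_ival /= add0n.
apply: leq_trans nm; rewrite ltnS; apply: leq_trans (leqnSn _) _.
by rewrite (big_rem i) //= leq_max leqnn.
Qed.

Lemma Sym_finite X : exists L : seq Sinf, forall s, Sym X s -> s \in L.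
Proof.
have [n _ /(_ n (leqnn _)) nX] := fset_bounded X.
exists [seq ext_perm t | t <- enum 'S_n] => s /(Sym_sub nX)/Sym_extP[t <-].
by apply: map_f; rewrite mem_enum.
Qed.

(** * Linear functions on a group algebra *)

Section Pairing.
Context {k : fieldType} {G : groupType}.
Implicit Types (f g : G -> k) (x y : galg k G) (s t : G).

Definition ev f x : k := lext (f : G -> k^o) x.

Lemma evP f c x y : ev f (c *: x + y) = c * ev f x + ev f y.
Proof. exact: (linearP (lext (f : G -> k^o))). Qed.

Lemma ev0 f : ev f 0 = 0.
Proof. exact: (raddf0 (lext (f : G -> k^o))). Qed.

Lemma evD f x y : ev f (x + y) = ev f x + ev f y.
Proof. by have := evP f 1 x y; rewrite scale1r mul1r. Qed.

Lemma evZ f c x : ev f (c *: x) = c * ev f x.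
Proof. by have := evP f c x 0; rewrite ev0 !addr0. Qed.

Lemma evB f x y : ev f (x - y) = ev f x - ev f y.
Proof. by rewrite evD -scaleN1r evZ mulN1r. Qed.

Lemma ev_sum f (I : Type) (r : seq I) (P : pred I) (F : I -> galg k G) :
  ev f (\sum_(i <- r | P i) F i) = \sum_(i <- r | P i) ev f (F i).
Proof. exact: (raddf_sum (lext (f : G -> k^o))). Qed.

Lemma ev_gelt f s : ev f (gelt k s) = f s.
Proof. by rewrite /ev /gelt lextU. Qed.

Lemma ev_lin c f g x : ev (fun s => c * f s + g s) x = c * ev f x + ev g x.
Proof.
elim/(@galg_ind k): x => [|d x y ex ey|s]; rewrite ?ev_gelt //.
  by rewrite !ev0 mulr0 addr0.
by rewrite !evP ex ey; ring.
Qed.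

Lemma ev0f x : ev (fun=> 0) x = 0.
Proof.
elim/(@galg_ind k): x => [|d x y ex ey|s]; rewrite ?ev_gelt ?ev0 //.
by rewrite evP ex ey mulr0 addr0.
Qed.

Lemma ev_linr c f x : ev (fun s => f s * c) x = ev f x * c.
Proof.
elim/(@galg_ind k): x => [|d x y ex ey|s]; rewrite ?ev_gelt ?ev0 ?mul0r //.
by rewrite !evP ex ey; ring.
Qed.

Lemma ev_sumf (I : Type) (r : seq I) (F : I -> G -> k) x :
  ev (fun s => \sum_(i <- r) F i s) x = \sum_(i <- r) ev (F i) x.
Proof.
elim: r => [|i r IH].
  by rewrite big_nil -[RHS](ev0f x); congr (ev _ x); apply/funext => s; rewrite big_nil.
rewrite big_cons -IH -[ev (F i) x]mul1r -ev_lin; congr (ev _ x).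
by apply/funext => s; rewrite big_cons mul1r.
Qed.

Lemma ev_mull f s x : ev f (gelt k s * x) = ev (fun t => f (s * t)%g) x.
Proof.
elim/(@galg_ind k): x => [|d x y ex ey|t]; first by rewrite mulr0 !ev0.
  by rewrite mulrDr -scalerAr !evP ex ey.
by rewrite -geltM !ev_gelt.
Qed.

Lemma ev_mulr f s x : ev f (x * gelt k s) = ev (fun t => f (t * s)%g) x.
Proof.
elim/(@galg_ind k): x => [|d x y ex ey|t]; first by rewrite mul0r !ev0.
  by rewrite mulrDl -scalerAl !evP ex ey.
by rewrite -geltM !ev_gelt.
Qed.

Lemma mcoeff_ev s x : ev (fun t => (t == s)%:R) x = x@_s.
Proof.
elim/(@galg_ind k): x => [|d x y ex ey|t]; first by rewrite ev0 mcoeff0.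
  by rewrite evP ex ey mcoeffD mcoeffZ.
by rewrite ev_gelt; apply/esym/mcoeffU.
Qed.

Lemma galgE x : x = \sum_(s <- msupp x) x@_s *: gelt k s.
Proof. by rewrite -[LHS](lext_id x) lextE. Qed.

Lemma evE f x : ev f x = \sum_(s <- msupp x) x@_s * f s.
Proof. by rewrite {1}(galgE x) ev_sum; apply: eq_bigr => s _; rewrite evZ ev_gelt. Qed.

(** [x] is a combination of elements of [D]. Testing against the functions that
    vanish on [D] makes stability under the algebra operations immediate. *)
Definition carried (D : set G) x : Prop :=
  forall f, (forall s, D s -> f s = 0) -> ev f x = 0.

Lemma carried_gelt D s : D s -> carried D (gelt k s).
Proof. by move=> Ds f /(_ s Ds); rewrite ev_gelt. Qed.

Lemma carried_geltE D s : carried D (gelt k s) -> D s.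
Proof.
move=> Ds; apply: contrapT => nDs; have := Ds (fun t => (`[< ~ D t >])%:R).
rewrite ev_gelt asboolT // => h; have /eqP := oner_neq0 k; apply; apply: h.
by move=> t Dt; case: asboolP.
Qed.

Lemma carriedP D c x y : carried D x -> carried D y -> carried D (c *: x + y).
Proof. by move=> Dx Dy f f0; rewrite evP Dx // Dy // mulr0 addr0. Qed.

Lemma carried0 D : carried D 0.
Proof. by move=> f _; rewrite ev0. Qed.

Lemma carriedD D x y : carried D x -> carried D y -> carried D (x + y).
Proof. by move=> Dx Dy; rewrite -[x]scale1r; apply: carriedP. Qed.

Lemma carriedZ D c x : carried D x -> carried D (c *: x).
Proof. by move=> Dx; rewrite -[c *: x]addr0; apply: carriedP => //; apply: carried0. Qed.

Lemma carriedB D x y : carried D x -> carried D y -> carried D (x - y).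
Proof. by move=> Dx Dy; rewrite addrC -scaleN1r; apply: carriedP. Qed.

Lemma carried_sum D (I : Type) (r : seq I) (P : pred I) F :
  (forall i, P i -> carried D (F i)) -> carried D (\sum_(i <- r | P i) F i).
Proof.
move=> DF; elim/big_rec: _ => [|i x Pi Dx]; first exact: carried0.
by apply: carriedD => //; apply: DF.
Qed.

Lemma carried_sub (D E : set G) x : D `<=` E -> carried D x -> carried E x.
Proof. by move=> DE Dx f f0; apply: Dx => s /DE/f0. Qed.

Lemma carried_eq D f g x : carried D x -> (forall s, D s -> f s = g s) ->
  ev f x = ev g x.
Proof.
move=> Dx fg; apply/eqP; rewrite -subr_eq0 -mulN1r addrC -ev_lin; apply/eqP/Dx.
by move=> s /fg ->; rewrite mulN1r addNr.
Qed.

Lemma carried_mcoeff D x s : carried D x -> s \in msupp x -> D s.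
Proof.
move=> Dx; apply: contraPP => nDs; apply/negP.
rewrite -mcoeff_eq0 -mcoeff_ev; apply/eqP/Dx => t Dt.
by case: eqP => // ts; case: nDs; rewrite -ts.
Qed.

Lemma carriedI (D E : set G) x : carried D x -> carried E x -> carried (D `&` E) x.
Proof.
move=> Dx Ex f f0; rewrite -(ev0f x).
have -> : ev f x = ev (fun s => if `[<D s>] then f s else 0) x.
  by apply: (carried_eq Dx) => s /asboolP ->.
by apply: (carried_eq Ex) => s Es; case: asboolP => // Ds; apply: f0.
Qed.

End Pairing.
Arguments carried {k G} D x.

(** By induction on the list of points: if some member of [U] takes the value 1
    at the new point, that point and this function join the family found for
    the subspace vanishing there. A subspace of functions thus has, on finitely
    many points, a generating family whose coordinate functions are
    evaluations; both double annihilator lemmas, and all the splittings of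
    tensors below, come from this. *)
Lemma interpolation (k : fieldType) (T : eqType) (x0 : T) (L : seq T)
    (U : set (T -> k)) :
  U (fun=> 0) ->
  (forall c f g, U f -> U g -> U (fun x => c * f x + g x)) ->
  exists n (t : nat -> T) (u : nat -> T -> k), [/\ (n <= size L)%N,
    forall i, (i < n)%N -> t i \in L, forall i, U (u i) &
    forall f, U f -> forall x, x \in L -> f x = \sum_(i < n) f (t i) * u i x].
Proof.
elim: L U => [|y L IH] U U0 Ulin; first by exists 0%N, (fun=> x0), (fun _ _ => 0).
have [y0|/existsNP[u0 /not_implyP[Uu0 /eqP u0y]]] :=
  pselect (forall f, U f -> f y = 0).
  have [n [t [u [nL tL uU fE]]]] := IH U U0 Ulin.
  exists n, t, u; split=> // [|i /tL|f Uf x].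
  - exact: leqW.
  - by rewrite inE orbC => ->.
  rewrite inE => /orP[/eqP->|/fE->//].
  by rewrite y0 // big1 // => i _; rewrite (y0 (u i)) // mulr0.
pose w x := (u0 y)^-1 * u0 x + 0.
have Uw : U w by apply: (Ulin _ u0 (fun=> 0)).
have wy : w y = 1 by rewrite /w addr0 mulVf.
have [||n [t [u [nL tL uU fE]]]] := IH [set f | U f /\ f y = 0].
- by split.
- by move=> c f g [Uf f0] [Ug g0]; split; [apply: Ulin|rewrite f0 g0 mulr0 addr0].
exists n.+1, (fun i => if i is j.+1 then t j else y),
  (fun i => if i is j.+1 then u j
            else (fun x => w x - \sum_(j < n) w (t j) * u j x)); split=> //.
- by case=> [|i] //=; rewrite inE ?eqxx // => /tL ->; rewrite orbT.
- case=> [|i]; last by case: (uU i).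
  have -> : (fun x => w x - \sum_(j < n) w (t j) * u j x) =
            (fun x => -1 * (\sum_(j < n) w (t j) * u j x) + w x).
    by apply/funext => x; rewrite mulN1r addrC.
  apply: (Ulin) => //; elim: (index_enum _) => [|j r Ur].
    by under eq_fun do rewrite big_nil.
  by under eq_fun do rewrite big_cons; apply: Ulin => //; case: (uU j).
move=> f Uf x xyL; rewrite big_ord_recl /=.
pose h x := - f y * w x + f x.
have Uh : U h /\ h y = 0.
  by split; [apply: Ulin|rewrite /h wy mulr1 addNr].
have hE : h x = \sum_(i < n) h (t i) * u i x.
  move: xyL; rewrite inE => /orP[/eqP->|/(fE h Uh)//].
  by rewrite Uh.2 big1 // => i _; case: (uU i) => _ ->; rewrite mulr0.
have -> : f x = f y * w x + h x by rewrite /h mulNr addNKr.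
rewrite hE mulrBr -addrA; congr (_ + _); rewrite mulr_sumr -sumrN -big_split /=.
by apply: eq_bigr => i _; rewrite /h; ring.
Qed.

Section Duality.
Context {k : fieldType}.
Local Notation fn := (Sinf -> k).
Implicit Types (f g u : fn) (X Y : {fset nat}) (D : set Sinf) (x z : kSinf k).

Definition linear_set (U : set fn) : Prop :=
  U (fun=> 0) /\ forall c f g, U f -> U g -> U (fun s => c * f s + g s).

Lemma linear_set_sum (U : set fn) n (c : nat -> k) (u : nat -> fn) :
  linear_set U -> (forall i, U (u i)) -> U (fun s => \sum_(i < n) c i * u i s).
Proof.
move=> [U0 Ulin] Uu; elim: (index_enum _) => [|j r Ur].
  by under eq_fun do rewrite big_nil.
by under eq_fun do rewrite big_cons; apply: Ulin.
Qed.

Definition finite_in D := exists L : seq Sinf, forall s, D s -> s \in L.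

Lemma interpolation_on D (U : set fn) : finite_in D -> linear_set U ->
  exists n (t : nat -> Sinf) (u : nat -> fn),
    [/\ forall i, (i < n)%N -> D (t i), forall i, U (u i) &
    forall f, U f -> forall s, D s -> f s = \sum_(i < n) f (t i) * u i s].
Proof.
move=> [L DL] [U0 Ulin].
have [n [t [u [_ tL uU fE]]]] :=
  interpolation 1%g [seq s <- L | `[< D s >]] U0 Ulin.
exists n, t, u; split=> // [i /tL|f Uf s Ds].
  by rewrite mem_filter => /andP[/asboolP].
by apply: fE => //; rewrite mem_filter DL // andbT; apply/asboolP.
Qed.

(** With [t] and [u] interpolating [U], the element [s - \sum_i u i s * t i] is
    killed by [U], hence by [f]: this expresses [f s] through the values of [f]
    at the [t i]. *)
Lemma double_annihilator_fun D (U : set fn) f : finite_in D -> linear_set U ->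
  (forall z, carried D z -> (forall u, U u -> ev u z = 0) -> ev f z = 0) ->
  exists2 u, U u & forall s, D s -> f s = u s.
Proof.
move=> Dfin Ulin f0; have [n [t [u [tD uU gE]]]] := interpolation_on Dfin Ulin.
exists (fun s => \sum_(i < n) f (t i) * u i s).
  exact: (linear_set_sum n (fun i => f (t i)) Ulin uU).
move=> s Ds; pose z := gelt k s - \sum_(i < n) u i s *: gelt k (t i).
have zE g : ev g z = g s - \sum_(i < n) g (t i) * u i s.
  rewrite /z evB ev_gelt ev_sum; congr (_ - _); apply: eq_bigr => i _.
  by rewrite evZ ev_gelt mulrC.
apply/eqP; rewrite -subr_eq0 -zE; apply/eqP/f0.
  apply: carriedB; first exact: carried_gelt.
  by apply: carried_sum => i _; apply: carriedZ; apply: carried_gelt; apply: tD.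
by move=> g Ug; rewrite zE -gE // subrr.
Qed.

(** Interpolation applied to the coefficient functions of the elements of [W]:
    the functions [r |-> (r == s) - \sum_i u i s * (r == t i)] kill [W], hence
    [x]. *)
Lemma double_annihilator_alg D (W : set (kSinf k)) x :
  finite_in D -> is_subspace W -> carried D x ->
  (forall f, (forall z, W z -> carried D z -> ev f z = 0) -> ev f x = 0) -> W x.
Proof.
move=> Dfin [W0 Wlin] Dx x0.
pose U : set fn := [set f | exists z, [/\ W z, carried D z &
  forall s, f s = ev (fun t => (t == s)%:R) z]].
have Ulin : linear_set U.
  split; first by exists 0; split=> // [|s]; rewrite ?ev0 //; apply: carried0.
  move=> c f g [z [Wz Dz fz]] [y [Wy Dy gy]]; exists (c *: z + y).
  by split=> [||s]; [apply: Wlin|apply: carriedP|rewrite evP fz gy].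
have [n [t [u [tD uU gE]]]] := interpolation_on Dfin Ulin.
have [z zP] := choice uU.
have -> : x = \sum_(i < n) x@_(t i) *: z i.
  have Dy : carried D (\sum_(i < n) x@_(t i) *: z i).
    by apply: carried_sum => i _; apply: carriedZ; case: (zP i).
  apply/malgP => s; have [Ds|nDs] := pselect (D s); last first.
    rewrite -!mcoeff_ev Dx ?Dy //; move=> r Dr; case: eqP => // rs;
    by case: nDs; rewrite -rs.
  pose f r : k := (r == s)%:R - \sum_(i < n) u i s * (r == t i)%:R.
  have fE y : ev f y = y@_s - \sum_(i < n) u i s * y@_(t i).
    rewrite -mcoeff_ev -[in RHS]mulN1r addrC.
    rewrite (_ : f = fun r => -1 * (\sum_(i < n) u i s * (r == t i)%:R) + (r == s)%:R).
      rewrite ev_lin ev_sumf; congr (_ * _ + _); apply: eq_bigr => i _.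
      rewrite -mcoeff_ev mulrC -ev_linr; congr (ev _ _); apply/funext => r.
      by rewrite mulrC.
    by apply/funext => r; rewrite mulN1r addrC.
  have : ev f x = 0.
    apply: x0 => y Wy Dy'; rewrite fE.
    have Uy : U (fun s => y@_s) by exists y; split=> // r; rewrite mcoeff_ev.
    rewrite {1}(gE _ Uy s Ds) -sumrB big1 // => i _.
    by rewrite mulrC subrr.
  rewrite fE => /eqP; rewrite subr_eq0 => /eqP ->.
  rewrite -[RHS]mcoeff_ev ev_sum; apply: eq_bigr => i _.
  by rewrite evZ mulrC; case: (zP i) => _ _ ->.
elim/big_rec: _ => // i y _ Wy; apply: Wlin => //; by case: (zP i).
Qed.

End Duality.

(** * Systems of functions dual to T-prime ideals *)

Section Systems.
Context {k : fieldType}.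
Local Notation fn := (Sinf -> k).
Implicit Types (f g u : fn) (X Y Z : {fset nat}) (s t : Sinf) (x z : kSinf k).
Implicit Types (A B : set fn) (F : Sinf -> Sinf -> k) (U V : {fset nat} -> set fn).

(** The tensor product of [A] and [B], realised as functions of two variables. *)
Inductive tensors A B : (Sinf -> Sinf -> k) -> Prop :=
| Tensors0 : tensors A B (fun _ _ => 0)
| TensorsS a b F : A a -> B b -> tensors A B F ->
    tensors A B (fun s t => a s * b t + F s t).

(** What the spaces of functions killing a T-prime ideal satisfy. Invariance
    under translations is the ideal property; [ts_res] and [ts_ext] say that
    restricting [U (X u Y)] to Sym(X) x Sym(Y) gives exactly the tensor product
    of [U X] and [U Y], which is T-primeness. With [ts_one], the component at
    the empty set consists of all functions on the trivial group. *)
Record Tsystem U : Prop := {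
  ts_lin : forall X, linear_set (U X);
  ts_loc : forall X f g, U X f -> (forall s, Sym X s -> f s = g s) -> U X g;
  ts_conj : forall X Y s f, maps s X Y -> U X f ->
    U Y (fun t => f (s * t * s^-1)%g);
  ts_left : forall X s f, Sym X s -> U X f -> U X (fun t => f (s * t)%g);
  ts_res : forall X Y f, [disjoint X & Y]%fset -> U (X `|` Y)%fset f ->
    exists2 F, tensors (U X) (U Y) F &
      forall s t, Sym X s -> Sym Y t -> f (s * t)%g = F s t;
  ts_ext : forall X Y a b, [disjoint X & Y]%fset -> U X a -> U Y b ->
    exists2 f, U (X `|` Y)%fset f &
      forall s t, Sym X s -> Sym Y t -> f (s * t)%g = a s * b t;
  ts_one : U fset0 (fun=> 1) }.

Lemma linear_setD A f g : linear_set A -> A f -> A g -> A (fun s => f s + g s).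
Proof.
move=> [_ Al] Af Ag; rewrite (_ : (fun s => _) = (fun s => 1 * f s + g s)).
  exact: Al.
by apply/funext => s; rewrite mul1r.
Qed.

Lemma linear_setZ A c f : linear_set A -> A f -> A (fun s => c * f s).
Proof.
move=> [A0 Al] Af; rewrite (_ : (fun s => _) = (fun s => c * f s + 0)).
  exact: (Al c f (fun=> 0)).
by apply/funext => s; rewrite addr0.
Qed.

Lemma tensorsD A B F F' : tensors A B F -> tensors A B F' ->
  tensors A B (fun s t => F s t + F' s t).
Proof.
move=> AF AF'; elim: AF => [|a b E Aa Bb AE IH].
  by under eq_fun => s do under eq_fun => t do rewrite add0r.
under eq_fun => s do under eq_fun => t do rewrite -addrA.
exact: TensorsS.
Qed.

Lemma tensors1 A B a b : A a -> B b -> tensors A B (fun s t => a s * b t).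
Proof.
move=> Aa Bb; have := TensorsS Aa Bb (Tensors0 A B).
by under eq_fun => s do under eq_fun => t do rewrite addr0.
Qed.

Lemma tensorsZ A B c F : linear_set A -> tensors A B F ->
  tensors A B (fun s t => c * F s t).
Proof.
move=> Al; elim=> [|a b E Aa Bb AE IH].
  under eq_fun => s do under eq_fun => t do rewrite mulr0.
  exact: Tensors0.
under eq_fun => s do under eq_fun => t do rewrite mulrDr mulrA.
by apply: (TensorsS (a := fun s => c * a s)) => //; apply: linear_setZ.
Qed.

Lemma tensors_map A B A' B' (p q : Sinf -> Sinf) F :
  (forall a, A a -> A' (fun s => a (p s))) ->
  (forall b, B b -> B' (fun s => b (q s))) ->
  tensors A B F -> tensors A' B' (fun s t => F (p s) (q t)).
Proof.
move=> pA qB; elim=> [|a b E Aa Bb AE IH]; first exact: Tensors0.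
by apply: (TensorsS (a := fun s => a (p s)) (b := fun s => b (q s))); auto.
Qed.

(** Freezing one variable of a tensor leaves a combination of left factors. *)
Lemma tensors_slice A B F t : linear_set A -> tensors A B F -> A (fun s => F s t).
Proof.
move=> Al; elim=> [|a b E Aa Bb AE IH]; first by case: Al.
apply: linear_setD => //; under eq_fun do rewrite mulrC.
exact: linear_setZ.
Qed.

Section Theory.
Context {U} (TU : Tsystem U).

Let Ulin := ts_lin TU.

Lemma ts_right X s f : Sym X s -> U X f -> U X (fun t => f (t * s)%g).
Proof.
move=> sX Uf; have sX' : maps s^-1%g X X by apply/SymP/SymV.
have := ts_conj TU sX' (ts_left TU sX Uf).
by under eq_fun do rewrite invgK -mulgA mulVKg.
Qed.

Lemma ts_conjV X Y s f : maps s X Y -> U Y f ->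
  U X (fun t => f (s^-1 * t * s)%g).
Proof. by move=> /mapsV sYX /(ts_conj TU sYX); rewrite invgK. Qed.

Lemma fsetUDK X Y : {subset X <= Y} -> (X `|` Y `\` X = Y)%fset.
Proof.
move=> XY; apply/fsetP => i; rewrite !inE.
by case: (boolP (i \in X)) => //= /XY ->.
Qed.

Lemma fdisjointD X Y : [disjoint X & Y `\` X]%fset.
Proof. by apply/fdisjointP => i iX; rewrite !inE iX. Qed.

(** Evaluate the second variable of [ts_res] at the identity. *)
Lemma ts_restrict X Y f : {subset X <= Y} -> U Y f -> U X f.
Proof.
move=> XY; rewrite -{1}(fsetUDK XY) => /(ts_res TU (fdisjointD _ _))[F AF fF].
apply: (ts_loc TU (tensors_slice 1%g (Ulin _) AF)) => s sX.
by rewrite -fF // mulg1.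
Qed.

(** The value at [s] is moved to the identity by translation, restricted to a
    single point, carried to the other points by relabelling, and spread over
    [X] by [ts_ext]. Only the case where [U Y] vanishes on Sym(Y) escapes. *)
Lemma ts_unital Y f s X : U Y f -> Y != fset0 -> Sym Y s -> f s != 0 ->
  exists2 b, U X b & b 1%g = 1.
Proof.
move=> Uf /fset0Pn[y yY] sY fs0.
have [b1 Ub1 b11] : exists2 b, U [fset y]%fset b & b 1%g = 1.
  exists (fun t => (f s)^-1 * f (s * t)%g); last by rewrite mulg1 mulVf.
  apply: linear_setZ; first exact: Ulin.
  apply: (@ts_restrict _ Y); first by move=> i; rewrite inE => /eqP ->.
  exact: (ts_left TU).
elim/finSet_rect: X => X IH; have [->|/fset0Pn[z zX]] := eqVneq X fset0.
  by exists (fun=> 1) => //; apply: (ts_one TU).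
have [b Ub b1E] := IH (X `\ z)%fset (fproperD1 zX).
have zmap : exists r, maps r [fset y]%fset [fset z]%fset.
  have sub c : (c == y) || (c == z) -> {subset [:: c] <= [fset y; z]%fset}.
    by move=> cyz i; rewrite inE => /eqP ->; rewrite !inE.
  have yl : (y == y) || (y == z) by rewrite eqxx.
  have zl : (z == y) || (z == z) by rewrite eqxx orbT.
  have [r _ rE] := @sym_ext_seq _ [:: y] [:: z] isT isT erefl (sub y yl) (sub z zl).
  exists r => i; have ryz : r y = z by apply: (rE 0%N).
  by rewrite !inE -ryz (inj_eq (@sinf_inj r)).
case: zmap => r ryz; have Uz := ts_conj TU ryz Ub1.
have dz : [disjoint [fset z] & X `\ z]%fset by rewrite fdisjoint1X !inE eqxx.
have [h Uh hE] := ts_ext TU dz Uz Ub.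
exists h; first by rewrite fsetD1K in Uh.
by have := hE 1%g 1%g (@Sym1 _) (@Sym1 _); rewrite mulg1 b1E mulr1 mulg1 mulgV b11.
Qed.

(** A function that vanishes extends by zero; otherwise multiply the
    restriction by a function on Sym(X \ Z) with value 1 at the identity. The
    set [Y] has to be nonempty: the unit of the sum of systems has constants on
    the empty set but nothing on larger sets. *)
Lemma ts_extend X Y Z f : U Y f -> Y != fset0 -> {subset Z <= X} ->
  {subset Z <= Y} ->
  exists2 g, U X g & forall s, Sym Z s -> f s = g s.
Proof.
move=> Uf Y0 ZX ZY.
have [f0|] := pselect (forall s, Sym Y s -> f s = 0).
  exists (fun=> 0) => [|s /(Sym_sub ZY)]; last exact: f0.
  by case: (Ulin X).
move=> /existsNP[s /not_implyP[sY /eqP fs0]].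
have [b Ub b1] := ts_unital (X `\` Z)%fset Uf Y0 sY fs0.
have [g Ug gE] := ts_ext TU (fdisjointD _ _) (ts_restrict ZY Uf) Ub.
exists g => [|t tZ]; first by rewrite fsetUDK in Ug.
by have := gE t 1%g tZ (@Sym1 _); rewrite mulg1 b1 mulr1.
Qed.

End Theory.

Definition ideal_of U : set (kSinf k) :=
  [set x | forall X f, X != fset0 -> carried (Sym X) x -> U X f -> ev f x = 0].

Lemma carried_ival x : exists2 n, (0 < n)%N &
  forall m, (n <= m)%N -> carried (Sym (ival 0 m)) x.
Proof.
have sub m n : (n <= m)%N -> {subset ival 0 n <= ival 0 m}.
  by move=> nm i; rewrite !in_ival /= => /leq_trans; apply.
elim/(@galg_ind k): x => [|c x y [n n0 nx] [m m0 my]|s].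
- by exists 1%N => // m _; apply: carried0.
- exists (maxn n m) => [|p]; first by rewrite leq_max n0.
  by rewrite geq_max => /andP[np mp]; apply: carriedP; auto.
have [n sn] := sinf_bound s; exists n.+1 => // m nm; apply: carried_gelt => i.
by rewrite in_ival /= -leqNgt => mi; apply: sn; apply: leq_trans mi; apply: ltnW.
Qed.

Lemma ival_neq0 m n : (0 < n)%N -> ival m n != fset0.
Proof. by move=> n0; apply/fset0Pn; exists m; rewrite in_ival leqnn -addn1 leq_add2l. Qed.

(** Membership may be tested on any one set carrying [x], since by [ts_extend]
    the functions available on another such set agree on the intersection with
    some available on this one. *)
Lemma ideal_ofP U X x : Tsystem U -> X != fset0 -> carried (Sym X) x ->
  (ideal_of U x <-> forall f, U X f -> ev f x = 0).
Proof.
move=> TU X0 Xx; split=> [Ix f|x0 Y f Y0 Yx Uf]; first exact: Ix.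
have [||g Ug fg] := @ts_extend U TU X Y (X `&` Y)%fset f Uf Y0.
- by move=> i; rewrite inE => /andP[].
- by move=> i; rewrite inE => /andP[].
rewrite (carried_eq (carried_sub _ (carriedI Xx Yx)) fg) ?x0 // => s [].
exact: SymI.
Qed.

Lemma ideal_of_ideal U : Tsystem U -> is_ideal (ideal_of U).
Proof.
move=> TU.
have I0 : ideal_of U 0 by move=> X f _ _ _; rewrite ev0.
have IP c x y : ideal_of U x -> ideal_of U y -> ideal_of U (c *: x + y).
  move=> Ix Iy; have [n n0 nx] := carried_ival x; have [m m0 my] := carried_ival y.
  have p0 : (0 < maxn n m)%N by rewrite leq_max n0.
  have px := nx _ (leq_maxl n m); have py := my _ (leq_maxr n m).
  apply/(ideal_ofP TU (ival_neq0 0 p0) (carriedP c px py)) => f Uf.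
  by rewrite evP (Ix _ _ (ival_neq0 0 p0)) // (Iy _ _ (ival_neq0 0 p0)) // mulr0 addr0.
have IM s x : ideal_of U x -> ideal_of U (gelt k s * x) /\ ideal_of U (x * gelt k s).
  move=> Ix; have [n n0 nx] := carried_ival x.
  have [m m0 ms] := carried_ival (gelt k s).
  have p0 : (0 < maxn n m)%N by rewrite leq_max n0.
  have px := nx _ (leq_maxl n m); have ps := ms _ (leq_maxr n m).
  have sp : Sym (ival 0 (maxn n m)) s.
    exact: carried_geltE ps.
  split; apply/(ideal_ofP TU (ival_neq0 0 p0)) => [f f0|f Uf].
  - by rewrite ev_mull; apply: px => t tp; apply: f0; apply: SymM.
  - by rewrite ev_mull; apply: Ix px _; [apply: ival_neq0|apply: (ts_left TU)].
  - by rewrite ev_mulr; apply: px => t tp; apply: f0; apply: SymM.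
  - by rewrite ev_mulr; apply: Ix px _; [apply: ival_neq0|apply: (ts_right TU)].
split=> // [x y Ix Iy|r x Ix]; first by rewrite -[x]scale1r; apply: IP.
elim/(@galg_ind k): r => [|c r r' [Ir Ir'] [Jr Jr']|s]; first by rewrite mul0r mulr0.
  by rewrite mulrDl mulrDr -scalerAl -scalerAr; split; apply: IP.
exact: IM.
Qed.

(** Every function on the trivial group Sym(fset0) is allowed, in accordance
    with the convention that ideals have zero component in degree 0. Without it
    the unit ideal would not be neutral for the sum. *)
Definition perp (I : set (kSinf k)) X : set fn :=
  [set f | X != fset0 -> forall z, I z -> carried (Sym X) z -> ev f z = 0].

Lemma ideal_subspace (I : set (kSinf k)) : is_ideal I -> is_subspace I.
Proof.
move=> [I0 ID IM]; split=> // c u v Iu Iv; apply: ID => //.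
by have [+ _] := IM (c *: 1) _ Iu; rewrite -scalerAl mul1r.
Qed.

(** Double annihilator on the side of functions. *)
Lemma perp_ideal_of U X : Tsystem U -> perp (ideal_of U) X = U X.
Proof.
move=> TU; have Ul := ts_lin TU X; apply/seteqP; split=> f /=; last first.
  by move=> Uf X0 z Iz Xz; apply: Iz Uf.
have [->|X0] := eqVneq X fset0.
  move=> _; apply: (ts_loc TU (f := fun s => f 1%g * 1)).
    by apply: linear_setZ; [apply: (ts_lin TU)|apply: (ts_one TU)].
  by move=> s /Sym0 ->; rewrite mulr1.
move=> /(_ X0) f0; have [z Xz Uz|u Uu fu] := double_annihilator_fun (Sym_finite X) Ul (f := f).
  by apply: f0 => //; apply/(ideal_ofP TU X0).
by apply: (ts_loc TU Uu) => s /fu.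
Qed.

(** Double annihilator on the side of the group algebra. *)
Lemma ideal_of_perp (I : set (kSinf k)) : is_ideal I -> ideal_of (perp I) = I.
Proof.
move=> Iid; apply/seteqP; split=> x; last first.
  by move=> Ix X f X0 Xx /(_ X0 x Ix Xx).
have [n n0 /(_ n (leqnn n)) nx] := carried_ival x.
move=> /(_ _ _ (ival_neq0 0 n0) nx) x0.
apply: (double_annihilator_alg (Sym_finite _) (ideal_subspace Iid) nx) => f f0.
by apply: x0 => _.
Qed.

End Systems.

(** * Pointwise products *)

Section Products.
Context {k : fieldType}.
Local Notation fn := (Sinf -> k).
Local Notation sys := ({fset nat} -> set fn).
Implicit Types (f g a b : fn) (X Y Z : {fset nat}) (s t : Sinf) (U V W : sys).

Inductive prods U V X : set fn :=
| Prods0 : prods U V X (fun=> 0)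
| ProdsS a b f : U X a -> V X b -> prods U V X f ->
    prods U V X (fun s => a s * b s + f s)
| Prods_loc f g : prods U V X f -> (forall s, Sym X s -> f s = g s) ->
    prods U V X g.

Lemma prods1 U V X a b : U X a -> V X b -> prods U V X (fun s => a s * b s).
Proof.
move=> Ua Vb; have := ProdsS Ua Vb (Prods0 U V X).
by under eq_fun do rewrite addr0.
Qed.

Lemma prods_lin U V X : Tsystem U -> linear_set (prods U V X).
Proof.
move=> TU; split=> [|c f g Uf Vg]; first exact: Prods0.
elim: Uf => [|a b h Ua Vb _ IH|h h' _ IH hh'].
- by under eq_fun do rewrite mulr0 add0r.
- under eq_fun do rewrite mulrDr mulrA -addrA.
  by apply: (ProdsS (a := fun s => c * a s)) => //; apply: linear_setZ (ts_lin TU _) _.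
by apply: Prods_loc IH _ => s /hh' ->.
Qed.

(** The rule for reasoning on a system of products: a local linear condition
    that holds for single products holds for all. *)
Lemma prods_min U V X (A : set fn) : linear_set A ->
  (forall f g, A f -> (forall s, Sym X s -> f s = g s) -> A g) ->
  (forall a b, U X a -> V X b -> A (fun s => a s * b s)) ->
  prods U V X `<=` A.
Proof.
move=> Al Aloc Aab f; elim=> [|a b h Ua Vb _ IH|h h' _ IH hh'].
- by case: Al.
- by apply: linear_setD => //; apply: Aab.
exact: Aloc IH _.
Qed.

Lemma tensors_mul A B A' B' C D (F F' : Sinf -> Sinf -> k) :
  (forall a c, A a -> A' c -> C (fun s => a s * c s)) ->
  (forall a c, B a -> B' c -> D (fun s => a s * c s)) ->
  tensors A B F -> tensors A' B' F' -> tensors C D (fun s t => F s t * F' s t).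
Proof.
move=> AC BD AF AF'; elim: AF => [|a b E Aa Bb _ IH].
  under eq_fun => s do under eq_fun => t do rewrite mul0r.
  exact: Tensors0.
under eq_fun => s do under eq_fun => t do rewrite mulrDl.
apply: tensorsD => //; elim: AF' => [|a' b' E' Aa' Bb' _ IH'].
  under eq_fun => s do under eq_fun => t do rewrite mulr0.
  exact: Tensors0.
under eq_fun => s do under eq_fun => t do rewrite mulrDr mulrACA.
apply: tensorsD => //.
by apply: (tensors1 (a := fun s => a s * a' s) (b := fun s => b s * b' s)); auto.
Qed.

(** The functions whose restriction to Sym(X) x Sym(Y) splits, as required by
    [ts_res]; being a linear condition, it may be checked on generators. *)
Definition splits A B X Y : set fn :=
  [set f | exists2 F : Sinf -> Sinf -> k, tensors A B F &
     forall s t, Sym X s -> Sym Y t -> f (s * t)%g = F s t].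

Lemma splits_lin A B X Y : linear_set A -> linear_set (splits A B X Y).
Proof.
move=> Al; split; first by exists (fun _ _ => 0) => //; apply: Tensors0.
move=> c f g [F AF fF] [E AE gE]; exists (fun s t => c * F s t + E s t).
  by apply: (tensorsD (F := fun s t => c * F s t)) => //; apply: tensorsZ.
by move=> s t sX tY; rewrite fF // gE.
Qed.

(** Restriction to Sym(X) x Sym(Y) is compatible with pointwise multiplication,
    and products of tensors are tensors. *)
Lemma prods_Tsystem U V : Tsystem U -> Tsystem V -> Tsystem (prods U V).
Proof.
move=> TU TV; have Pl X : linear_set (prods U V X) by apply: prods_lin.
split=> //.
- exact: Prods_loc.
- move=> X Y s f sXY; elim=> [|a b h Ua Vb _ IH|h h' _ IH hh'].
  + exact: Prods0.
  + apply: (ProdsS (a := fun t => a _) (b := fun t => b _)) => //.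
      exact: (ts_conj TU).
    exact: (ts_conj TV).
  by apply: Prods_loc IH _ => t tY; apply: hh'; apply: Sym_conj tY.
- move=> X s f sX; elim=> [|a b h Ua Vb _ IH|h h' _ IH hh'].
  + exact: Prods0.
  + apply: (ProdsS (a := fun t => a _) (b := fun t => b _)) => //.
      exact: (ts_left TU).
    exact: (ts_left TV).
  by apply: Prods_loc IH _ => t tY; apply: hh'; apply: SymM.
- move=> X Y f XY.
  apply: (@prods_min _ _ _ (splits (prods U V X) (prods U V Y) X Y)) f.
  + exact: splits_lin.
  + move=> f g [F AF fF] fg; exists F => // s t sX tY.
    by rewrite -fF // fg //; apply: Sym_setU.
  move=> a b Ua Vb.
  have [[F UF aF] [E VE bE]] := (ts_res TU XY Ua, ts_res TV XY Vb).
  exists (fun s t => F s t * E s t); last by move=> s t sX tY; rewrite aF // bE.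
  by apply: tensors_mul UF VE => *; apply: prods1.
- move=> X Y a b XY Ua Ub; move: a Ua b Ub.
  pose E a b := exists2 f, prods U V (X `|` Y)%fset f &
      forall s t, Sym X s -> Sym Y t -> f (s * t)%g = a s * b t.
  have El a : linear_set (E a).
    split; first by exists (fun=> 0) => [|s t _ _]; [case: (Pl (X `|` Y)%fset)|rewrite mulr0].
    move=> c f g [F PF Ff] [H PH Hg]; exists (fun s => c * F s + H s).
      by case: (Pl (X `|` Y)%fset) => _; apply.
    by move=> s t sX tY; rewrite Ff // Hg //; ring.
  have Er b : linear_set (E^~ b).
    split; first by exists (fun=> 0) => [|s t _ _]; [case: (Pl (X `|` Y)%fset)|rewrite mul0r].
    move=> c f g [F PF Ff] [H PH Hg]; exists (fun s => c * F s + H s).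
      by case: (Pl (X `|` Y)%fset) => _; apply.
    by move=> s t sX tY; rewrite Ff // Hg //; ring.
  apply: (@prods_min _ _ _ [set a | forall b, prods U V Y b -> E a b]) => /=.
  + split=> [b _|c f g Ef Eg b Pb]; first by case: (Er b).
    by case: (Er b) => _; apply; [apply: Ef|apply: Eg].
  + move=> f g Ef fg b /Ef[F PF Ff]; exists F => // s t sX tY.
    by rewrite Ff // fg.
  move=> a b Ua Vb; apply: prods_min => //.
    by move=> f g [F PF Ff] fg; exists F => // s t sX tY; rewrite Ff // fg.
  move=> a' b' Ua' Vb'; have [f Uf fE] := ts_ext TU XY Ua Ua'.
  have [g Vg gE] := ts_ext TV XY Vb Vb'.
  exists (fun s => f s * g s); first exact: prods1.
  by move=> s t sX tY; rewrite fE // gE // mulrACA.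
apply: Prods_loc (prods1 (ts_one TU) (ts_one TV)) _ => s _; exact: mulr1.
Qed.

(** The constants: the functions that kill the augmentation ideal. *)
Definition sys_one : sys :=
  fun X => [set f | exists c, forall s, Sym X s -> f s = c].

Lemma sys_one_Tsystem : Tsystem sys_one.
Proof.
split.
- move=> X; split; first by exists 0.
  by move=> c f g [d fd] [e ge]; exists (c * d + e) => s sX; rewrite fd // ge.
- by move=> X f g [c fc] fg; exists c => s sX; rewrite -fg // fc.
- by move=> X Y s f sXY [c fc]; exists c => t tY; apply: fc; apply: Sym_conj tY.
- by move=> X s f sX [c fc]; exists c => t tX; apply: fc; apply: SymM.
- move=> X Y f XY [c fc]; exists (fun _ _ => c * 1).
    by apply: (tensors1 (a := fun=> c) (b := fun=> 1)); [exists c|exists 1].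
  by move=> s t sX tY; rewrite mulr1 fc //; apply: Sym_setU.
- move=> X Y a b XY [c ac] [d bd]; exists (fun=> c * d); first by exists (c * d).
  by move=> s t sX tY; rewrite ac // bd.
by exists 1.
Qed.

Lemma sys_ext U V : (forall X, U X `<=` V X) -> (forall X, V X `<=` U X) -> U = V.
Proof. by move=> UV VU; apply/funext => X; apply/seteqP. Qed.

Lemma prodsC U V : Tsystem U -> Tsystem V -> prods U V = prods V U.
Proof.
move=> TU TV; suff sub U' V' : Tsystem U' -> Tsystem V' ->
    forall X, prods U' V' X `<=` prods V' U' X.
  by apply: sys_ext; apply: sub.
move=> TU' TV' X; apply: prods_min; first exact: prods_lin.
  exact: Prods_loc.
by move=> a b Ua Vb; under eq_fun do rewrite mulrC; apply: prods1.
Qed.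

Lemma prods1s U : Tsystem U -> prods sys_one U = U.
Proof.
move=> TU; apply: sys_ext => X.
  apply: prods_min; [exact: ts_lin|exact: (ts_loc TU)|move=> a b [c ac] Ub].
  apply: (ts_loc TU (linear_setZ c (ts_lin TU X) Ub)) => s sX.
  by rewrite ac.
move=> f Uf; apply: Prods_loc (prods1 (a := fun=> 1) _ Uf) _; first by exists 1.
by move=> s _; rewrite mul1r.
Qed.

Lemma prodsA U V W : Tsystem U -> Tsystem V -> Tsystem W ->
  prods U (prods V W) = prods (prods U V) W.
Proof.
move=> TU TV TW; have TUV := prods_Tsystem TU TV; have TVW := prods_Tsystem TV TW.
have TL := prods_Tsystem TU TVW; have TR := prods_Tsystem TUV TW.
have lin_mull (A : set fn) a : linear_set A -> linear_set [set f | A (fun s => a s * f s)].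
  move=> [A0 Al]; split=> /=; first by under eq_fun do rewrite mulr0.
  by move=> c f g Af Ag; under eq_fun do rewrite mulrDr mulrCA; apply: Al.
apply: sys_ext => X; apply: prods_min; try exact: ts_lin; try exact: Prods_loc.
  move=> a f Ua; move: f; apply: (prods_min (A := [set f | _ (fun s => a s * f s)])).
  - by apply: lin_mull; exact: ts_lin.
  - by move=> f g /= Af fg; apply: Prods_loc Af _ => s /fg ->.
  move=> b c Vb Wc /=; under eq_fun do rewrite mulrA.
  by apply: (prods1 (a := fun s => a s * b s)) => //; apply: prods1.
move=> f c Vf Wc; move: f Vf; apply: (prods_min (A := [set f | _ (fun s => f s * c s)])).
- under [X in [set f | X f]]eq_fun => f do under eq_fun do rewrite mulrC.
  by apply: lin_mull; exact: ts_lin.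
- by move=> f g /= Af fg; apply: Prods_loc Af _ => s /fg ->.
move=> a b Ua Vb /=; under eq_fun do rewrite -mulrA.
by apply: (prods1 (b := fun s => b s * c s)) => //; apply: prods1.
Qed.

End Products.

(** * Sums of systems *)

Section Sums.
Context {k : fieldType}.
Local Notation fn := (Sinf -> k).
Local Notation sys := ({fset nat} -> set fn).
Implicit Types (f g a b : fn) (X Y Z P Q : {fset nat}) (s t : Sinf) (U V W : sys).

Definition stabb P s : k := (`[< maps s P P >])%:R.

Lemma stabbT P s : maps s P P -> stabb P s = 1.
Proof. by move=> sP; rewrite /stabb asboolT. Qed.

Lemma stabbF P s : ~ maps s P P -> stabb P s = 0.
Proof. by move=> sP; rewrite /stabb asboolF. Qed.

Lemma eq_stabb P Q s t : (maps s P P <-> maps t Q Q) -> stabb P s = stabb Q t.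
Proof. by move=> st; rewrite /stabb; congr (nat_of_bool _)%:R; apply/asbool_equiv_eq. Qed.

(** A matrix coefficient of the representation induced from Sym(P) x Sym(X \
    P): the exterior product of [f] and [g], extended by zero off that
    subgroup. *)
Definition block X P f g : fn :=
  fun s => stabb P s * (f (restr P s) * g (restr (X `\` P)%fset s)).

(** Closure under translations on both sides is built in: a single block only
    involves one double coset of the Young subgroup, its translates reach the
    others. *)
Inductive sums U V X : set fn :=
| Sums0 : sums U V X (fun=> 0)
| Sums_lin c f g : sums U V X f -> sums U V X g ->
    sums U V X (fun s => c * f s + g s)
| Sums_loc f g : sums U V X f -> (forall s, Sym X s -> f s = g s) ->
    sums U V X g
| Sums_left s f : Sym X s -> sums U V X f -> sums U V X (fun t => f (s * t)%g)
| Sums_right s f : Sym X s -> sums U V X f -> sums U V X (fun t => f (t * s)%g)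
| Sums_block P f g : {subset P <= X} -> U P f -> V (X `\` P)%fset g ->
    sums U V X (block X P f g).

Lemma sums_linear U V X : linear_set (sums U V X).
Proof. by split; [apply: Sums0|apply: Sums_lin]. Qed.

(** The conditions under which an inclusion of [sums U V X] may be tested on
    blocks. *)
Record invariant X (A : set fn) : Prop := {
  inv_lin : linear_set A;
  inv_loc : forall f g, A f -> (forall s, Sym X s -> f s = g s) -> A g;
  inv_left : forall s f, Sym X s -> A f -> A (fun t => f (s * t)%g);
  inv_right : forall s f, Sym X s -> A f -> A (fun t => f (t * s)%g) }.

Lemma sums_min U V X (A : set fn) : invariant X A ->
  (forall P f g, {subset P <= X} -> U P f -> V (X `\` P)%fset g ->
     A (block X P f g)) ->
  sums U V X `<=` A.
Proof.
move=> [Al Aloc Aleft Aright] Ab f; elim=> [|c g h _ Ag _ Ah|g h _ Ag gh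
    |s g sX _ Ag|s g sX _ Ag|P g h PX Ug Vh].
- by case: Al.
- by case: Al => _; apply.
- exact: Aloc Ag gh.
- exact: Aleft.
- exact: Aright.
exact: Ab.
Qed.

Lemma sums_inv U V X : invariant X (sums U V X).
Proof.
by split; [exact: sums_linear|exact: Sums_loc|exact: Sums_left|exact: Sums_right].
Qed.

Lemma Tsystem_inv U X : Tsystem U -> invariant X (U X).
Proof.
move=> TU; split; [exact: ts_lin|exact: (ts_loc TU)|move=> s f; exact: (ts_left TU)|].
by move=> s f; apply: ts_right.
Qed.

Lemma block_conj X Y P s f g t : maps s X Y -> Sym Y t ->
  block X P f g (s * t * s^-1)%g =
  block Y (img s P) (fun t => f (s * t * s^-1)%g) (fun t => g (s * t * s^-1)%g) t.
Proof.
move=> sXY tY; have sP := maps_img s P; have e : maps (s * t * s^-1)%g P P <->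
    maps t (img s P) (img s P).
  split=> [sts|tP]; last by apply: mapsM (mapsV sP); apply: mapsM tP.
  have -> : t = (s^-1 * (s * t * s^-1) * s)%g by rewrite -!mulgA mulVg mulKg mulg1.
  by apply: mapsM (sP); apply: mapsM sts; apply: mapsV.
rewrite /block (eq_stabb e); have [tP|ntP] := pselect (maps t (img s P) (img s P)).
  rewrite (restr_conj sP tP) (restr_conj (mapsD sXY sP)) //.
  by apply: mapsD => //; apply: SymP.
by rewrite stabbF // !mul0r.
Qed.

Lemma maps_mulr P s t : maps t P P -> maps (s * t)%g P P <-> maps s P P.
Proof.
move=> tP; split=> [stP|sP]; last exact: mapsM tP.
by rewrite -(mulgK t s); apply: mapsM (mapsV tP).
Qed.

Lemma maps_mull P s t : maps t P P -> maps (t * s)%g P P <-> maps s P P.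
Proof.
move=> tP; split=> [stP|sP]; last exact: mapsM sP.
by rewrite -(mulKg t s); apply: mapsM stP; apply: mapsV.
Qed.

Lemma block_mulr X P f g s t : Sym X s -> Sym X t -> maps t P P ->
  block X P f g (s * t)%g =
  block X P (fun s => f (s * restr P t)%g)
    (fun s => g (s * restr (X `\` P)%fset t)%g) s.
Proof.
move=> sX tX tP; rewrite /block (eq_stabb (maps_mulr s tP)).
have [sP|nsP] := pselect (maps s P P); last by rewrite stabbF // !mul0r.
by rewrite !restrM //; apply: mapsD => //; apply: SymP.
Qed.

Lemma block_mull X P f g s t : Sym X s -> Sym X t -> maps t P P ->
  block X P f g (t * s)%g =
  block X P (fun s => f (restr P t * s)%g)
    (fun s => g (restr (X `\` P)%fset t * s)%g) s.
Proof.
move=> sX tX tP; rewrite /block (eq_stabb (maps_mull s tP)).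
have [sP|nsP] := pselect (maps s P P); last by rewrite stabbF // !mul0r.
by rewrite !restrM //; apply: mapsD => //; apply: SymP.
Qed.

Lemma maps_prod X Y P Q s t : [disjoint X & Y]%fset -> {subset P <= X} ->
  {subset Q <= Y} -> Sym X s -> Sym Y t ->
  maps (s * t)%g (P `|` Q)%fset (P `|` Q)%fset <-> maps s P P /\ maps t Q Q.
Proof.
move=> XY PX QY sX tY; have sQ : maps s Q Q.
  apply: Sym_disj_maps sX; apply/fdisjointP => i /QY iY.
  by apply/negP => iX; have := fdisjointP XY i iX; rewrite iY.
have tP : maps t P P.
  by apply: Sym_disj_maps tY; apply/fdisjointP => i /PX iX; apply: (fdisjointP XY).
split=> [stPQ|[sP tQ]]; last by apply: mapsM; apply: mapsU.
have xP i : (i \in P) = (i \in (P `|` Q)%fset) && (i \in X).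
  rewrite inE andb_orl; case: (boolP (i \in P)) => [/PX->//|_] /=.
  by apply/esym/negP => /andP[/QY iY iX]; have := fdisjointP XY i iX; rewrite iY.
have xQ i : (i \in Q) = (i \in (P `|` Q)%fset) && (i \in Y).
  rewrite inE andb_orl; case: (boolP (i \in Q)) => [/QY->//|_] /=; last first.
    by rewrite orbF; apply/esym/negP => /andP[/PX iX iY]; have := fdisjointP XY i iX; rewrite iY.
  by rewrite orbT.
have tX : maps t X X by exact: Sym_disj_maps XY tY.
have sY : maps s Y Y by apply: Sym_disj_maps sX; rewrite fdisjoint_sym.
split=> i.
  have := stPQ i; rewrite sinfM => e.
  by rewrite -(tP (s i)) xP tX (SymP sX) e -xP.
have := stPQ (s^-1%g i); rewrite sinfM sinfKV => e.
have sVi : (s^-1%g i \in Q) = (i \in Q) by apply: mapsV.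
have sVY : (s^-1%g i \in Y) = (i \in Y) by apply: mapsV.
by rewrite xQ e (SymP tY) -sVY -xQ sVi.
Qed.

Lemma restr_prod X Y P Q s t : [disjoint X & Y]%fset -> {subset P <= X} ->
  {subset Q <= Y} -> Sym X s -> Sym Y t -> maps s P P -> maps t Q Q ->
  restr (P `|` Q)%fset (s * t)%g = (restr P s * restr Q t)%g.
Proof.
move=> XY PX QY sX tY sP tQ.
have stPQ : maps (s * t)%g (P `|` Q)%fset (P `|` Q)%fset.
  by apply/(maps_prod XY).
have XYi i : i \in X -> i \in Y = false.
  by move=> iX; apply/negbTE/(fdisjointP XY).
apply/sinfP => i; rewrite sinfM !restrE // sinfM inE.
case: (boolP (i \in P)) => iP /=.
  have siX : s i \in X by rewrite (SymP sX) PX.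
  case: ifPn => [/QY|_]; first by rewrite XYi.
  by rewrite (tY (s i)) // XYi.
case: ifPn => // iQ; rewrite (sX i) //.
by apply/negP => iX; have := QY _ iQ; rewrite XYi.
Qed.

Lemma fsetD_prod X Y P Q : [disjoint X & Y]%fset -> {subset P <= X} ->
  {subset Q <= Y} -> ((X `|` Y) `\` (P `|` Q) = (X `\` P) `|` (Y `\` Q))%fset.
Proof.
move=> XY PX QY; apply/fsetP => i; rewrite !inE.
case: (boolP (i \in P)) => [/PX iX|nP]; case: (boolP (i \in Q)) => [/QY iY|nQ] //=.
- by rewrite (negbTE (fdisjointP XY i iX)).
- case iX: (i \in X) => //=; by have := fdisjointP XY i iX; rewrite iY.
Qed.

(** Two blocks on disjoint sets are factors of the block on the union. *)
Lemma block_prod X Y P Q f g s t : [disjoint X & Y]%fset -> {subset P <= X} ->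
  {subset Q <= Y} -> Sym X s -> Sym Y t ->
  block (X `|` Y)%fset (P `|` Q)%fset f g (s * t)%g =
  stabb P s * stabb Q t * (f (restr P s * restr Q t)%g *
    g (restr (X `\` P)%fset s * restr (Y `\` Q)%fset t)%g).
Proof.
move=> XY PX QY sX tY; rewrite /block.
have eD := fsetD_prod XY PX QY.
have [[sP tQ]|nst] := pselect (maps s P P /\ maps t Q Q).
  have stPQ : maps (s * t)%g (P `|` Q)%fset (P `|` Q)%fset.
    by apply/(maps_prod XY).
  rewrite !stabbT // !mul1r (restr_prod XY) // eD (restr_prod XY) //.
  - by move=> i; rewrite inE => /andP[].
  - by move=> i; rewrite inE => /andP[].
  - by apply: mapsD => //; apply: SymP.
  - by apply: mapsD => //; apply: SymP.
rewrite stabbF ?mul0r; last by move/(maps_prod XY PX QY sX tY).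
have [sP|nsP] := pselect (maps s P P); last by rewrite [stabb P s]stabbF // !mul0r.
have [tQ|ntQ] := pselect (maps t Q Q); last by rewrite [stabb Q t]stabbF // mulr0 mul0r.
by case: nst.
Qed.

Lemma block_lin_l X P g c f f' s :
  block X P (fun s => c * f s + f' s) g s = c * block X P f g s + block X P f' g s.
Proof. by rewrite /block; ring. Qed.

Lemma block_lin_r X P f c g g' s :
  block X P f (fun s => c * g s + g' s) s = c * block X P f g s + block X P f g' s.
Proof. by rewrite /block; ring. Qed.

Lemma block_loc X P f f' g g' s : {subset P <= X} -> Sym X s ->
  (forall t, Sym P t -> f t = f' t) ->
  (forall t, Sym (X `\` P)%fset t -> g t = g' t) ->
  block X P f g s = block X P f' g' s.
Proof.
move=> PX sX ff' gg'; rewrite /block.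
have [sP|nsP] := pselect (maps s P P); last by rewrite stabbF // !mul0r.
rewrite ff'; last exact: restr_Sym.
by rewrite gg' //; apply: restr_Sym; apply: mapsC.
Qed.

(** Induction on two tensors at once, for a bilinear operation [op] on
    functions of two variables. *)
Lemma tensors_ind2 A B A' B' (C : (Sinf -> Sinf -> k) -> Prop)
  (op : (Sinf -> Sinf -> k) -> (Sinf -> Sinf -> k) -> Sinf -> Sinf -> k) F F' :
  C (fun _ _ => 0) ->
  (forall F F', C F -> C F' -> C (fun s t => F s t + F' s t)) ->
  (forall E, op (fun _ _ => 0) E = fun _ _ => 0) ->
  (forall E, op E (fun _ _ => 0) = fun _ _ => 0) ->
  (forall E H K, op (fun s t => E s t + H s t) K = fun s t => op E K s t + op H K s t) ->
  (forall E H K, op K (fun s t => E s t + H s t) = fun s t => op K E s t + op K H s t) ->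
  (forall a b a' b', A a -> B b -> A' a' -> B' b' ->
     C (op (fun s t => a s * b t) (fun s t => a' s * b' t))) ->
  tensors A B F -> tensors A' B' F' -> C (op F F').
Proof.
move=> C0 CD op0l op0r opDl opDr Cop AF AF'.
elim: AF => [|a b E Aa Bb _ IH]; first by rewrite op0l.
rewrite opDl; apply: (CD) => //; elim: AF' => [|a' b' E' Aa' Bb' _ IH']; first by rewrite op0r.
by rewrite opDr; apply: (CD) => //; apply: Cop.
Qed.

(** The restriction property is Mackey's formula: the restriction of a
    translated block to Sym(X) x Sym(Y) is zero, or the product of a block on
    [X] and a block on [Y], up to translations and up to splitting its two
    entries. *)
Lemma sums_Tsystem U V : Tsystem U -> Tsystem V -> Tsystem (sums U V).
Proof.
move=> TU TV; split.
- exact: sums_linear.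
- exact: Sums_loc.
- move=> X Y s f sXY.
  apply: (sums_min (A := [set f | sums U V Y (fun t => f (s * t * s^-1)%g)])).
    split=> [|f' g /= Af fg|r f' rX /= Af|r f' rX /= Af].
    + by split; [apply: Sums0|move=> c f' g /=; apply: Sums_lin].
    + by apply: Sums_loc Af _ => t tY; apply: fg; apply: Sym_conj tY.
    + apply: Sums_loc (Sums_left (Sym_conjV sXY rX) Af) _ => t tY.
      by rewrite !mulgA mulgV mul1g.
    + apply: Sums_loc (Sums_right (Sym_conjV sXY rX) Af) _ => t tY.
      by rewrite -!mulgA mulgV mulg1.
  move=> P f' g PX Uf Vg /=.
  apply: Sums_loc (Sums_block (P := img s P) (f := fun t => _) (g := fun t => _) _ _ _) _.
  + by apply: maps_subset sXY (maps_img s P) PX.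
  + by apply: (ts_conj TU (maps_img s P) Uf).
  + by apply: (ts_conj TV (mapsD sXY (maps_img s P)) Vg).
  by move=> t tY; rewrite -(block_conj P f' g sXY tY).
- by move=> X s f sX; apply: Sums_left.
- move=> X Y f XY Zf; set Z := (X `|` Y)%fset in Zf.
  (* Translations by Sym(X u Y) do not respect Sym(X) x Sym(Y), so the
     property is proved for all translates at once. *)
  pose A : set fn := [set f | forall s t, Sym Z s -> Sym Z t ->
    splits (sums U V X) (sums U V Y) X Y (fun r => f (s * r * t)%g)].
  suff : A f.
    by move=> /(_ 1%g 1%g (@Sym1 _) (@Sym1 _)); under eq_fun do rewrite mulg1 mul1g.
  have splin := splits_lin (sums U V Y) X Y (sums_linear U V X).
  have SZ x y : Sym X x -> Sym Y y -> Sym Z (x * y)%g by apply: Sym_setU.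
  apply: sums_min f Zf; first split.
  + split=> [s t sZ tZ|c f g Af Ag s t sZ tZ]; first by case: splin.
    by case: splin => _; apply; [apply: Af|apply: Ag].
  + move=> f g Af fg s t sZ tZ; have [F FT fF] := Af s t sZ tZ; exists F => // x y xX yY.
    by rewrite -fF // fg //; apply: SymM => //; apply: SymM => //; apply: SZ.
  + move=> r f rZ Af s t sZ tZ; have [F FT fF] := Af (r * s)%g t (SymM rZ sZ) tZ.
    by exists F => // x y xX yY; rewrite -fF // !mulgA.
  + move=> r f rZ Af s t sZ tZ; have [F FT fF] := Af s (t * r)%g sZ (SymM tZ rZ).
    by exists F => // x y xX yY; rewrite -fF // !mulgA.
  move=> P f g PZ Uf Vg s t sZ tZ.
  have [[x0 [y0 [x0X y0Y stP]]]|none] := pselect (exists x y, [/\ Sym X x, Sym Y y &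
      maps (s * (x * y) * t)%g P P]); last first.
    exists (fun _ _ => 0) => [|x y xX yY]; first exact: Tensors0.
    rewrite /block stabbF ?mul0r // => stP; case: none.
    by exists x, y.
  (* Some element of Sym(X) x Sym(Y) lies in the support of the translated
     block. After translating by it, only a conjugation by [s] and a
     translation by an element [p] of the stabiliser remain, and both
     preserve blocks. *)
  set p := (s * (x0 * y0) * t)%g in stP.
  have pZ : Sym Z p by apply: SymM => //; apply: SymM => //; apply: SZ.
  pose Q := img s P; have sPQ : maps s P Q := maps_img s P.
  have QZ : {subset Q <= Z} by apply: maps_subset (SymP sZ) sPQ PZ.
  pose f1 r := f (s * r * s^-1 * restr P p)%g.
  pose g1 r := g (s * r * s^-1 * restr (Z `\` P)%fset p)%g.
  have Uf1 : U Q f1 := ts_conj TU sPQ (ts_right TU (restr_Sym stP) Uf).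
  have pZP := mapsC PZ pZ stP.
  have Vg1 : V (Z `\` Q)%fset g1 :=
    ts_conj TV (mapsD (SymP sZ) sPQ) (ts_right TV (restr_Sym pZP) Vg).
  pose Q1 := (Q `&` X)%fset; pose Q2 := (Q `&` Y)%fset.
  have Q1X : {subset Q1 <= X} by move=> i; rewrite inE => /andP[].
  have Q2Y : {subset Q2 <= Y} by move=> i; rewrite inE => /andP[].
  have Q12 : Q = (Q1 `|` Q2)%fset.
    apply/fsetP => i; rewrite !inE -andb_orr; case: (boolP (i \in Q)) => //= /QZ.
    by rewrite inE => ->.
  have D12 : (Z `\` Q = (X `\` Q1) `|` (Y `\` Q2))%fset.
    apply/fsetP => i; rewrite !inE; case: (i \in Q) => //=.
      by case: (i \in X); case: (i \in Y).
  have dis P' Q' : {subset P' <= X} -> {subset Q' <= Y} -> [disjoint P' & Q']%fset.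
    move=> PX QY; apply/fdisjointP => i /PX iX; apply/negP => /QY iY.
    by have := fdisjointP XY i iX; rewrite iY.
  have DX (X' P' : {fset nat}) : {subset (X' `\` P')%fset <= X'}.
    by move=> i; rewrite inE => /andP[].
  have := Uf1; rewrite {1}Q12 => /(ts_res TU (dis _ _ Q1X Q2Y))[F FT f1F].
  have := Vg1; rewrite {1}D12 => /(ts_res TV (dis _ _ (DX _ _) (DX _ _)))[E ET g1E].
  pose H (x y : Sinf) := stabb Q1 x * stabb Q2 y * (F (restr Q1 x) (restr Q2 y) *
      E (restr (X `\` Q1)%fset x) (restr (Y `\` Q2)%fset y)).
  have HT : tensors (sums U V X) (sums U V Y) H.
    pose op (F E : Sinf -> Sinf -> k) x y := stabb Q1 x * stabb Q2 y * (F (restr Q1 x) (restr Q2 y) *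
      E (restr (X `\` Q1)%fset x) (restr (Y `\` Q2)%fset y)).
    apply: (tensors_ind2 (C := tensors _ _) (op := op)) FT ET.
    * exact: Tensors0.
    * exact: tensorsD.
    * by move=> E'; apply/funext => x; apply/funext => y; rewrite /op mul0r mulr0.
    * by move=> E'; apply/funext => x; apply/funext => y; rewrite /op !mulr0.
    * by move=> E' H' K; apply/funext => x; apply/funext => y; rewrite /op; ring.
    * by move=> E' H' K; apply/funext => x; apply/funext => y; rewrite /op; ring.
    move=> a b a' b' Ua Ub Va' Vb'.
    rewrite (_ : op _ _ = fun x y => block X Q1 a a' x * block Y Q2 b b' y).
      by apply: tensors1; apply: Sums_block.
    by apply/funext => x; apply/funext => y; rewrite /op /block; ring.
  have HE x y : Sym X x -> Sym Y y -> block Z Q f1 g1 (x * y)%g = H x y.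
    move=> xX yY; rewrite {1}Q12 block_prod // /H.
    have [xQ|nxQ] := pselect (maps x Q1 Q1); last by rewrite [stabb Q1 x]stabbF // !mul0r.
    have [yQ|nyQ] := pselect (maps y Q2 Q2); last by rewrite [stabb Q2 y]stabbF // mulr0 !mul0r.
    by rewrite f1F ?g1E //; apply: restr_Sym => //; apply: mapsC.
  exists (fun x y => H (x * x0^-1)%g (y * y0^-1)%g).
    apply: (tensors_map (p := fun x => (x * x0^-1)%g) (q := fun x => (x * y0^-1)%g)) HT => f'.
      by apply: Sums_right; apply: SymV.
    by apply: Sums_right; apply: SymV.
  move=> x y xX yY; rewrite -HE; last 2 first.
  + by apply: SymM => //; apply: SymV.
  + by apply: SymM => //; apply: SymV.
  set r := (_ * _ * (_ * _))%g.
  have rE : (s * (x * y) * t = s * r * s^-1 * p)%g.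
    have <- : (r * (x0 * y0) = x * y)%g.
      rewrite /r -!mulgA (Sym_comm XY x0X y0Y) mulKg -(Sym_comm XY x0X yY).
      by rewrite mulKg.
    by rewrite /p !mulgA mulgVK.
  have rZ : Sym Z r by apply: SZ; apply: SymM => //; apply: SymV.
  rewrite rE block_mulr //; last by apply: Sym_conj (SymP sZ) rZ.
  by rewrite (block_conj _ _ _ (SymP sZ) rZ).
- move=> X Y a b XY Ua Ub; set Z := (X `|` Y)%fset; move: a Ua b Ub.
  pose E a b := exists2 f, sums U V Z f &
      forall s t, Sym X s -> Sym Y t -> f (s * t)%g = a s * b t.
  have XZ : {subset X <= Z} by move=> i iX; rewrite inE iX.
  have YZ : {subset Y <= Z} by move=> i iY; rewrite inE iY orbT.
  have Zl := sums_linear U V Z.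
  have Ea a : invariant Y (E a).
    split.
    + split; first by exists (fun=> 0) => [|s t _ _]; [case: Zl|rewrite mulr0].
      move=> c f g [F PF Ff] [H PH Hg]; exists (fun s => c * F s + H s).
        by case: Zl => _; apply.
      by move=> s t sX tY; rewrite Ff // Hg //; ring.
    + by move=> f g [F PF Ff] fg; exists F => // s t sX tY; rewrite Ff // fg.
    + move=> r f rY [F PF Ff]; exists (fun s => F (r * s)%g).
        by apply: Sums_left => //; apply: Sym_sub YZ rY.
      move=> s t sX tY; rewrite mulgA -(Sym_comm XY sX rY) -mulgA Ff //.
      exact: SymM.
    + move=> r f rY [F PF Ff]; exists (fun s => F (s * r)%g).
        by apply: Sums_right => //; apply: Sym_sub YZ rY.
      by move=> s t sX tY; rewrite -mulgA Ff //; apply: SymM.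
  apply: (sums_min (A := [set a | forall b, sums U V Y b -> E a b])).
    split.
    + split=> [b _|c f g Ef Eg b Vb].
        by exists (fun=> 0) => [|s t _ _]; [case: Zl|rewrite mul0r].
      have [[F PF Ff] [H PH Hg]] := (Ef b Vb, Eg b Vb).
      exists (fun s => c * F s + H s); first by case: Zl => _; apply.
      by move=> s t sX tY; rewrite Ff // Hg //; ring.
    + by move=> f g Ef fg b /Ef[F PF Ff]; exists F => // s t sX tY; rewrite Ff // fg.
    + move=> r f rX Ef b /Ef[F PF Ff]; exists (fun s => F (r * s)%g).
        by apply: Sums_left => //; apply: Sym_sub XZ rX.
      by move=> s t sX tY; rewrite mulgA Ff //; apply: SymM.
    + move=> r f rX Ef b /Ef[F PF Ff]; exists (fun s => F (s * r)%g).
        by apply: Sums_right => //; apply: Sym_sub XZ rX.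
      move=> s t sX tY; rewrite -mulgA -(Sym_comm XY rX tY) mulgA Ff //.
      exact: SymM.
  move=> P a a' PX Ua Va'; apply: sums_min => // Q b b' QY Ub Vb'.
  have dis P' Q' : {subset P' <= X} -> {subset Q' <= Y} -> [disjoint P' & Q']%fset.
    move=> P'X Q'Y; apply/fdisjointP => i /P'X iX; apply/negP => /Q'Y iY.
    by have := fdisjointP XY i iX; rewrite iY.
  have DX (X' P' : {fset nat}) : {subset (X' `\` P')%fset <= X'}.
    by move=> i; rewrite inE => /andP[].
  have [f Uf fE] := ts_ext TU (dis _ _ PX QY) Ua Ub.
  have [g Vg gE] := ts_ext TV (dis _ _ (DX _ _) (DX _ _)) Va' Vb'.
  exists (block Z (P `|` Q)%fset f g); first apply: Sums_block => //.
  + by move=> i; rewrite inE => /orP[/PX/XZ|/QY/YZ].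
  + by rewrite fsetD_prod.
  move=> s t sX tY; rewrite block_prod // /block.
  have [sP|nsP] := pselect (maps s P P); last by rewrite [stabb P s]stabbF // !mul0r.
  have [tQ|ntQ] := pselect (maps t Q Q); last by rewrite [stabb Q t]stabbF // mulr0 !mul0r mulr0.
  rewrite fE ?gE; [ring| | | | ]; apply: restr_Sym => //; exact: mapsC.
- apply: Sums_loc (Sums_block (P := fset0) (f := fun=> 1) (g := fun=> 1) _ _ _) _.
  + by [].
  + exact: ts_one.
  + by rewrite fsetD0; apply: ts_one.
  by move=> s _; rewrite /block stabbT // !mulr1.
Qed.

End Sums.

Section SumLaws.
Context {k : fieldType}.
Local Notation fn := (Sinf -> k).
Local Notation sys := ({fset nat} -> set fn).
Implicit Types (f g a b : fn) (X Y Z P Q : {fset nat}) (s t : Sinf) (U V W : sys).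

(** Functions killing the unit ideal. The component at the empty set is not
    zero, so that splitting off an empty set changes nothing. *)
Definition sys_zero : sys :=
  fun X => [set f | X != fset0 -> forall s, Sym X s -> f s = 0].

Lemma sys_zero0 f : sys_zero fset0 f.
Proof. by rewrite /sys_zero /mkset eqxx. Qed.

Lemma fsetU_neq0 X Y : ((X `|` Y)%fset != fset0) = (X != fset0) || (Y != fset0).
Proof.
apply/idP/idP => [/fset0Pn[i]|/orP[]/fset0Pn[i iX]].
- by rewrite inE => /orP[] iX; apply/orP; [left|right]; apply/fset0Pn; exists i.
- by apply/fset0Pn; exists i; rewrite inE iX.
- by apply/fset0Pn; exists i; rewrite inE iX orbT.
Qed.

Lemma sys_zero_Tsystem : Tsystem sys_zero.
Proof.
split.
- move=> X; split=> [_ //|c f g f0 g0 X0 s sX].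
  by rewrite f0 ?g0 // mulr0 addr0.
- by move=> X f g f0 fg X0 s sX; rewrite -fg // f0.
- move=> X Y s f sXY f0 Y0 t tY; apply: f0; last exact: Sym_conj tY.
  by rewrite -cardfs_gt0 (maps_card sXY) cardfs_gt0.
- by move=> X s f sX f0 X0 t tX; apply: f0 => //; apply: SymM.
- move=> X Y f XY f0; have [Z0|] := boolP ((X `|` Y)%fset != fset0).
    exists (fun _ _ => 0); first exact: Tensors0.
    by move=> s t sX tY; rewrite f0 //; apply: Sym_setU.
  rewrite fsetU_neq0 negb_or !negbK => /andP[/eqP X0 /eqP Y0].
  exists (fun _ _ => f 1%g * 1).
    apply: (tensors1 (a := fun=> f 1%g) (b := fun=> 1)).
      by rewrite X0; apply: sys_zero0.
    by rewrite Y0; apply: sys_zero0.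
  by rewrite X0 Y0 => s t /Sym0-> /Sym0->; rewrite mulg1 mulr1.
- move=> X Y a b XY a0 b0; have [Z0|] := boolP ((X `|` Y)%fset != fset0).
    exists (fun=> 0) => // s t sX tY; move: Z0; rewrite fsetU_neq0.
    by case/orP => [X0|Y0]; [rewrite a0 // mul0r|rewrite b0 // mulr0].
  rewrite fsetU_neq0 negb_or !negbK => /andP[/eqP X0 /eqP Y0].
  exists (fun _ => a 1%g * b 1%g); first by rewrite X0 Y0 fsetU0; apply: sys_zero0.
  by rewrite X0 Y0 => s t /Sym0-> /Sym0->.
exact: sys_zero0.
Qed.

Lemma fsetDK_sub X P : {subset P <= X} -> (X `\` (X `\` P) = P)%fset.
Proof.
move=> PX; apply/fsetP => i; rewrite !inE.
by case: (boolP (i \in P)) => [/PX ->|_] //=; case: (i \in X).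
Qed.

Lemma fsubD X P : {subset (X `\` P)%fset <= X}.
Proof. by move=> i; rewrite inE => /andP[]. Qed.

(** A permutation preserves [P] if and only if it preserves the complement. *)
Lemma sumsC U V : sums U V = sums V U.
Proof.
suff sub U' V' X : sums U' V' X `<=` sums V' U' X.
  by apply: sys_ext => X; apply: sub.
apply: sums_min; first exact: sums_inv.
move=> P f g PX Uf Vg.
have Uf' : U' (X `\` (X `\` P))%fset f by rewrite fsetDK_sub.
apply: Sums_loc (Sums_block (fsubD (P := P)) Vg Uf') _.
move=> s sX; rewrite /block fsetDK_sub //.
rewrite [f _ * g _]mulrC; congr (_ * _); apply: eq_stabb; split; last exact: mapsC.
by move=> /(mapsC (fsubD (P := P)) sX); rewrite fsetDK_sub.
Qed.

(** Only the block that splits off the empty set survives. *)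
Lemma sums0s V : Tsystem V -> sums sys_zero V = V.
Proof.
move=> TV; apply: sys_ext => X.
  apply: sums_min; first exact: Tsystem_inv.
  move=> P f g PX f0 Vg; have [P0|P0] := eqVneq P fset0.
    subst P; rewrite fsetD0 in Vg.
    apply: (ts_loc TV (linear_setZ (f 1%g) (ts_lin TV X) Vg)) => s sX.
    rewrite /block fsetD0 stabbT // mul1r (restr_id sX); congr (f _ * _).
    by apply/esym/Sym0/restr_Sym.
  apply: (ts_loc TV (f := fun=> 0)); first by case: (ts_lin TV X).
  move=> s sX; rewrite /block; have [sP|nsP] := pselect (maps s P P).
    by rewrite (f0 P0) ?mul0r ?mulr0 //; apply: restr_Sym.
  by rewrite stabbF // mul0r.
move=> g Vg; have := @Sums_block k sys_zero V X fset0 (fun=> 1) g.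
have sub0 : {subset fset0 <= X} by [].
rewrite fsetD0 => /(_ sub0 (sys_zero0 _) Vg) h; apply: Sums_loc h _.
by move=> s sX; rewrite /block stabbT // !mul1r fsetD0 restr_id.
Qed.

Lemma prods0s V : Tsystem V -> prods sys_zero V = sys_zero.
Proof.
move=> TV; have T0 := sys_zero_Tsystem; apply: sys_ext => X.
  apply: prods_min; [exact: ts_lin|exact: (ts_loc T0)|].
  by move=> a b a0 Vb X0 s sX; rewrite a0 // mul0r.
move=> f f0; have [X0|X0] := eqVneq X fset0.
  subst X; apply: Prods_loc (prods1 (a := fun=> f 1%g) _ (ts_one TV)) _.
    exact: sys_zero0.
  by move=> s /Sym0 ->; rewrite mulr1.
by apply: Prods_loc (Prods0 _ _ _) _ => s sX; rewrite f0.
Qed.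

(** A block whose first entry is itself a block on [Q] inside [P] is, read in
    the other order, a block on [Q] whose second entry is a block on [P \ Q]. *)
Lemma sumsA_sub U V W X : Tsystem U -> Tsystem V -> Tsystem W ->
  sums (sums U V) W X `<=` sums U (sums V W) X.
Proof.
move=> TU TV TW; apply: sums_min; first exact: sums_inv.
move=> P f g PX Uf Wg; move: f Uf.
set T := sums U (sums V W) X; have [Tl Tloc Tleft Tright] := sums_inv U (sums V W) X.
apply: (sums_min (A := [set f | T (block X P f g)])).
  split=> [|f f' /= Tf ff'|s f sP /= Tf|s f sP /= Tf].
  - split=> [|c f f' Tf Tf'] /=.
      by apply: Tloc (Sums0 _ _ _) _ => s _; rewrite /block mul0r mulr0.
    by apply: Tloc (Tl.2 c _ _ Tf Tf') _ => s _; rewrite block_lin_l.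
  - by apply: Tloc Tf _ => s sX; apply: block_loc.
  - have sX := Sym_sub PX sP.
    apply: Tloc (Tleft s _ sX Tf) _ => t tX.
    rewrite block_mull //; last exact: SymP.
    apply: block_loc => // r rP; rewrite ?(restr_id sP) // (restr_disj _ sP) ?mul1g //.
    by rewrite fdisjoint_sym fdisjointD.
  - have sX := Sym_sub PX sP.
    apply: Tloc (Tright s _ sX Tf) _ => t tX.
    rewrite block_mulr //; last exact: SymP.
    apply: block_loc => // r rP; rewrite ?(restr_id sP) // (restr_disj _ sP) ?mulg1 //.
    by rewrite fdisjoint_sym fdisjointD.
move=> Q a b QP Ua Vb /=.
have QX : {subset Q <= X} by move=> i /QP/PX.
have PQXQ : {subset (P `\` Q)%fset <= (X `\` Q)%fset}.
  by move=> i; rewrite !inE => /andP[-> /PX].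
have eD : ((X `\` Q) `\` (P `\` Q) = X `\` P)%fset.
  apply/fsetP => i; rewrite !inE; case: (boolP (i \in Q)) => [/QP ->|_] //=.
have cQ : [disjoint Q & P `\` Q]%fset by apply: fdisjointD.
have Wg' : W ((X `\` Q) `\` (P `\` Q))%fset g by rewrite eD.
apply: Sums_loc (Sums_block QX Ua (Sums_block PQXQ Vb Wg')) _.
move=> s sX; rewrite /block eD.
have [sQ|nsQ] := pselect (maps s Q Q); last first.
  rewrite [stabb Q s]stabbF // mul0r; have [sP|nsP] := pselect (maps s P P).
    by rewrite (@stabbF _ Q (restr P s)) ?mul0r ?mulr0 // => /(maps_restr QP sP).
  by rewrite [stabb P s]stabbF // mul0r.
have sXQ := mapsC QX sX sQ.
have [sP|nsP] := pselect (maps s P P); last first.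
  rewrite [stabb P s]stabbF // mul0r (@stabbF _ _ (restr (X `\` Q)%fset s)) ?mul0r ?mulr0 //.
  move/(maps_restr PQXQ sXQ) => sPQ; apply: nsP.
  by rewrite -(fsetUDK QP); apply: mapsU.
have sPQ : maps s (P `\` Q)%fset (P `\` Q)%fset by apply: mapsD.
have rQ := (maps_restr QP sP).2 sQ; have rPQ := (maps_restr PQXQ sXQ).2 sPQ.
rewrite (stabbT sP) (stabbT sQ) (stabbT rQ) (stabbT rPQ).
have XPQ : {subset (X `\` P)%fset <= (X `\` Q)%fset}.
  by move=> i; rewrite !inE => /andP[iP ->]; rewrite andbT; apply: contra iP => /QP.
have sXP := mapsC PX sX sP.
rewrite (restr_restr QP sP sQ) (restr_restr (fsubD (P := Q)) sP sPQ).
by rewrite (restr_restr PQXQ sXQ sPQ) (restr_restr XPQ sXQ sXP); ring.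
Qed.

(** By commutativity, the two inclusions are the same statement. *)
Lemma sumsA U V W : Tsystem U -> Tsystem V -> Tsystem W ->
  sums U (sums V W) = sums (sums U V) W.
Proof.
move=> TU TV TW; apply: sys_ext => X; last exact: sumsA_sub.
rewrite sumsC [sums V W]sumsC [sums (sums U V) W]sumsC [sums U V]sumsC.
exact: sumsA_sub.
Qed.

(** On the stabiliser of [P], a function of [W X] splits along [P] by [ts_res];
    conversely [ts_ext] glues the factors from [W] of the two entries of a
    block. *)
Lemma prods_sumsDl U V W : Tsystem U -> Tsystem V -> Tsystem W ->
  prods (sums U V) W = sums (prods U W) (prods V W).
Proof.
move=> TU TV TW; have [TUW TVW] := (prods_Tsystem TU TW, prods_Tsystem TV TW).
have TUV := sums_Tsystem TU TV; have TP := prods_Tsystem TUV TW.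
apply: sys_ext => X.
  have [Tl Tloc Tleft Tright] := sums_inv (prods U W) (prods V W) X.
  set T := sums (prods U W) (prods V W) X in Tl Tloc Tleft Tright *.
  apply: prods_min => // f c Uf; move: f Uf c.
  apply: (sums_min (A := [set f | forall c, W X c -> T (fun s => f s * c s)])).
    split=> [|f g Tf fg c Wc|s f sX Tf c Wc|s f sX Tf c Wc] /=.
    - split=> [c Wc|d f g Tf Tg c Wc] /=.
        by under eq_fun do rewrite mul0r; case: Tl.
      under eq_fun do rewrite mulrDl -mulrA.
      by apply: Tl.2; [apply: Tf|apply: Tg].
    - by apply: Tloc (Tf c Wc) _ => s /fg ->.
    - apply: Tloc (Tleft s _ sX (Tf _ (ts_left TW (SymV sX) Wc))) _ => t tX.
      by rewrite mulKg.
    - apply: Tloc (Tright s _ sX (Tf _ (ts_right TW (SymV sX) Wc))) _ => t tX.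
      by rewrite mulgK.
  move=> P a b PX Ua Vb c Wc; have dis := fdisjointD P X.
  have := Wc; rewrite -{1}(fsetUDK PX) => /(ts_res TW dis)[F FT cF].
  apply: (Tloc (fun s => block X P a b s * F (restr P s) (restr (X `\` P)%fset s))).
    elim: FT => [|c1 c2 E Wc1 Wc2 _ IH].
      by under eq_fun do rewrite mulr0; case: Tl.
    under eq_fun do rewrite mulrDr; apply: linear_setD => //.
    apply: Tloc (Sums_block PX (prods1 Ua Wc1) (prods1 Vb Wc2)) _ => s sX.
    by rewrite /block; ring.
  move=> s sX; have [sP|nsP] := pselect (maps s P P); last first.
    by rewrite /block stabbF // !mul0r.
  rewrite -cF; [by rewrite -restr_split|exact: restr_Sym|].
  by apply: restr_Sym; apply: mapsC.
apply: sums_min; first exact: Tsystem_inv.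
have [Tl Tloc _ _] := Tsystem_inv X TP.
move=> P f g PX Uf; move: f Uf g; have dis := fdisjointD P X.
apply: (prods_min (A := [set f | forall g, prods V W (X `\` P)%fset g ->
   prods (sums U V) W X (block X P f g)])) => /=.
- split=> [g Vg|c f f' Tf Tf' g Vg] /=.
    by apply: Tloc (Prods0 _ _ _) _ => s _; rewrite /block mul0r mulr0.
  by apply: Tloc (Tl.2 c _ _ (Tf _ Vg) (Tf' _ Vg)) _ => s _; rewrite block_lin_l.
- by move=> f f' Tf ff' g Vg; apply: Tloc (Tf _ Vg) _ => s sX; apply: block_loc.
move=> a c Ua Wc; apply: prods_min.
- split=> [|d g g' Tg Tg'] /=.
    by apply: Tloc (Prods0 _ _ _) _ => s _; rewrite /block !mulr0.
  by apply: Tloc (Tl.2 d _ _ Tg Tg') _ => s _; rewrite block_lin_r.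
- by move=> g g' Tg gg'; apply: Tloc Tg _ => s sX; apply: block_loc.
move=> b c' Vb Wc'; have [d Wd dE] := ts_ext TW dis Wc Wc'.
rewrite fsetUDK // in Wd.
apply: Tloc (prods1 (Sums_block PX Ua Vb) Wd) _ => s sX; rewrite /block.
have [sP|nsP] := pselect (maps s P P); last by rewrite stabbF // !mul0r.
have -> : d s = d (restr P s * restr (X `\` P)%fset s)%g by rewrite -restr_split.
by rewrite dE; [ring|apply: restr_Sym|apply: restr_Sym; apply: mapsC].
Qed.

End SumLaws.

(** * From ideals to systems and back *)

Section Tensors.
Context {k : fieldType}.
Implicit Types (V W : lmodType k).

Lemma subspaceD V (A : set V) x y : is_subspace A -> A x -> A y -> A (x + y).
Proof. by move=> [_ Al] Ax Ay; rewrite -[x]scale1r; apply: Al. Qed.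

Lemma sum_subspaceP V (A B : set V) : is_subspace A -> is_subspace B ->
  is_subspace (sum_subspace A B).
Proof.
move=> [A0 Al] [B0 Bl]; split.
  by exists 0 => //; exists 0 => //; rewrite addr0.
move=> c _ _ [a Aa [b Bb <-]] [a' Aa' [b' Bb' <-]].
exists (c *: a + a'); first exact: Al.
exists (c *: b + b'); first exact: Bl.
by rewrite scalerDr addrACA.
Qed.

Lemma tensorDl V W (v v' : V) (w : W) : tensor (v + v') w = tensor v w + tensor v' w.
Proof. by have := (@tensor_bilinear k V W).1 w 1 v v'; rewrite !scale1r. Qed.

Lemma tensorDr V W (v : V) (w w' : W) : tensor v (w + w') = tensor v w + tensor v w'.
Proof. by have := (@tensor_bilinear k V W).2 v 1 w w'; rewrite !scale1r. Qed.

Lemma tensor0l V W (w : W) : tensor (0 : V) w = 0.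
Proof. by apply: (addIr (tensor 0 w)); rewrite -tensorDl !add0r. Qed.

Lemma tensor0r V W (v : V) : tensor v (0 : W) = 0.
Proof. by apply: (addIr (tensor v 0)); rewrite -tensorDr !add0r. Qed.

Lemma tensorZl V W c (v : V) (w : W) : tensor (c *: v) w = c *: tensor v w.
Proof.
by have := (@tensor_bilinear k V W).1 w c v 0; rewrite tensor0l !addr0.
Qed.

Lemma tensorZr V W c (v : V) (w : W) : tensor v (c *: w) = c *: tensor v w.
Proof.
by have := (@tensor_bilinear k V W).2 v c w 0; rewrite tensor0r !addr0.
Qed.

Lemma tensorBl V W (v v' : V) (w : W) : tensor (v - v') w = tensor v w - tensor v' w.
Proof. by rewrite tensorDl -scaleN1r tensorZl scaleN1r. Qed.

Lemma tensorBr V W (v : V) (w w' : W) : tensor v (w - w') = tensor v w - tensor v w'.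
Proof. by rewrite tensorDr -scaleN1r tensorZr scaleN1r. Qed.

Lemma tensor_suml V W (I : Type) (r : seq I) (F : I -> V) (w : W) :
  tensor (\sum_(i <- r) F i) w = \sum_(i <- r) tensor (F i) w.
Proof.
by elim: r => [|i r IH]; rewrite ?big_nil ?tensor0l // !big_cons tensorDl IH.
Qed.

Lemma tensor_sumr V W (I : Type) (r : seq I) (v : V) (F : I -> W) :
  tensor v (\sum_(i <- r) F i) = \sum_(i <- r) tensor v (F i).
Proof.
by elim: r => [|i r IH]; rewrite ?big_nil ?tensor0r // !big_cons tensorDr IH.
Qed.

Lemma tens_ind V W (A : set (tens V W)) : is_subspace A ->
  (forall v w, A (tensor v w)) -> forall t, A t.
Proof.
move=> [A0 Al] Avw t; rewrite -[t]lreprK; move: (lrepr t) => x.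
rewrite -(lext_id x) lextE.
elim: (enum_fset _) => [|p r IH]; first by rewrite big_nil raddf0.
rewrite big_cons linearP; apply: Al => //.
by have := Avw p.1 p.2; rewrite tensor.unlock -surjective_pairing.
Qed.

Lemma tens_subspace V W (A : set V) (B : set W) : is_subspace (tens_sub A B).
Proof. exact: span_subspace. Qed.

Lemma tens_subT V W (A : set V) (B : set W) a b : A a -> B b ->
  tens_sub A B (tensor a b).
Proof. by move=> Aa Bb W0; case=> _; apply; exists a => //; exists b. Qed.

(** Write [x'] and [y'] for the two sums: the difference is [(x - x') (x) y +
    x' (x) (y - y')]. *)
Lemma tensor_reduce V W (A : set V) (B : set W) x y m n
    (c : nat -> k) (a : nat -> V) (d : nat -> k) (b : nat -> W) :
  A (x - \sum_(i < m) c i *: a i) -> B (y - \sum_(j < n) d j *: b j) ->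
  sum_subspace (tens_sub A setT) (tens_sub setT B)
    (tensor x y - \sum_(i < m) \sum_(j < n) (c i * d j) *: tensor (a i) (b j)).
Proof.
move=> Ax By; pose x' := \sum_(i < m) c i *: a i; pose y' := \sum_(j < n) d j *: b j.
exists (tensor (x - x') y); first exact: tens_subT.
exists (tensor x' (y - y')); first exact: tens_subT.
rewrite tensorBl tensorBr addrA subrK; congr (_ - _).
rewrite /x' tensor_suml; apply: eq_bigr => i _.
rewrite /y' tensor_sumr; apply: eq_bigr => j _.
by rewrite tensorZl tensorZr scalerA.
Qed.

End Tensors.

Section Levels.
Context {k : fieldType}.
Local Notation fn := (Sinf -> k).
Implicit Types (f g a b : fn) (X Y : {fset nat}) (x z : kSinf k).

Lemma kS_incl_lin n c (x y : kS k n) :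
  kS_incl (c *: x + y) = c *: kS_incl x + kS_incl y.
Proof. exact: (linearP (lext _)). Qed.

Lemma kS_incl0 n : kS_incl (0 : kS k n) = 0.
Proof. exact: (raddf0 (lext _)). Qed.

Lemma kS_incl_gelt n (s : 'S_n) : kS_incl (gelt k s) = gelt k (ext_perm s).
Proof. by rewrite /kS_incl /galg_map /gelt lextU. Qed.

Lemma ev_incl f n (x : kS k n) : ev f (kS_incl x) = ev (fun s => f (ext_perm s)) x.
Proof.
elim/(@galg_ind k): x => [|c x y ex ey|s]; first by rewrite kS_incl0 !ev0.
  by rewrite kS_incl_lin !evP ex ey.
by rewrite kS_incl_gelt !ev_gelt.
Qed.

Lemma kS_incl_eq0 n (x : kS k n) : (forall f, ev f (kS_incl x) = 0) -> x = 0.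
Proof.
move=> x0; apply/malgP => s; rewrite mcoeff0 -mcoeff_ev.
rewrite -[RHS](x0 (fun t => (t == ext_perm s)%:R)) ev_incl; congr (ev _ x).
by apply/funext => t; rewrite (inj_eq (@ext_perm_inj n)).
Qed.

Lemma carried_incl n (x : kS k n) : carried (Sym (ival 0 n)) (kS_incl x).
Proof.
move=> f f0; rewrite ev_incl -[RHS](ev0f x); congr (ev _ x).
by apply/funext => s; apply: f0; apply: Sym_ext.
Qed.

Lemma carried_lift (V : lmodType k) (F : V -> kSinf k) (D : set Sinf) z :
  (forall c v w, F (c *: v + w) = c *: F v + F w) ->
  (forall s, D s -> exists v, F v = gelt k s) ->
  carried D z -> exists v, F v = z.
Proof.
move=> Fl FD Dz.
have F0 : F 0 = 0.
  by have := Fl (-1) 0 0; rewrite scaler0 addr0 scaleN1r addNr.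
suff H (r : seq Sinf) : all (fun s => s \in msupp z) r ->
    exists v, F v = \sum_(s <- r) z@_s *: gelt k s.
  by rewrite (galgE z); apply: H; apply/allP.
elim: r => [|s r IH] /=; first by exists 0; rewrite big_nil.
case/andP=> sz /IH[v Fv]; have [w Fw] := FD s (carried_mcoeff Dz sz).
by exists (z@_s *: w + v); rewrite Fl Fv Fw big_cons.
Qed.

Lemma shift_exists m n : exists r : Sinf, forall i, (i < n)%N -> r i = (m + i)%N.
Proof.
have sub1 : {subset iota 0 n <= ival 0 (m + n)}.
  by move=> i; rewrite mem_iota in_ival /= !add0n => /leq_trans; apply; rewrite leq_addl.
have sub2 : {subset iota m n <= ival 0 (m + n)}.
  by move=> i; rewrite mem_iota in_ival /= add0n => /andP[].
have sz : size (iota 0 n) = size (iota m n) by rewrite !size_iota.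
have [r _ rE] := sym_ext_seq (iota_uniq _ _) (iota_uniq _ _) sz sub1 sub2.
by exists r => i ni; have := rE i; rewrite size_iota !nth_iota // add0n; apply.
Qed.

(** Some permutation carrying the first [n] points to the [n] points after the
    first [m]; conjugation by it turns the second factor of the Young subgroup
    into Sym([m, m + n[). *)
Definition shift m n : Sinf := sval (cid (shift_exists m n)).

Lemma shiftE m n i : (i < n)%N -> shift m n i = (m + i)%N.
Proof. exact: (svalP (cid (shift_exists m n))). Qed.

Lemma maps_shift m n : maps (shift m n) (ival 0 n) (ival m n).
Proof.
move=> i; rewrite !in_ival /= add0n; case: (ltnP i n) => [ni|ni].
  by rewrite shiftE // leq_addr ltn_add2l.
apply/negP => /andP[mi]; rewrite -(subnKC mi) ltn_add2l => lt.
move: ni; rewrite leqNgt => /negP; apply.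
by have := shiftE m lt; rewrite subnKC // => /(@sinf_inj (shift m n)) <-.
Qed.

Definition shifted m n (s : Sinf) : Sinf := ((shift m n)^-1 * s * shift m n)%g.

Lemma Sym_shifted m n s : Sym (ival 0 n) s -> Sym (ival m n) (shifted m n s).
Proof. exact: Sym_conjV (maps_shift m n). Qed.

Lemma ext_young m n p (e : (m + n)%N = p) (s : 'S_m) (t : 'S_n) :
  ext_perm (young e s t) = (ext_perm s * shifted m n (ext_perm t))%g.
Proof.
case: p / e; apply/sinfP => i; rewrite /young cast_perm_id sinfM /shifted !sinfM /=.
have shiftV j : (j < n)%N -> (shift m n)^-1%g (m + j)%N = j.
  by move=> jn; rewrite -(shiftE m jn) sinfK.
have out j : (j \notin ival m n) ->
    shift m n (ext_perm_fun t ((shift m n)^-1%g j)) = j.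
  by move=> jm; have := @Sym_shifted m n _ (Sym_ext t) j jm.
case: (ltnP i (m + n)) => [imn|imn]; last first.
  rewrite !(ext_perm_ge _ imn) (@ext_perm_ge m s i); last by apply: leq_trans imn; apply: leq_addr.
  by rewrite out // in_ival negb_and -leqNgt imn orbT.
rewrite -[i]/(val (Ordinal imn)) ext_perm_lt permE.
case: (split_ordP (Ordinal imn)) => j ->.
  rewrite young_fun_lshift /= ext_perm_lt out // in_ival negb_and -ltnNge ltn_ord //.
rewrite young_fun_rshift /= (@ext_perm_ge m) ?leq_addr // shiftV //.
by rewrite ext_perm_lt shiftE.
Qed.

Lemma young_tens_lin m n p (e : (m + n)%N = p) c (t u : tens (kS k m) (kS k n)) :
  young_tens e (c *: t + u) = c *: young_tens e t + young_tens e u.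
Proof. exact: (tlift_linear (lext2_bilinear _)). Qed.

Lemma young_tens0 m n p (e : (m + n)%N = p) : young_tens e 0 = 0 :> kS k p.
Proof.
by have := young_tens_lin e (-1) 0 0; rewrite scaler0 addr0 scaleN1r addNr.
Qed.

Lemma incl_young m n p (e : (m + n)%N = p) (x : kS k m) (y : kS k n) :
  kS_incl (young_tens e (tensor x y)) =
  kS_incl x * (gelt k (shift m n)^-1%g * kS_incl y * gelt k (shift m n)).
Proof.
elim/(@galg_ind k): x => [|c x x' ex ex'|s].
- by rewrite tensor0l young_tens0 !kS_incl0 mul0r.
- by rewrite tensorDl tensorZl young_tens_lin !kS_incl_lin ex ex' mulrDl -scalerAl.
elim/(@galg_ind k): y => [|c x x' ex ex'|t].
- by rewrite tensor0r young_tens0 !kS_incl0 mulr0 mul0r mulr0.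
- rewrite tensorDr tensorZr young_tens_lin !kS_incl_lin ex ex'.
  by rewrite [_ * (_ *: _ + _)]mulrDr mulrDl mulrDr -!scalerAr -scalerAl -scalerAr.
by rewrite young_tens_gelt !kS_incl_gelt -!geltM ext_young.
Qed.

Lemma ev_young f m n p (e : (m + n)%N = p) a b (x : kS k m) (y : kS k n) :
  (forall s t, Sym (ival 0 m) s -> Sym (ival m n) t -> f (s * t)%g = a s * b t) ->
  ev f (kS_incl (young_tens e (tensor x y))) =
  ev a (kS_incl x) * ev (fun t => b (shifted m n t)) (kS_incl y).
Proof.
move=> fE; rewrite incl_young; move: (carried_incl x) (carried_incl y).
move: (kS_incl x) (kS_incl y) => {}x {}y cx cy.
rewrite (galgE x) mulr_suml !ev_sum mulr_suml.
rewrite big_seq [RHS]big_seq; apply: eq_bigr => s sx.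
rewrite -scalerAl !evZ ev_gelt -[RHS]mulrA; congr (_ * _).
rewrite ev_mull ev_mulr ev_mull.
have Ss := carried_mcoeff cx sx.
rewrite mulrC -ev_linr; apply: (carried_eq cy) => t ty.
by rewrite fE //; [exact: mulrC|exact: Sym_shifted].
Qed.

Lemma levelE (I : set (kSinf k)) n : (0 < n)%N -> level I n = [set x | I (kS_incl x)].
Proof. by case: n. Qed.

(** In degree 0 the component of the ideal is zero by convention while all
    functions are available, so the equivalence holds there too. *)
Lemma levelP U n (x : kS k n) : Tsystem U ->
  (level (ideal_of U) n x <-> forall f, U (ival 0 n) f -> ev f (kS_incl x) = 0).
Proof.
move=> TU; case: (posnP n) => [n0|n0]; last first.
  by rewrite levelE //=; apply: ideal_ofP; [|exact: ival_neq0|exact: carried_incl].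
subst n => /=; have e : ival 0 0 = fset0 by apply/fsetP => i; rewrite in_ival.
split=> [->|x0]; first by move=> f _; rewrite kS_incl0 ev0.
apply: (@kS_incl_eq0 0) => f. apply: (x0 f). rewrite e -(perp_ideal_of fset0 TU).
by rewrite /perp /mkset eqxx.
Qed.

(** Finitely many permutations span the group algebra modulo the ideal, with
    coordinate functions in [U]: the interpolation lemma, read in the quotient. *)
Lemma level_basis U n : Tsystem U -> exists N (p : nat -> 'S_n) (u : nat -> fn),
  (forall i, U (ival 0 n) (u i)) /\ forall s : 'S_n,
    level (ideal_of U) n
      (gelt k s - \sum_(i < N) u i (ext_perm s) *: gelt k (p i)).
Proof.
move=> TU.
have [N [t [u [tX Uu fE]]]] := interpolation_on (Sym_finite (ival 0 n)) (ts_lin TU (ival 0 n)).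
have tp i : exists p : 'S_n, (i < N)%N -> ext_perm p = t i.
  case: (ltnP i N) => [iN|_]; last by exists 1%g.
  by have [p <-] := Sym_extP (tX i iN); exists p.
have [p pt] := choice tp; exists N, p, u; split=> // s; apply/(levelP _ TU) => f Uf.
rewrite ev_incl evB ev_gelt ev_sum (fE _ Uf); last exact: Sym_ext.
rewrite -sumrB big1 // => i _.
by rewrite evZ ev_gelt pt ?ltn_ord // mulrC subrr.
Qed.

End Levels.

Section TPrime.
Context {k : fieldType}.
Local Notation fn := (Sinf -> k).
Implicit Types (f g a b : fn) (X Y : {fset nat}) (x z : kSinf k).

Lemma preim_subspace (V W : lmodType k) (F : V -> W) (A : set W) :
  (forall c v w, F (c *: v + w) = c *: F v + F w) -> is_subspace A ->
  is_subspace (F @^-1` A).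
Proof.
move=> Fl [A0 Al]; split=> [|c u v /= Au Av]; last by rewrite Fl; apply: Al.
have := Fl (-1) 0 0; rewrite scaler0 addr0 scaleN1r addNr => e.
by rewrite /preimage /mkset e.
Qed.

Definition residue (V : lmodType k) M N (w : nat -> nat -> V)
    (c : V -> nat -> nat -> k) (t : V) : V :=
  t - \sum_(i < M) \sum_(j < N) c t i j *: w i j.

Lemma residue_lin (V : lmodType k) M N (w : nat -> nat -> V) c :
  (forall d t u i j, c (d *: t + u) i j = d * c t i j + c u i j) ->
  forall d t u, residue M N w c (d *: t + u) =
    d *: residue M N w c t + residue M N w c u.
Proof.
move=> cl d t u; rewrite /residue scalerBr addrACA -opprD; congr (_ - _).
rewrite scaler_sumr -big_split; apply: eq_bigr => i _ /=.
rewrite scaler_sumr -big_split; apply: eq_bigr => j _ /=.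
by rewrite cl scalerDl scalerA.
Qed.

Lemma residue_id (V : lmodType k) M N (w : nat -> nat -> V) c t :
  (forall i j, c t i j = 0) -> residue M N w c t = t.
Proof.
move=> c0; rewrite /residue big1 ?subr0 // => i _; rewrite big1 // => j _.
by rewrite c0 scale0r.
Qed.

(** An element [t] of the tensor product is reduced, modulo the two ideals, to
    a combination of tensors of permutations from [level_basis]. By [ts_ext]
    its coefficients are the values on [t] of functions of the system on the
    larger set, so they vanish if the image of [t] is in the ideal. *)
Lemma ideal_of_T_prime (U : {fset nat} -> set fn) :
  Tsystem U -> T_prime (ideal_of U).
Proof.
move=> TU m n m0 n0; have mn0 : (0 < m + n)%N by rewrite ltn_addr.
have Iid := ideal_of_ideal TU; have Isub := ideal_subspace Iid.
set I := ideal_of U in Iid Isub *.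
apply/seteqP; split=> [z|z [t tS <-]]; last first.
  split; last by exists t.
  rewrite levelE //=; case: tS => t1 t1S [t2 t2S <-].
  pose A := [set t | I (kS_incl (young_tens (erefl (m + n)%N) t))].
  have As : is_subspace A.
    apply: (preim_subspace (F := fun t => kS_incl (young_tens (erefl (m + n)%N) t))) => //.
    by move=> c v w; rewrite young_tens_lin kS_incl_lin.
  case: Iid => _ _ IM.
  suff [A1 A2] : A t1 /\ A t2 by apply: (subspaceD As).
  split; [move: t1 t1S|move: t2 t2S]; apply: span_ind => // _ [x xI [y yI <-]].
    by rewrite /A /= incl_young; rewrite levelE // in xI; case: (IM (gelt k (shift m n)^-1%g * kS_incl y * gelt k (shift m n)) _ xI).
  rewrite /A /= incl_young; rewrite levelE // in yI.
  have [/(IM (gelt k (shift m n)) _)[_ h] _] := IM (gelt k (shift m n)^-1%g) _ yI.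
  by have [] := IM (kS_incl x) _ h.
move=> [zI [t _ tz]]; exists t => //.
have [M [p [u [Uu uE]]]] := level_basis m TU.
have [N [q [v [Uv vE]]]] := level_basis n TU.
have dis : [disjoint ival 0 m & ival m n]%fset.
  by apply/fdisjointP => i; rewrite !in_ival /= add0n negb_and -ltnNge => ->.
have eU : (ival 0 m `|` ival m n = ival 0 (m + n))%fset.
  apply/fsetP => i; rewrite inE !in_ival /= !add0n.
  by case: (ltnP i m) => //= im; rewrite ltn_addr.
have hex i j : exists h : fn, U (ival 0 (m + n)) h /\
    forall s r, Sym (ival 0 m) s -> Sym (ival m n) r ->
    h (s * r)%g = u i s * v j (shift m n * r * (shift m n)^-1)%g.
  have [h Uh hE] := ts_ext TU dis (Uu i) (ts_conj TU (maps_shift m n) (Uv j)).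
  by exists h; rewrite -eU.
pose h i := projT1 (choice (hex i)); have hP i := projT2 (choice (hex i)).
pose w i j := tensor (gelt k (p i)) (gelt k (q j)).
pose cf t i j := ev (h i j) (kS_incl (young_tens (erefl (m + n)%N) t)).
pose G := residue M N w cf.
set S := sum_subspace _ _.
have Ssub : is_subspace S by apply: sum_subspaceP; apply: tens_subspace.
have Gl : forall d t1 t2, G (d *: t1 + t2) = d *: G t1 + G t2.
  by apply: residue_lin => d t1 t2 i j; rewrite /cf young_tens_lin kS_incl_lin evP.
have GS : forall t, S (G t).
  apply: tens_ind; first exact: (preim_subspace Gl).
  have [S0 Sl] := Ssub.
  have G0 : G 0 = 0.
    by have := Gl (-1) 0 0; rewrite scaler0 addr0 scaleN1r addNr.
  move=> x y; elim/(@galg_ind k): x => [|c x x' ex ex'|s].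
  - by rewrite tensor0l G0.
  - by rewrite tensorDl tensorZl Gl; apply: Sl.
  elim/(@galg_ind k): y => [|c y y' ey ey'|r].
  - by rewrite tensor0r G0.
  - by rewrite tensorDr tensorZr Gl; apply: Sl.
  have cE i j : cf (tensor (gelt k s) (gelt k r)) i j =
      u i (ext_perm s) * v j (ext_perm r).
    rewrite /cf (ev_young _ _ _ (hP i j).2) !kS_incl_gelt !ev_gelt; congr (_ * v j _).
    by rewrite /shifted !mulgA mulgV mul1g mulgK.
  rewrite /G /residue; under eq_bigr do under eq_bigr do rewrite cE.
  exact: (@tensor_reduce k (kS k m) (kS k n) (level I m) (level I n)
    (gelt k s) (gelt k r) M N (fun i => u i (ext_perm s)) (fun i => gelt k (p i))
    (fun j => v j (ext_perm r)) (fun j => gelt k (q j)) (uE s) (vE r)).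
rewrite -[t](@residue_id _ M N w cf); first exact: GS.
move=> i j; rewrite /cf tz; move: zI; rewrite levelE //.
move=> /(_ (ival 0 (m + n)) (h i j)); apply; [exact: ival_neq0|exact: carried_incl|by case: (hP i j)].
Qed.

Lemma tensors_sum (A B : set fn) n (a : nat -> fn) (b : nat -> fn) :
  (forall i, (i < n)%N -> A (a i)) -> (forall i, B (b i)) ->
  tensors A B (fun s t => \sum_(i < n) a i s * b i t).
Proof.
elim: n => [|n IH] Aa Bb.
  under eq_fun => s do under eq_fun => t do rewrite big_ord0.
  exact: Tensors0.
under eq_fun => s do under eq_fun => t do rewrite big_ord_recr.
apply: tensorsD; last by apply: tensors1 => //; apply: Aa.
by apply: IH => // i ni; apply: Aa; apply: ltnW.
Qed.

Section Perp.
Context (I : set (kSinf k)) (Iid : is_ideal I).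

Lemma perp_lin X : linear_set (perp I X).
Proof.
split=> [_ z _ _|c f g f0 g0 X0 z Iz Xz]; first by rewrite ev0f.
by rewrite ev_lin f0 // g0 // mulr0 addr0.
Qed.

Lemma perp_loc X f g : perp I X f -> (forall s, Sym X s -> f s = g s) -> perp I X g.
Proof. by move=> f0 fg X0 z Iz Xz; rewrite -(carried_eq Xz fg) f0. Qed.

Lemma perp_conj X Y s f : maps s X Y -> perp I X f ->
  perp I Y (fun t => f (s * t * s^-1)%g).
Proof.
case: Iid => _ _ IM sXY f0 Y0 z Iz Yz.
have <- : ev f (gelt k s * z * gelt k s^-1%g) =
          ev (fun t => f (s * t * s^-1)%g) z.
  by rewrite ev_mulr ev_mull.
apply: f0.
- by rewrite -cardfs_gt0 (maps_card sXY) cardfs_gt0.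
- by have [/(IM (gelt k s^-1%g))[_]] := IM (gelt k s) _ Iz.
move=> g g0; rewrite ev_mulr ev_mull; apply: Yz => t tY.
by apply: g0; apply: Sym_conj tY.
Qed.

Lemma perp_left X s f : Sym X s -> perp I X f -> perp I X (fun t => f (s * t)%g).
Proof.
case: Iid => _ _ IM sX f0 X0 z Iz Xz; rewrite -ev_mull; apply: f0 => //.
  by have [] := IM (gelt k s) _ Iz.
by move=> g g0; rewrite ev_mull; apply: Xz => t tX; apply: g0; apply: SymM.
Qed.

(** Freezing one variable of a function that kills [I] leaves a function that
    kills [I], in each variable; a function of two variables all of whose
    slices lie in given finite dimensional spaces is a tensor. *)
Lemma perp_res X Y f : [disjoint X & Y]%fset -> perp I (X `|` Y)%fset f ->
  exists2 F, tensors (perp I X) (perp I Y) F &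
    forall s t, Sym X s -> Sym Y t -> f (s * t)%g = F s t.
Proof.
case: Iid => _ _ IM XY f0.
have fl t : Sym Y t -> perp I X (fun s => f (s * t)%g).
  move=> tY X0 z Iz Xz; rewrite -ev_mulr; apply: f0.
  - by rewrite fsetU_neq0 X0.
  - by have [] := IM (gelt k t) _ Iz.
  by move=> g g0; rewrite ev_mulr; apply: Xz => s sX; apply: g0; apply: Sym_setU.
have fr s : Sym X s -> perp I Y (fun t => f (s * t)%g).
  move=> sX Y0 z Iz Yz; rewrite -ev_mull; apply: f0.
  - by rewrite fsetU_neq0 Y0 orbT.
  - by have [] := IM (gelt k s) _ Iz.
  by move=> g g0; rewrite ev_mull; apply: Yz => t tY; apply: g0; apply: Sym_setU.
have [n [t [u [tY uP gE]]]] := interpolation_on (Sym_finite Y) (perp_lin Y).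
exists (fun s r => \sum_(i < n) f (s * t i)%g * u i r).
  by apply: (tensors_sum (a := fun i s => f (s * t i)%g)) => // i ni; apply: fl; apply: tY.
by move=> s r sX rY; rewrite (gE _ (fr s sX) r rY).
Qed.

(** This is where T-primeness is used: on the product of the two groups, [a s *
    b t] kills whatever is killed by the functions that kill [I], because such
    elements are combinations of products with one factor in [I]. *)
Lemma perp_ext_ival m n a b : T_prime I -> (0 < m)%N -> (0 < n)%N ->
  perp I (ival 0 m) a -> perp I (ival m n) b ->
  exists2 f, perp I (ival 0 (m + n)) f &
    forall s t, Sym (ival 0 m) s -> Sym (ival m n) t -> f (s * t)%g = a s * b t.
Proof.
move=> IT m0 n0 Ia Ib; have mn0 : (0 < m + n)%N by rewrite ltn_addr.
pose D : set Sinf := [set r | exists s t, [/\ Sym (ival 0 m) s, Sym (ival m n) t & r = (s * t)%g]].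
have eU : (ival 0 m `|` ival m n = ival 0 (m + n))%fset.
  apply/fsetP => i; rewrite inE !in_ival /= !add0n.
  by case: (ltnP i m) => //= im; rewrite ltn_addr.
have dis : [disjoint ival 0 m & ival m n]%fset.
  by apply/fdisjointP => i; rewrite !in_ival /= add0n negb_and -ltnNge => ->.
have DS : D `<=` Sym (ival 0 (m + n)).
  by move=> _ [s [t [sm tn ->]]]; rewrite -eU; apply: Sym_setU.
have Dfin : finite_in D.
  by have [L SL] := Sym_finite (ival 0 (m + n)); exists L => s /DS/SL.
pose phi s := a (restr (ival 0 m) s) * b (restr (ival m n) s).
have phiE s t : Sym (ival 0 m) s -> Sym (ival m n) t -> phi (s * t)%g = a s * b t.
  move=> sm tn; have dis' : [disjoint ival m n & ival 0 m]%fset by rewrite fdisjoint_sym.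
  rewrite /phi (restrM (SymP sm) (Sym_disj_maps dis tn)).
  rewrite (restrM (Sym_disj_maps dis' sm) (SymP tn)).
  rewrite (restr_id sm) (restr_id tn) (restr_disj dis tn) (restr_disj dis' sm).
  by rewrite mulg1 mul1g.
have [z Dz z0|f If fE] := double_annihilator_fun Dfin (perp_lin (ival 0 (m + n))) (f := phi).
  have Iz : I z.
    apply: (double_annihilator_alg (Sym_finite _) (ideal_subspace Iid)
      (carried_sub DS Dz)) => f f0.
    by apply: z0 => _ y Iy Sy; apply: f0.
  have [t tz] : exists t, kS_incl (young_tens (erefl (m + n)%N) t) = z.
    apply: carried_lift Dz => [c v w|_ [s [t [/Sym_extP[p <-] tn ->]]]].
      by rewrite young_tens_lin kS_incl_lin.
    have [q qE] := Sym_extP (Sym_conj (maps_shift m n) tn).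
    exists (tensor (gelt k p) (gelt k q)).
    by rewrite young_tens_gelt kS_incl_gelt ext_young qE /shifted !mulgA !mulgVK.
  have : (level I (m + n) `&` range (young_tens (erefl (m + n)%N)))
      (young_tens (erefl (m + n)%N) t).
    by split; [rewrite levelE //= tz|exists t].
  rewrite IT // => -[t' [t1 t1S [t2 t2S <-]] tE].
  rewrite -tz -tE {tE}.
  pose A := [set t | ev phi (kS_incl (young_tens (erefl (m + n)%N) t)) = 0].
  have As : is_subspace A.
    have Al c v w : ev phi (kS_incl (young_tens (erefl (m + n)%N) (c *: v + w))) =
       c * ev phi (kS_incl (young_tens (erefl (m + n)%N) v)) +
       ev phi (kS_incl (young_tens (erefl (m + n)%N) w)).
      by rewrite young_tens_lin kS_incl_lin evP.
    split=> [|c v w]; rewrite /A /=; last by rewrite Al => -> ->; rewrite mulr0 addr0.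
    have := Al (-1) 0 0; rewrite scaler0 addr0 mulN1r addNr; exact.
  apply: (subspaceD As); [move: t1 t1S|move: t2 t2S]; apply: span_ind => // _ [x xI [y yI <-]];
    rewrite /A /= (ev_young _ _ _ phiE).
    rewrite levelE // in xI; rewrite Ia ?mul0r //; first exact: ival_neq0.
    exact: carried_incl.
  rewrite levelE // in yI; have := perp_conj (mapsV (maps_shift m n)) Ib.
  rewrite invgK => Ib'.
  rewrite (Ib' _ _ yI) ?mulr0 //; first exact: ival_neq0.
  exact: carried_incl.
exists f => // s t sm tn; rewrite -fE ?phiE //.
by exists s, t.
Qed.

(** The case of two consecutive intervals, carried to [X] and [Y] by
    relabelling. *)
Lemma perp_ext X Y a b : T_prime I -> [disjoint X & Y]%fset ->
  perp I X a -> perp I Y b ->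
  exists2 f, perp I (X `|` Y)%fset f &
    forall s t, Sym X s -> Sym Y t -> f (s * t)%g = a s * b t.
Proof.
move=> IT XY Ia Ib; have [X0|X0] := eqVneq X fset0.
  exists (fun s => a 1%g * b s).
    by rewrite X0 fset0U; apply: (linear_setZ (a 1%g) (perp_lin Y) Ib).
  by rewrite X0 => s t /Sym0 -> _; rewrite mul1g.
have [Y0|Y0] := eqVneq Y fset0.
  exists (fun s => b 1%g * a s).
    by rewrite Y0 fsetU0; apply: (linear_setZ (b 1%g) (perp_lin X) Ia).
  by rewrite Y0 => s t _ /Sym0 ->; rewrite mulg1 mulrC.
set m := #|` X|; set n := #|` Y|.
pose Z := ((X `|` Y) `|` ival 0 (m + n))%fset.
have uXY : uniq (X ++ Y).
  rewrite cat_uniq !fset_uniq andbT /=; apply/hasPn => i iY.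
  by apply/negP => /(fdisjointP XY); rewrite iY.
have sz : size (X ++ Y) = size (iota 0 (m + n)) by rewrite size_cat size_iota.
have sub1 : {subset X ++ Y <= Z}.
  by move=> i; rewrite mem_cat !inE => ->.
have sub2 : {subset iota 0 (m + n) <= Z}.
  by move=> i; rewrite mem_iota in_fsetU in_ival => ->; rewrite orbT.
have [r _ rE] := sym_ext_seq uXY (iota_uniq _ _) sz sub1 sub2.
have sX : size X = m by [].
have sY : size Y = n by [].
have rX i : (i < m)%N -> r (nth 0%N X i) = i.
  move=> im; have := rE i; rewrite nth_cat sX im nth_iota ?add0n; last first.
    by rewrite ltn_addr.
  by apply; rewrite size_cat sX ltn_addr.
have rY i : (i < n)%N -> r (nth 0%N Y i) = (m + i)%N.
  move=> ni; have lt : (m + i < size (X ++ Y))%N by rewrite size_cat sX sY ltn_add2l.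
  have e : nth 0%N (X ++ Y) (m + i) = nth 0%N Y i.
    by rewrite nth_cat sX ltnNge leq_addr /= addKn.
  by have := rE _ lt; rewrite e nth_iota ?ltn_add2l // add0n.
have mX : maps r X (ival 0 m).
  move=> j; rewrite in_ival /= add0n; case: (boolP (j \in X)) => jX.
    by rewrite -(nth_index 0%N jX) rX index_mem.
  apply/negP => rj; move: jX; rewrite -(sinf_inj (rX _ rj)) => /negP; apply.
  exact: mem_nth.
have mY : maps r Y (ival m n).
  move=> j; rewrite in_ival; case: (boolP (j \in Y)) => jY.
    by rewrite -(nth_index 0%N jY) rY ?leq_addr ?ltn_add2l index_mem.
  apply/negP => /andP[mr rj]; have rj' : (r j - m < n)%N by rewrite ltn_subLR.
  have := rY _ rj'; rewrite subnKC // => /(@sinf_inj r) e.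
  by move: jY; rewrite -e mem_nth.
have m0 : (0 < m)%N by rewrite cardfs_gt0.
have n0 : (0 < n)%N by rewrite cardfs_gt0.
have [f If fE] := perp_ext_ival IT m0 n0 (perp_conj mX Ia) (perp_conj mY Ib).
have mXY : maps r (X `|` Y)%fset (ival 0 (m + n)).
  move=> j; rewrite in_fsetU -mX -mY !in_ival /= !add0n.
  by case: (ltnP (r j) m) => //= rm; rewrite ltn_addr.
exists (fun t => f (r^-1 * t * r)%g).
  by have := perp_conj (mapsV mXY) If; rewrite invgK.
move=> s t Xs Yt.
have -> : (r^-1 * (s * t) * r = (r^-1 * s * r) * (r^-1 * t * r))%g.
  by rewrite !mulgA mulgK.
rewrite fE; [|exact: Sym_conjV Xs|exact: Sym_conjV Yt].
by rewrite !mulgA mulgV !mul1g !mulgK.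
Qed.

Lemma perp_Tsystem : T_prime I -> Tsystem (perp I).
Proof.
move=> IT; split.
- exact: perp_lin.
- exact: perp_loc.
- exact: perp_conj.
- exact: perp_left.
- exact: perp_res.
- by move=> X Y a b; apply: perp_ext.
by rewrite /perp /mkset eqxx.
Qed.

End Perp.

End TPrime.

(** * The product of ideals *)

Section Bowtie.
Context {k : fieldType}.
Local Notation fn := (Sinf -> k).
Implicit Types (f g a b : fn) (X Y : {fset nat}) (x z : kSinf k).

Definition ev2 f g (t : tens (kSinf k) (kSinf k)) : k :=
  tlift (fun x y => (ev f x * ev g y : k^o)) t.

Lemma ev2_bilinear f g :
  bilinear2 (fun x y : kSinf k => (ev f x * ev g y : k^o)).
Proof.
split=> [y c x x'|x c y y']; rewrite evP.
  by rewrite mulrDl -mulrA.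
by rewrite mulrDr mulrCA.
Qed.

Lemma ev2_lin f g c t u : ev2 f g (c *: t + u) = c * ev2 f g t + ev2 f g u.
Proof. exact: (tlift_linear (ev2_bilinear f g)). Qed.

Lemma ev2_tensor f g x y : ev2 f g (tensor x y) = ev f x * ev g y.
Proof. exact: (tlift_tensor (ev2_bilinear f g)). Qed.

Lemma comult_lin c x y :
  comult (c *: x + y : kSinf k) = c *: comult x + comult y.
Proof. exact: (linearP (lext _)). Qed.

Lemma comult_gelt (s : Sinf) : comult (gelt k s) = tensor (gelt k s) (gelt k s).
Proof. by rewrite /comult /gelt lextU. Qed.

Lemma comult0 : comult (0 : kSinf k) = 0.
Proof. exact: (raddf0 (lext _)). Qed.

Lemma ev2_comult f g x : ev2 f g (comult x) = ev (fun s => f s * g s) x.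
Proof.
have ev20 : ev2 f g 0 = 0.
  by have := ev2_lin f g (-1) 0 0; rewrite scaler0 addr0 mulN1r addNr.
elim/(@galg_ind k): x => [|c x y ex ey|s]; first by rewrite comult0 ev20 ev0.
  by rewrite comult_lin ev2_lin ex ey evP.
by rewrite comult_gelt ev2_tensor !ev_gelt.
Qed.

(** If the coproduct of [x] is in the sum of the two ideals of the tensor
    square, it is killed by [f (x) g]; the finitely many elements involved are
    all carried by one large interval, to which [f] and [g] first have to be
    extended. Conversely the two factors of each [s (x) s] are reduced modulo
    the ideals by interpolation, and the coefficients of the result are values
    of products [u i * v j] on [x]. *)
Lemma bowtieE (I J : set (kSinf k)) : is_ideal I -> is_ideal J ->
  T_prime I -> T_prime J -> bowtie I J = ideal_of (prods (perp I) (perp J)).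
Proof.
move=> Iid Jid IT JT.
have TI := perp_Tsystem Iid IT; have TJ := perp_Tsystem Jid JT.
have TP := prods_Tsystem TI TJ.
apply/seteqP; split=> x.
  rewrite /bowtie /preimage /mkset => -[t1 t1S [t2 t2S xE]].
  (* The forms [f] and [g] depend on the interval on which they are
     considered, hence a condition on all large intervals. *)
  pose A := [set t | exists N0, forall N f g, (N0 <= N)%N ->
    perp I (ival 0 N) f -> perp J (ival 0 N) g -> ev2 f g t = 0].
  have As : is_subspace A.
    split=> [|c t u [M tM] [N uN]].
      exists 0%N => N f g _ _ _.
      by have := ev2_lin f g (-1) 0 0; rewrite scaler0 addr0 mulN1r addNr.
    exists (maxn M N) => L f g; rewrite geq_max => /andP[ML NL] If Jg.
    by rewrite ev2_lin (tM L) // (uN L) // mulr0 addr0.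
  have At : A (t1 + t2).
    apply: subspaceD => //; [move: t1 t1S {xE}|move: t2 t2S {xE}];
      apply: span_ind => // _ [a aI [b bJ <-]].
      have [N N0 aN] := carried_ival a; exists N => L f g NL If Jg.
      rewrite ev2_tensor If ?mul0r //; last exact: aN.
      by apply: ival_neq0; apply: leq_trans NL.
    have [N N0 bN] := carried_ival b; exists N => L f g NL If Jg.
    rewrite ev2_tensor Jg ?mulr0 //; last exact: bN.
    by apply: ival_neq0; apply: leq_trans NL.
  rewrite xE in At => {xE}; case: At => N0 xN X h X0 Xx.
  have [M M0 XM] := fset_bounded X; pose N := maxn N0 M.
  have XN : {subset X <= ival 0 N} by apply: XM; rewrite leq_maxr.
  apply: (prods_min (A := [set h | ev h x = 0])).
  - split=> [|c f g /= f0 g0] /=; first exact: ev0f.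
    by rewrite ev_lin f0 g0 mulr0 addr0.
  - by move=> f g /= f0 fg; rewrite -(carried_eq Xx fg).
  move=> f g If Jg /=.
  have [f' If' ff'] := ts_extend TI If X0 XN (fun _ => id).
  have [g' Jg' gg'] := ts_extend TJ Jg X0 XN (fun _ => id).
  rewrite (carried_eq (g := fun s => f' s * g' s) Xx); last first.
    by move=> s sX; rewrite ff' // gg'.
  by rewrite -ev2_comult (xN N) // leq_maxl.
move=> xP; have [n n0 /(_ n (leqnn n)) nx] := carried_ival x.
have X0 := ival_neq0 0 n0; set X := ival 0 n in nx X0.
have split1 (K : set (kSinf k)) : is_ideal K -> T_prime K ->
    exists N (p : nat -> Sinf) (u : nat -> fn), (forall i, perp K X (u i)) /\
    forall s, Sym X s -> K (gelt k s - \sum_(i < N) u i s *: gelt k (p i)).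
  move=> Kid KT; have TK := perp_Tsystem Kid KT.
  have [N [p [u [pX Ku fE]]]] := interpolation_on (Sym_finite X) (ts_lin TK X).
  exists N, p, u; split=> // s sX; rewrite -[K]ideal_of_perp //.
  apply/(ideal_ofP TK X0) => [|f Kf].
    apply: carriedB; first exact: carried_gelt.
    by apply: carried_sum => i _; apply: carriedZ; apply: carried_gelt; apply: pX.
  rewrite evB ev_gelt ev_sum (fE _ Kf) // -sumrB big1 // => i _.
  by rewrite evZ ev_gelt mulrC subrr.
have [M [p [u [Iu uE]]]] := split1 I Iid IT.
have [N [q [v [Jv vE]]]] := split1 J Jid JT.
rewrite /bowtie /preimage /mkset.
set S := sum_subspace _ _.
have Ssub : is_subspace S by apply: sum_subspaceP; apply: tens_subspace.
pose w i j := tensor (gelt k (p i)) (gelt k (q j)).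
pose R x := comult x - \sum_(i < M) \sum_(j < N) ev (fun s => u i s * v j s) x *: w i j.
have RS : S (R x).
  have RE : R x = \sum_(s <- msupp x) x@_s *: R (gelt k s).
    rewrite /R; under [RHS]eq_bigr do rewrite scalerBr.
    rewrite sumrB; congr (_ - _).
      rewrite {1}(galgE x); elim: (enum_fset _) => [|s r IH].
        by rewrite !big_nil comult0.
      by rewrite !big_cons comult_lin IH.
    under [RHS]eq_bigr do rewrite scaler_sumr.
    rewrite [RHS]exchange_big; apply: eq_bigr => i _ /=.
    under [RHS]eq_bigr do rewrite scaler_sumr.
    rewrite [RHS]exchange_big; apply: eq_bigr => j _ /=.
    rewrite evE scaler_suml; apply: eq_bigr => s _.
    by rewrite ev_gelt scalerA.
  rewrite RE big_seq; elim/big_rec: _ => [|s y sx Sy]; first by case: Ssub.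
  case: Ssub => _; apply=> //; have sX := carried_mcoeff nx sx.
  rewrite /R comult_gelt; under eq_bigr do under eq_bigr do rewrite ev_gelt.
  exact: (@tensor_reduce k (kSinf k) (kSinf k) I J (gelt k s) (gelt k s) M N
    (fun i => u i s) (fun i => gelt k (p i)) (fun j => v j s)
    (fun j => gelt k (q j)) (uE s sX) (vE s sX)).
suff <- : R x = comult x by [].
rewrite /R big1 ?subr0 // => i _; rewrite big1 // => j _.
rewrite (xP X) ?scale0r //; exact: prods1.
Qed.

End Bowtie.

(** * The sum of ideals and induced representations *)

Section Dagger.
Context {k : fieldType}.
Local Notation fn := (Sinf -> k).
Implicit Types (f g : fn) (X Y P : {fset nat}).

Section Young.
Context {m n p : nat} (e : (m + n)%N = p).
Local Notation X := (ival 0 p).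
Local Notation P := (ival 0 m).
Local Notation Y := (ival m n).

Lemma ivalD : (X `\` P = Y)%fset.
Proof.
apply/fsetP => i; rewrite inE !in_ival /= !add0n -e.
by rewrite -leqNgt.
Qed.

Lemma ival_sub : {subset P <= X}.
Proof.
by move=> i; rewrite !in_ival /= !add0n => /leq_trans; apply; rewrite -e leq_addr.
Qed.

Lemma ival_disj : [disjoint P & Y]%fset.
Proof.
by apply/fdisjointP => i; rewrite !in_ival /= add0n negb_and -ltnNge => ->.
Qed.

Lemma maps_young (s : 'S_m) (t : 'S_n) : maps (ext_perm (young e s t)) P P.
Proof.
rewrite ext_young; apply: mapsM (SymP (Sym_ext s)) _.
exact: (Sym_disj_maps ival_disj (@Sym_shifted m n _ (Sym_ext t))).
Qed.

Lemma restr_young_l (s : 'S_m) (t : 'S_n) :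
  restr P (ext_perm (young e s t)) = ext_perm s.
Proof.
have tY := @Sym_shifted m n _ (Sym_ext t).
rewrite ext_young restrM; last exact: Sym_disj_maps ival_disj tY.
  by rewrite (restr_id (Sym_ext s)) (restr_disj ival_disj tY) mulg1.
exact/SymP/Sym_ext.
Qed.

Lemma restr_young_r (s : 'S_m) (t : 'S_n) :
  restr Y (ext_perm (young e s t)) = shifted m n (ext_perm t).
Proof.
have tY := @Sym_shifted m n _ (Sym_ext t).
have d : [disjoint Y & P]%fset by rewrite fdisjoint_sym ival_disj.
rewrite ext_young (restrM (Sym_disj_maps d (Sym_ext s)) (SymP tY)).
by rewrite (restr_id tY) (restr_disj d (Sym_ext s)) mul1g.
Qed.

Lemma block_young f g (z : Sinf) (s : 'S_m) (t : 'S_n) : Sym X z ->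
  block X P f g (z * ext_perm (young e s t))%g =
  stabb P z * (f (restr P z * ext_perm s)%g *
               g (restr Y z * shifted m n (ext_perm t))%g).
Proof.
move=> zX; rewrite block_mulr //; [|exact: Sym_ext|exact: maps_young].
by rewrite /block ivalD restr_young_l restr_young_r.
Qed.

Lemma young_of_maps (z : 'S_p) : maps (ext_perm z) P P ->
  exists s t, z = young e s t.
Proof.
move=> zP; have zX := Sym_ext z.
have zY : maps (ext_perm z) Y Y by rewrite -ivalD; apply: mapsC => //; apply: ival_sub.
have [s sE] := Sym_extP (restr_Sym zP).
have [t tE] := Sym_extP (Sym_conj (maps_shift m n) (restr_Sym zY)).
exists s, t; apply: (@ext_perm_inj p); rewrite ext_young sE tE /shifted.
rewrite [in LHS](restr_split zX zP) ivalD.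
by rewrite !mulgA !mulgVK.
Qed.

End Young.

(** Representatives of classes are chosen arbitrarily; a linear map killing [U]
    does not see the choice. *)
Lemma lquot_lift (V W : lmodType k) (U : set V) (F : V -> W) :
  (forall c v w, F (c *: v + w) = c *: F v + F w) ->
  (forall v, U v -> F v = 0) ->
  (forall v, F (lrepr (lpi U v)) = F v) /\ linear (fun a : lquot U => F (lrepr a)).
Proof.
move=> Fl FU.
have F0 : F 0 = 0.
  by have := Fl (-1) 0 0; rewrite scaler0 addr0 scaleN1r addNr.
have E v : F (lrepr (lpi U v)) = F v.
  have : Defs.span U (lrepr (lpi U v) - v) by apply/lpiP; rewrite lreprK.
  have Fs : is_subspace [set v | F v = 0].
    by split=> [//|c u w /= u0 w0]; rewrite Fl u0 w0 scaler0 addr0.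
  move=> /(span_ind Fs FU) /=; rewrite addrC -scaleN1r Fl scaleN1r => /eqP.
  by rewrite addrC subr_eq0 => /eqP.
split=> // c a b /=.
by rewrite -{1}[a]lreprK -{1}[b]lreprK -linearP E Fl.
Qed.


Lemma ev_eq0_fun (G : groupType) (h : G -> k) (x : galg k G) :
  (forall s, h s = 0) -> ev h x = 0.
Proof. by move=> h0; rewrite -[RHS](ev0f x); congr (ev _ x); apply/funext. Qed.

Lemma young1 m n p (e : (m + n)%N = p) : young e 1%g 1%g = 1%g.
Proof.
apply: (@ext_perm_inj p); have ext1 q : ext_perm (1%g : 'S_q) = 1%g.
  by apply/sinfP => i; rewrite /= ext_perm1.
by rewrite ext_young !ext1 /shifted mulg1 mulVg mulg1.
Qed.

Lemma quot_act_linear i (U : set (kS k i)) (s : 'S_i) :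
  (forall (s : 'S_i) x, U x -> U (gelt k s * x)) -> linear (quot_act (U := U) s).
Proof.
move=> Us; apply: (lquot_lift (F := fun x => lpi U (gelt k s * x)) _ _).2.
  by move=> c v w; rewrite -linearP mulrDr scalerAr.
by move=> v /(Us s) Uv; apply/lpi_eq0; apply: Defs.sub_span.
Qed.

Lemma box_bilinear m n (A : set (kS k m)) (B : set (kS k n)) (g : 'S_m * 'S_n) :
  (forall (s : 'S_m) x, A x -> A (gelt k s * x)) ->
  (forall (s : 'S_n) x, B x -> B (gelt k s * x)) ->
  bilinear2 (fun (a : lquot A) (b : lquot B) =>
    tensor (quot_act g.1 a) (quot_act g.2 b) : tens (lquot A) (lquot B)).
Proof.
move=> Al Bl; split=> [b c a a'|a c b b'].
  by rewrite quot_act_linear // tensorDl tensorZl.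
by rewrite quot_act_linear // tensorDr tensorZr.
Qed.

Section Functional.
Context {m n p : nat} (e : (m + n)%N = p).
Context (A : set (kS k m)) (B : set (kS k n)) (h : 'S_p -> k).
Hypothesis A_left : forall (s : 'S_m) x, A x -> A (gelt k s * x).
Hypothesis B_left : forall (s : 'S_n) x, B x -> B (gelt k s * x).

Let F (y : kS k p) (a : kS k m) (b : kS k n) : k :=
  ev (fun z => ev (fun s => ev (fun t => h (z * young e s t)%g) b) a) y.

Hypothesis FA : forall z a b, A a -> F (gelt k z) a b = 0.
Hypothesis FB : forall z a b, B b -> F (gelt k z) a b = 0.

Let Fa y b c a a' : F y (c *: a + a') b = c * F y a b + F y a' b.
Proof. by rewrite /F -ev_lin; congr (ev _ y); apply/funext => z; rewrite evP. Qed.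

Let Fb y a c b b' : F y a (c *: b + b') = c * F y a b + F y a b'.
Proof.
rewrite /F -ev_lin; congr (ev _ y); apply/funext => z; rewrite -ev_lin.
by congr (ev _ a); apply/funext => s; rewrite evP.
Qed.

Let Fy a b c y y' : F (c *: y + y') a b = c * F y a b + F y' a b.
Proof. exact: evP. Qed.

Let FA' y a b : A a -> F y a b = 0.
Proof.
by move=> Aa; apply: ev_eq0_fun => z; have := FA z b Aa; rewrite /F ev_gelt.
Qed.

Let FB' y a b : B b -> F y a b = 0.
Proof.
by move=> Bb; apply: ev_eq0_fun => z; have := FB z a Bb; rewrite /F ev_gelt.
Qed.

Let MA := lquot A.
Let MB := lquot B.

Let Fl y (a : MA) (b : MB) : k^o := F y (lrepr a) (lrepr b).

Let Fl_bil y : bilinear2 (Fl y).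
Proof.
split=> [b|a].
  exact: (lquot_lift (W := k^o) (F := fun a => F y a (lrepr b))
           (Fa y (lrepr b)) (fun a => @FA' y a (lrepr b))).2.
exact: (lquot_lift (W := k^o) (F := fun b => F y (lrepr a) b)
         (Fb y (lrepr a)) (fun b => @FB' y (lrepr a) b)).2.
Qed.

Let Fm y (t : tens MA MB) : k^o := tlift (Fl y) t.

Let Fm_tensor y a b : Fm y (tensor a b) = Fl y a b.
Proof. exact: (tlift_tensor (Fl_bil y)). Qed.

Let Fm_lin y : linear (Fm y).
Proof. exact: (tlift_linear (Fl_bil y)). Qed.

Let FlE y a b : Fl y (lpi A a) (lpi B b) = F y a b.
Proof.
rewrite /Fl (lquot_lift (W := k^o) (F := fun a => F y a (lrepr (lpi B b)))
           (Fa y _) (fun a => @FA' y a _)).1.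
exact: (lquot_lift (W := k^o) (F := fun b => F y a b)
         (Fb y a) (fun b => @FB' y a b)).1.
Qed.

Let Fm_bil : bilinear2 Fm.
Proof.
split=> [t|]; last exact: Fm_lin.
move=> c y y'; move: t; apply: tens_ind => [|a b]; last first.
  by rewrite !Fm_tensor /Fl Fy.
split=> [|d t u tE uE].
  have F0 z : Fm z 0 = 0.
    by have := Fm_lin z (-1) 0 0; rewrite scaler0 addr0 scaleN1r addNr.
  by rewrite /mkset !F0 scaler0 addr0.
rewrite /mkset in tE uE *; rewrite !Fm_lin tE uE !scalerDr !scalerA addrACA.
by rewrite [c * d]mulrC.
Qed.

Let FM (g : 'S_m * 'S_n) x a b :
  F (x * gelt k (young e g.1 g.2)) a b = F x (gelt k g.1 * a) (gelt k g.2 * b).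
Proof.
rewrite /F ev_mulr; congr (ev _ x); apply/funext => z; rewrite ev_mull.
congr (ev _ a); apply/funext => s; rewrite ev_mull.
by congr (ev _ b); apply/funext => t; rewrite youngM mulgA.
Qed.

Let Fm_box (g : 'S_m * 'S_n) x t :
  Fm (x * gelt k (young e g.1 g.2)) t =
  Fm x (box_act (quot_act (U := A)) (quot_act (U := B)) g t).
Proof.
have qbil := box_bilinear g A_left B_left.
move: t; apply: tens_ind => [|a b].
  split=> [|c t u tE uE]; rewrite /mkset.
    have F0 z : Fm z 0 = 0.
      by have := Fm_lin z (-1) 0 0; rewrite scaler0 addr0 scaleN1r addNr.
    have b0 : box_act (quot_act (U := A)) (quot_act (U := B)) g 0 = 0.
      by have := tlift_linear qbil (-1) 0 0; rewrite scaler0 addr0 scaleN1r addNr.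
    by rewrite b0 !F0.
  rewrite /mkset in tE uE *.
  by rewrite [box_act _ _ _ _](tlift_linear qbil) !Fm_lin tE uE.
rewrite [box_act _ _ _ _](tlift_tensor qbil) !Fm_tensor {1}/Fl FM.
exact: esym (FlE _ _ _).
Qed.

(** A function on the group whose associated form kills [A] and [B] in the two
    factors of the Young subgroup induces a linear form on the induced module.
    Its value on the class of [y], tensored with the generator, is the value of
    the function on [y]. *)
Lemma Ind_separate y :
  lpi (ind_rel (fun g : 'S_m * 'S_n => young e g.1 g.2)
        (box_act (quot_act (U := A)) (quot_act (U := B))))
    (tensor y (tensor (lpi A 1) (lpi B 1))) = 0 -> ev h y = 0.
Proof.
move/lpi_eq0; set R := ind_rel _ _ => yR.
pose Phi (w : tens (kS k p) (tens MA MB)) : k^o := tlift Fm w.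
have Phi_lin : linear Phi by exact: (tlift_linear Fm_bil).
have Phi_sub : is_subspace [set w | Phi w = 0].
  split=> [|c u v /= u0 v0] /=; last by rewrite Phi_lin u0 v0 scaler0 addr0.
  by have := Phi_lin (-1) 0 0; rewrite scaler0 addr0 scaleN1r addNr.
have : Phi (tensor y (tensor (lpi A 1) (lpi B 1))) = 0.
  apply: span_ind Phi_sub _ _ yR => _ [x [g [t ->]]] /=.
  have -> : Phi (tensor (x * gelt k (young e g.1 g.2)) t -
      tensor x (box_act (quot_act (U := A)) (quot_act (U := B)) g t)) =
      Fm (x * gelt k (young e g.1 g.2)) t -
      Fm x (box_act (quot_act (U := A)) (quot_act (U := B)) g t).
    rewrite addrC -scaleN1r Phi_lin /Phi !(tlift_tensor Fm_bil).
    by rewrite scaleN1r addrC.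
  rewrite (Fm_box g x t); exact: subrr.
rewrite /Phi (tlift_tensor Fm_bil) Fm_tensor FlE /F => <-.
congr (ev _ y); apply/funext => z; rewrite !ev_gelt.
by rewrite young1 mulg1.
Qed.

End Functional.

End Dagger.

Section DaggerLevel.
Context {k : fieldType}.
Local Notation fn := (Sinf -> k).
Implicit Types (f g : fn) (X Y P : {fset nat}) (U V : {fset nat} -> set fn).

Lemma level_left U n (s : 'S_n) x : Tsystem U ->
  level (ideal_of U) n x -> level (ideal_of U) n (gelt k s * x).
Proof.
move=> TU /(levelP _ TU) x0; apply/(levelP _ TU) => f Uf.
rewrite ev_incl ev_mull -[RHS](x0 _ (ts_left TU (Sym_ext s) Uf)) ev_incl.
by congr (ev _ x); apply/funext => t; rewrite ext_perm_morph.
Qed.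

Section OneBlock.
Context {U V : {fset nat} -> set fn} (TU : Tsystem U) (TV : Tsystem V).
Context {m n p : nat} (e : (m + n)%N = p).
Local Notation X := (ival 0 p).
Local Notation P := (ival 0 m).
Local Notation Y := (ival m n).
Local Notation A := (level (ideal_of U) m).
Local Notation B := (level (ideal_of V) n).
Local Notation rel := (ind_rel (fun g : 'S_m * 'S_n => young e g.1 g.2)
        (box_act (quot_act (U := A)) (quot_act (U := B)))).

(** If [z] does not preserve [P], nothing in the coset does and the block
    vanishes; if it does, the first entry of the block is translated by a
    member of Sym(P). *)
Lemma block_kill_l f g z (a : kS k m) (b : kS k n) : U P f -> Sym X z -> A a ->
  ev (fun s => ev (fun t => block X P f g (z * ext_perm (young e s t))%g) b) a = 0.
Proof.
move=> Uf zX /(levelP _ TU) a0.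
have [zP|nzP] := pselect (maps z P P); last first.
  apply: ev_eq0_fun => s; apply: ev_eq0_fun => t.
  by rewrite block_young // stabbF // mul0r.
have := a0 _ (ts_left TU (restr_Sym zP) Uf); rewrite ev_incl => a0'.
rewrite -(mul0r (ev (fun t => g (restr Y z * shifted m n (ext_perm t))%g) b)).
rewrite -a0' -ev_linr; congr (ev _ a); apply/funext => s.
rewrite mulrC -ev_linr; congr (ev _ b); apply/funext => t.
by rewrite block_young // stabbT // mul1r mulrC.
Qed.

Lemma block_kill_r f g z (a : kS k m) (b : kS k n) : V Y g -> Sym X z -> B b ->
  ev (fun s => ev (fun t => block X P f g (z * ext_perm (young e s t))%g) b) a = 0.
Proof.
move=> Vg zX /(levelP _ TV) b0; apply: ev_eq0_fun => s.
have [zP|nzP] := pselect (maps z P P); last first.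
  by apply: ev_eq0_fun => t; rewrite block_young // stabbF // mul0r.
have zY : maps z Y Y by rewrite -(ivalD e); apply: (mapsC (ival_sub e) zX zP).
have := b0 _ (ts_conjV TV (maps_shift m n) (ts_left TV (restr_Sym zY) Vg)).
rewrite ev_incl => b0'; rewrite -(mulr0 (f (restr P z * ext_perm s)%g)) -b0'.
rewrite mulrC -ev_linr; congr (ev _ b); apply/funext => t.
by rewrite block_young // stabbT // mul1r mulrC.
Qed.

(** Blocks are the matrix coefficients at the generator of the induced module:
    apply the annihilating element to a translate of the generator and pair
    with a block. *)
Lemma Ann_Ind_block x f g (s t : 'S_p) :
  Ann_Ind (fun g : 'S_m * 'S_n => young e g.1 g.2)
    (box_act (quot_act (U := A)) (quot_act (U := B))) x ->
  U P f -> V Y g ->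
  ev (fun z => block X P f g (ext_perm s * ext_perm z * ext_perm t)%g) x = 0.
Proof.
move=> Ax Uf Vg.
have := Ax (lpi rel (tensor (gelt k t) (tensor (lpi A 1) (lpi B 1)))).
rewrite ind_act_tensor.
move/(Ind_separate (h := fun z => block X P f g (ext_perm s * ext_perm z)%g)).
rewrite ev_mulr => <-.
- by congr (ev _ x); apply/funext => z; rewrite ext_perm_morph mulgA.
- by move=> r y; apply: level_left.
- by move=> r y; apply: level_left.
- move=> z a b Aa; rewrite ev_gelt -[RHS](@block_kill_l f g (ext_perm s * ext_perm z)%g a b) //.
    congr (ev _ a); apply/funext => r; congr (ev _ b); apply/funext => q.
    by rewrite ext_perm_morph mulgA.
  by apply: SymM; apply: Sym_ext.
- move=> z a b Bb; rewrite ev_gelt -[RHS](@block_kill_r f g (ext_perm s * ext_perm z)%g a b) //.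
    congr (ev _ a); apply/funext => r; congr (ev _ b); apply/funext => q.
    by rewrite ext_perm_morph mulgA.
  by apply: SymM; apply: Sym_ext.
Qed.

Lemma lpi_comb (W : lmodType k) (S : set W) (N : nat) (v : W) (c : nat -> k)
    (w : nat -> W) :
  S (v - \sum_(i < N) c i *: w i) -> lpi S v = \sum_(i < N) c i *: lpi S (w i).
Proof.
move=> Sv; have -> : \sum_(i < N) c i *: lpi S (w i) = lpi S (\sum_(i < N) c i *: w i).
  by rewrite linear_sum; apply: eq_bigr => i _; rewrite linearZ.
by apply/lpiP; apply: Defs.sub_span.
Qed.

(** As a vector space the induced module is the direct sum of copies of the
    inner tensor product, one for each coset of the Young subgroup. On each
    copy the two factors are expanded by [level_basis], and the coefficients so
    obtained are values of translated blocks. *)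
Lemma block_vanish_lpi (y : kS k p) :
  (forall (s : 'S_p) f g, U P f -> V Y g ->
     ev (fun z => block X P f g (ext_perm s * ext_perm z)%g) y = 0) ->
  lpi rel (tensor y (tensor (lpi A 1) (lpi B 1))) = 0.
Proof.
move=> y0.
have [M [q [u [Uu uE]]]] := level_basis m TU.
have [N [r [v [Vv vE]]]] := level_basis n TV.
have lA (s : 'S_m) x : A x -> A (gelt k s * x) by apply: level_left.
have lB (s : 'S_n) x : B x -> B (gelt k s * x) by apply: level_left.
pose v' j : fn := fun t => v j (shift m n * t * (shift m n)^-1)%g.
have Vv' j : V Y (v' j) := ts_conj TV (maps_shift m n) (Vv j).
pose blk i j (s z : 'S_p) := block X P (u i) (v' j) ((ext_perm s)^-1 * ext_perm z)%g.
pose eqv (z z' : 'S_p) := [exists g : 'S_m * 'S_n, z == z' * young e g.1 g.2]%g.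
(* A canonical representative of the left coset of [z] modulo the Young
   subgroup. *)
pose rep z := choose (eqv z) z.
have eqvP z z' : eqv z z' -> exists s t, z = (z' * young e s t)%g.
  by move=> /existsP[[s t] /= /eqP ->]; exists s, t.
have eqvI z' s t : eqv (z' * young e s t)%g z'.
  by apply/existsP; exists (s, t).
have eqvR z : eqv z z by rewrite -{1}[z]mulg1 -(young1 e).
have youngV s t : (young e s t)^-1%g = young e s^-1%g t^-1%g.
  by apply: (mulgI (young e s t)); rewrite mulgV -youngM !mulgV young1.
have eqvS z z' : eqv z z' -> eqv z' z.
  by move=> /eqvP[s [t ->]]; rewrite -{1}(mulgK (young e s t) z') youngV.
have eqvT z z' z'' : eqv z z' -> eqv z' z'' -> eqv z z''.
  by move=> /eqvP[s [t ->]] /eqvP[s' [t' ->]]; rewrite -mulgA -youngM.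
have repP z : eqv z (rep z) by exact: chooseP.
have rep_eqv z z' : eqv z z' -> rep z = rep z'.
  move=> zz'; rewrite /rep (@eq_choose _ (eqv z) (eqv z')).
    by apply: choose_id => //; apply: eqvS.
  by move=> w; apply/idP/idP; [apply: eqvT; apply: eqvS|apply: eqvT].
pose H s i j := lpi rel (tensor (gelt k s) (tensor (lpi A (gelt k (q i))) (lpi B (gelt k (r j))))).
pose G y := lpi rel (tensor y (tensor (lpi A 1) (lpi B 1))).
have Gl c y1 y2 : G (c *: y1 + y2) = c *: G y1 + G y2.
  by rewrite /G tensorDl tensorZl linearP.
have G0 : G 0 = 0 by rewrite /G tensor0l raddf0.
(* Only the coset of [z] contributes, blocks being zero off the subgroup. *)
have Gz z : G (gelt k z) = \sum_(s | rep s == s) \sum_(i < M) \sum_(j < N)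
    blk i j s z *: H s i j.
  have [s [t zE]] := eqvP _ _ (repP z); set d := rep z in zE.
  have dd : rep d == d by rewrite -(rep_eqv z d) // repP.
  rewrite (bigD1 d) //= [X in _ + X]big1 ?addr0 => [|d' /andP[/eqP d'd' d'd]].
    have blkE i j : blk i j d z = u i (ext_perm s) * v j (ext_perm t).
      rewrite /blk zE ext_perm_morph mulKg -[ext_perm (young e s t)]mul1g.
      rewrite block_young // stabbT // !restr1 !mul1g /v' /shifted.
      by rewrite mul1r !mulgA mulgV mul1g mulgK.
    have -> : G (gelt k z) =
        lpi rel (tensor (gelt k d) (tensor (lpi A (gelt k s)) (lpi B (gelt k t)))).
      have -> : tensor (lpi A (gelt k s)) (lpi B (gelt k t)) =
          box_act (quot_act (U := A)) (quot_act (U := B)) (s, t)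
            (tensor (lpi A 1) (lpi B 1)).
        rewrite /box_act (tlift_tensor (box_bilinear (s, t) lA lB)) /=.
        by rewrite !quot_act_lpi // !mulr1.
      apply/lpiP; apply: Defs.sub_span; exists (gelt k d), (s, t), (tensor (lpi A 1) (lpi B 1)).
      by rewrite -geltM -zE.
    have ls : lpi A (gelt k s) = \sum_(i < M) u i (ext_perm s) *: lpi A (gelt k (q i)).
      exact: (@lpi_comb (kS k m) A M _ (fun i => u i (ext_perm s)) (fun i => gelt k (q i)) (uE s)).
    have lt : lpi B (gelt k t) = \sum_(j < N) v j (ext_perm t) *: lpi B (gelt k (r j)).
      exact: (@lpi_comb (kS k n) B N _ (fun j => v j (ext_perm t)) (fun j => gelt k (r j)) (vE t)).
    rewrite ls lt tensor_suml tensor_sumr linear_sum.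
    apply: eq_bigr => i _ /=; rewrite tensor_sumr tensor_sumr linear_sum.
    apply: eq_bigr => j _ /=.
    by rewrite blkE tensorZl tensorZr tensorZr tensorZr !linearZ /= scalerA.
  rewrite big1 // => i _; rewrite big1 // => j _; rewrite /blk /block stabbF ?mul0r ?scale0r //.
  rewrite -ext_permV -ext_perm_morph => /(young_of_maps e)[s' [t' st']].
  have : eqv z d' by rewrite -(mulKVg d' z) st'.
  by move/rep_eqv; rewrite d'd' => dE; rewrite -/d -dE /d eqxx in d'd.
have GE w : G w = \sum_(s | rep s == s) \sum_(i < M) \sum_(j < N)
    ev (blk i j s) w *: H s i j.
  elim/(@galg_ind k): w => [|c w w' wE wE'|z].
  - rewrite G0 big1 // => s _; rewrite big1 // => i _; rewrite big1 // => j _.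
    by rewrite ev0 scale0r.
  - rewrite Gl wE wE' scaler_sumr -big_split; apply: eq_bigr => s _ /=.
    rewrite scaler_sumr -big_split; apply: eq_bigr => i _ /=.
    rewrite scaler_sumr -big_split; apply: eq_bigr => j _ /=.
    by rewrite evP scalerDl scalerA.
  rewrite Gz; apply: eq_bigr => s _; apply: eq_bigr => i _.
  by apply: eq_bigr => j _; rewrite ev_gelt.
rewrite -/(G y) GE big1 // => s _; rewrite big1 // => i _; rewrite big1 // => j _.
rewrite [ev _ _](_ : _ = 0) ?scale0r //.
rewrite -(y0 s^-1%g (u i) (v' j) (Uu i) (Vv' j)); congr (ev _ y).
by apply/funext => z; rewrite /blk ext_permV.
Qed.

(** The translates of the generator span the induced module. *)
Lemma block_Ann_Ind x :
  (forall (s t : 'S_p) f g, U P f -> V Y g ->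
     ev (fun z => block X P f g (ext_perm s * ext_perm z * ext_perm t)%g) x = 0) ->
  Ann_Ind (fun g : 'S_m * 'S_n => young e g.1 g.2)
    (box_act (quot_act (U := A)) (quot_act (U := B))) x.
Proof.
move=> x0 w; rewrite /ind_act; move: (lrepr w) => t {w}.
have lA (s : 'S_m) a : A a -> A (gelt k s * a) by apply: level_left.
have lB (s : 'S_n) b : B b -> B (gelt k s * b) by apply: level_left.
pose b2 (y : kS k p) (c : tens (lquot A) (lquot B)) := tensor (x * y) c.
have bil : bilinear2 b2.
  split=> [c d y y'|y d c c']; rewrite /b2; last by rewrite tensorDr tensorZr.
  by rewrite mulrDr -scalerAr tensorDl tensorZl.
move: t; apply: tens_ind.
  split=> [|c t u tE uE]; rewrite /mkset.
    have L0 : tlift b2 0 = 0.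
      by have := tlift_linear bil (-1) 0 0; rewrite scaler0 addr0 scaleN1r addNr.
    by rewrite -/b2 L0 raddf0.
  rewrite /mkset -/b2 in tE uE *.
  by rewrite (tlift_linear bil) linearP /= tE uE scaler0 addr0.
move=> y c; rewrite /mkset -/b2 (tlift_tensor bil) /b2 {bil b2}.
pose Q y c := lpi rel (tensor (x * y) c) = 0.
rewrite -/(Q y c).
have Ql y' : is_subspace [set c | Q y' c].
  split=> [|d a b]; rewrite /mkset /Q; first by rewrite tensor0r raddf0.
  by move=> a0 b0; rewrite tensorDr tensorZr linearP /= a0 b0 scaler0 addr0.
elim/(@galg_ind k): y => [|d y y' Qy Qy'|t]; rewrite /Q.
- by rewrite mulr0 tensor0l raddf0.
- by rewrite mulrDr -scalerAr tensorDl tensorZl linearP /= Qy Qy' scaler0 addr0.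
rewrite -/(Q _ _); move: c; apply: tens_ind; first exact: Ql.
move=> a b; rewrite -[a]lreprK -[b]lreprK; move: (lrepr a) (lrepr b) => {}a {}b.
have [Q0 QP] := Ql (gelt k t).
rewrite /mkset; elim/(@galg_ind k): a => [|d a a' Qa Qa'|s1].
- by rewrite raddf0 tensor0l.
- by rewrite linearP tensorDl tensorZl; apply: QP.
elim/(@galg_ind k): b => [|d b b' Qb Qb'|s2].
- by rewrite raddf0 tensor0r.
- by rewrite linearP tensorDr tensorZr; apply: QP.
rewrite /Q; set t' := (t * young e s1 s2)%g.
rewrite -(@block_vanish_lpi (x * gelt k t')) => [|s f g Uf Vg]; last first.
  rewrite ev_mulr -[RHS](x0 s t' f g) //; congr (ev _ x).
  by apply/funext => z; rewrite ext_perm_morph mulgA.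
apply/esym/lpiP; apply: Defs.sub_span.
exists (x * gelt k t), (s1, s2), (tensor (lpi A 1) (lpi B 1)).
rewrite -mulrA -geltM -/t' /box_act (tlift_tensor (box_bilinear (s1, s2) lA lB)) /=.
have qA : quot_act s1 (lpi A 1) = lpi A (gelt k s1) by rewrite quot_act_lpi ?mulr1.
have qB : quot_act s2 (lpi B 1) = lpi B (gelt k s2) by rewrite quot_act_lpi ?mulr1.
by rewrite qA qB.
Qed.

End OneBlock.

(** Blocks on initial intervals suffice, since a permutation of the interval
    carries any subset to an initial one. *)
Lemma sums_standard U V n (x : kSinf k) : Tsystem U -> Tsystem V ->
  (forall i s t f g, (i <= n)%N -> Sym (ival 0 n) s -> Sym (ival 0 n) t ->
     U (ival 0 i) f -> V (ival i (n - i)) g ->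
     ev (fun z => block (ival 0 n) (ival 0 i) f g (s * z * t)%g) x = 0) ->
  carried (Sym (ival 0 n)) x ->
  forall h, sums U V (ival 0 n) h -> ev h x = 0.
Proof.
move=> TU TV x0 nx h Uh; set X := ival 0 n in nx x0 Uh.
suff : (forall s t, Sym X s -> Sym X t -> ev (fun z => h (s * z * t)%g) x = 0).
  move=> /(_ 1%g 1%g (@Sym1 _) (@Sym1 _)) <-; congr (ev _ x).
  by apply/funext => z; rewrite mul1g mulg1.
move: h Uh; apply: (sums_min (A := [set h | forall s t, Sym X s -> Sym X t ->
  ev (fun z => h (s * z * t)%g) x = 0])).
  split=> [|f g f0 fg s t sX tX|r f rX f0 s t sX tX|r f rX f0 s t sX tX].
  - split=> [s t _ _|c f g f0 g0 s t sX tX]; first exact: ev0f.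
    by rewrite ev_lin f0 // g0 // mulr0 addr0.
  - rewrite -[RHS](f0 s t sX tX); apply/esym/(carried_eq nx) => z zX.
    by apply: fg; apply: SymM tX; apply: SymM zX.
  - rewrite -[RHS](f0 (r * s)%g t (SymM rX sX) tX); congr (ev _ x).
    by apply/funext => z; rewrite !mulgA.
  - rewrite -[RHS](f0 s (t * r)%g sX (SymM tX rX)); congr (ev _ x).
    by apply/funext => z; rewrite !mulgA.
move=> P f g PX Uf Vg s t sX tX.
have Pn : (#|` P| <= n)%N.
  by rewrite -(card_ival 0 n); apply/fsubset_leq_card/fsubsetP.
have iX : {subset ival 0 #|` P| <= X}.
  by move=> i; rewrite !in_ival /= !add0n => /leq_trans; apply.
have [r rX rP] : exists2 r, Sym X r & maps r P (ival 0 #|` P|).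
  by apply: sym_transitive => //; rewrite card_ival.
have eP : img r P = ival 0 #|` P|.
  by apply/fsetP => i; rewrite -(sinfKV r i) maps_img rP.
have Uf' := ts_conj TU rP Uf.
have := ts_conj TV (mapsD (SymP rX) rP) Vg; rewrite (ivalD (subnKC Pn)) => Vg'.
rewrite -(x0 _ (r^-1 * s)%g (t * r)%g _ _ Pn _ _ Uf' Vg'); last 2 first.
- by apply: SymM => //; apply: SymV.
- exact: SymM.
apply: (carried_eq nx) => z zX.
have -> : (s * z * t = r * (r^-1 * s * z * (t * r)) * r^-1)%g.
  by rewrite !mulgA mulgV mul1g mulgK.
rewrite (block_conj _ _ _ (SymP rX)) ?eP //.
by apply: SymM; [apply: SymM => //; apply: SymM => //; apply: SymV|apply: SymM].
Qed.

(** An element annihilates the induced representations exactly when it is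
    killed by the translates of blocks. *)
Lemma dagger_levelE (I J : set (kSinf k)) n : is_ideal I -> is_ideal J ->
  T_prime I -> T_prime J -> (0 < n)%N ->
  level (ideal_of (sums (perp I) (perp J))) n = dagger_level I J n.
Proof.
move=> Iid Jid IT JT n0.
have TI := perp_Tsystem Iid IT; have TJ := perp_Tsystem Jid JT.
have TS := sums_Tsystem TI TJ.
apply/seteqP; split=> x.
  move=> /(levelP _ TS) x0 i le_i_n.
  rewrite -(ideal_of_perp Iid) -(ideal_of_perp Jid).
  refine (block_Ann_Ind TI TJ _) => s t f g Uf Vg.
  have e := subnKC le_i_n.
  have Vg' : perp J (ival 0 n `\` ival 0 i)%fset g by rewrite (ivalD e).
  have := Sums_right (Sym_ext t) (Sums_left (Sym_ext s)
    (Sums_block (ival_sub e) Uf Vg')) => /x0.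
  rewrite ev_incl => <-; congr (ev _ x); apply/funext => z.
move=> xA; apply/(levelP _ TS); apply: sums_standard => //; last first.
  exact: carried_incl.
move=> i s t f g le_i_n /Sym_extP[s' <-] /Sym_extP[t' <-] Uf Vg; rewrite ev_incl.
have := xA i le_i_n.
rewrite -(ideal_of_perp Iid) -(ideal_of_perp Jid) => xA'.
exact: (Ann_Ind_block TI TJ s' t' xA' Uf Vg).
Qed.

End DaggerLevel.

(** * Exponential growth *)

(** For [m > C ^ 2], [(2 m)!] is at least [m ^ m], hence exceeds [C ^ (2 m)]. *)
Lemma exp_lt_fact C : exists2 n, (0 < n)%N & (C ^ n < n`!)%N.
Proof.
have H m j : (m ^ j <= (m + j)`!)%N.
  elim: j => [|j IH]; first by rewrite expn0 fact_gt0.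
  by rewrite expnS addnS factS leq_mul // leqW // leq_addr.
pose m := (C ^ 2).+1; exists (m + m)%N => //.
apply: leq_trans (H m m); rewrite addnn -mul2n expnM ltn_exp2r //.
Qed.

Section LexicographicMinimum.
Implicit Types (s t r : Sinf).

(** Lexicographic order on permutations, seen as sequences of values. *)
Definition lexlt s t := exists p, (s p < t p)%N /\ forall q, (q < p)%N -> s q = t q.

Lemma lexlt_trans s t r : lexlt s t -> lexlt t r -> lexlt s r.
Proof.
move=> [p [stp sq]] [p' [trp tq]]; case: (ltngtP p p') => pp'.
- by exists p; rewrite -tq //; split=> // q qp; rewrite sq // tq // (ltn_trans qp).
- by exists p'; rewrite sq //; split=> // q qp; rewrite sq ?tq // (ltn_trans qp).
- exists p; split=> [|q qp]; first by rewrite (ltn_trans stp) // pp'.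
  by rewrite sq // tq // -pp'.
Qed.

Lemma lexlt_irr s : ~ lexlt s s.
Proof. by move=> [p []]; rewrite ltnn. Qed.

Lemma lexlt_total s t : [\/ s = t, lexlt s t | lexlt t s].
Proof.
have [st|/existsNP[i /eqP sti]] := pselect (forall i, s i = t i).
  by constructor 1; apply/sinfP.
have ex : exists i, s i != t i by exists i.
case: (ex_minnP ex) => p stp pmin.
have eq q : (q < p)%N -> s q = t q.
  by move=> qp; apply/eqP; apply: contraTT qp => /pmin; rewrite -leqNgt.
case: (ltngtP (s p) (t p)) => h; last by rewrite h eqxx in stp.
  by constructor 2; exists p.
by constructor 3; exists p; split=> // q /eq.
Qed.

Lemma lex_min (L : seq Sinf) : L != [::] ->
  exists2 s, s \in L & forall t, t \in L -> ~ lexlt t s.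
Proof.
elim: L => // a L IH _; have [->|/IH[m mL mmin]] := eqVneq L [::].
  exists a => [|t]; rewrite ?mem_head // in_cons in_nil orbF => /eqP ->.
  exact: lexlt_irr.
have [am|am|ma] := lexlt_total a m.
- exists m; first by rewrite in_cons mL orbT.
  move=> t; rewrite in_cons => /orP[/eqP->|/mmin//]; rewrite am; exact: lexlt_irr.
- exists a; first exact: mem_head.
  move=> t; rewrite in_cons => /orP[/eqP->|tL ta]; first exact: lexlt_irr.
  exact: mmin _ tL (lexlt_trans ta am).
- exists m; first by rewrite in_cons mL orbT.
  move=> t; rewrite in_cons => /orP[/eqP-> am|/mmin//].
  exact: lexlt_irr (lexlt_trans am ma).
Qed.

End LexicographicMinimum.

(** The positions with no larger value before them form one increasing class,
    and a decreasing subsequence of the rest can be prolonged by one of them. *)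
Lemma decreasing_or_coloured m (X : {fset nat}) (w : Sinf) :
  (exists c : nat -> nat, (forall p, p \in X -> (c p < m)%N) /\
     forall p q, p \in X -> q \in X -> (p < q)%N -> c p = c q -> (w p < w q)%N) \/
  (exists l : seq nat, [/\ size l = m.+1, sorted ltn l, {subset l <= X} &
     sorted gtn [seq w p | p <- l]]).
Proof.
elim: m X => [|m IH] X.
  have [->|/fset0Pn[i iX]] := eqVneq X fset0; first by left; exists id.
  by right; exists [:: i]; split=> // j; rewrite inE => /eqP ->.
(* The positions of the left-to-right maxima. *)
pose M := [fset p in X | ~~ has (fun q => (q < p) && (w p < w q))%N X]%fset.
have [[c [cm cw]]|[l [sl sol lX swl]]] := IH (X `\` M)%fset.
  left; exists (fun p => if p \in M then m else c p); split=> [p pX|p q pX qX pq].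
    by case: ifPn => // pM; rewrite ltnW // ltnS cm // inE pM.
  case: ifPn => pM; case: ifPn => qM.
  - move=> _; move: qM; rewrite inE /= => /andP[_ /hasPn/(_ p pX)].
    rewrite pq /= -leqNgt leq_eqVlt => /orP[/eqP/(@sinf_inj w) e|//].
    by rewrite e ltnn in pq.
  - by move=> mc; have := cm q; rewrite inE qM -mc ltnn => /(_ qX).
  - by move=> mc; have := cm p; rewrite inE pM mc ltnn => /(_ pX).
  by apply: cw; rewrite // inE ?pM ?qM.
right; case: l sl sol lX swl => // p l sl sol lX swl.
have := lX p; rewrite !inE eqxx => /(_ isT) /andP[+ pX].
rewrite pX /= negbK => /hasP[q qX /andP[qp wpq]].
exists (q :: p :: l); split=> /=; first by rewrite -sl.
- by rewrite qp.
- by move=> i; rewrite inE => /orP[/eqP->//|/lX]; rewrite inE => /andP[].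
- by rewrite wpq.
Qed.

Section Growth.
Context {k : fieldType}.
Local Notation fn := (Sinf -> k).
Local Notation sys := ({fset nat} -> set fn).
Implicit Types (f g : fn) (X Y P : {fset nat}) (s t w : Sinf) (U V : sys).

Definition spanned X N (u : nat -> fn) f : Prop :=
  exists c : nat -> k, forall s, Sym X s -> f s = \sum_(i < N) c i * u i s.

(** The dimension of the restrictions of [U X] to Sym(X) is at most [C ^ |X|];
    the spanning functions need not belong to [U X]. *)
Definition exp_bounded U C : Prop := forall X, exists u : nat -> fn,
  forall f, U X f -> spanned X (C ^ #|` X|) u f.

Lemma spanned_le X M N u f : (M <= N)%N -> spanned X M u f -> spanned X N u f.
Proof.
move=> MN [c cE]; exists (fun i => if (i < M)%N then c i else 0) => s sX.
rewrite cE // (big_ord_widen N (fun i => c i * u i s)) // big_mkcond /=.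
by apply: eq_bigr => i _; case: ifP; rewrite ?mul0r.
Qed.

Lemma spanned_fin X (K : finType) (u : K -> fn) : exists u' : nat -> fn,
  forall f (c : K -> k), (forall s, Sym X s -> f s = \sum_j c j * u j s) ->
  spanned X #|K| u' f.
Proof.
exists (fun i => if insub i : option 'I_#|K| is Some j then u (enum_val j)
                 else fun=> 0) => f c fE.
exists (fun i => if insub i : option 'I_#|K| is Some j then c (enum_val j)
                 else 0) => s sX.
rewrite fE // (reindex (@enum_val K K)) /=; last first.
  by apply: onW_bij; apply: enum_val_bij.
by apply: eq_bigr => i _; rewrite valK.
Qed.

(** A colouring of the positions and one of the values. *)
Definition colouring m X := ({ffun X -> 'I_m.+1} * {ffun X -> 'I_m.+1})%type.

Definition compatible m X w (cd : colouring m X) : Prop :=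
  (forall p q : X, (val p < val q)%N -> cd.1 p = cd.1 q ->
     (w (val p) < w (val q))%N) /\
  (forall p q : X, w (val p) = val q -> cd.2 q = cd.1 p).

(** A permutation that is increasing on each colour class and matches the
    colours of positions and values is determined by the colours: at the first
    place where two of them differ, the smaller value is taken by the other one
    at a later position of the same colour, where it should be larger. *)
Lemma compatible_inj m X w w' (cd : colouring m X) : Sym X w -> Sym X w' ->
  compatible w cd -> compatible w' cd -> w = w'.
Proof.
move=> wX w'X.
have half v v' p : Sym X v -> Sym X v' -> compatible v cd -> compatible v' cd ->
    (forall q, (q < p)%N -> v q = v' q) -> ~ (v p < v' p)%N.
  move=> vX v'X [vi vd] [v'i v'd] vv' lt.
  have pX : p \in X.
    by apply: contraT => pX; move: lt; rewrite vX // v'X // ltnn.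
  have vpX : v p \in X by rewrite (SymP vX).
  have qX : v'^-1%g (v p) \in X by rewrite (SymP (SymV v'X)).
  set q := v'^-1%g (v p) in qX.
  have v'q : v' q = v p by rewrite /q sinfKV.
  have cpq : cd.1 [` pX]%fset = cd.1 [` qX]%fset.
    by rewrite -(vd [` pX] [` vpX])%fset // -(v'd [` qX] [` vpX])%fset.
  case: (ltngtP q p) => qp.
  - have := vv' q qp; rewrite v'q => /(@sinf_inj v) e.
    by rewrite e ltnn in qp.
  - have := v'i [` pX]%fset [` qX]%fset qp cpq; rewrite /= v'q => lt'.
    by have := ltn_trans lt lt'; rewrite ltnn.
  - by rewrite -v'q qp ltnn in lt.
move=> wc w'c; have [//|ww'|w'w] := lexlt_total w w'.
- by case: ww' => p [lt eq]; case: (half w w' p).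
- by case: w'w => p [lt eq]; case: (half w' w p).
Qed.

Lemma coloured_list m X : exists2 L : seq Sinf,
  (size L <= (m.+1 * m.+1) ^ #|` X|)%N &
  forall w, Sym X w ->
    (exists c : nat -> nat, (forall p, p \in X -> (c p < m)%N) /\
     forall p q, p \in X -> q \in X -> (p < q)%N -> c p = c q -> (w p < w q)%N) ->
    w \in L.
Proof.
pose pickw (cd : colouring m X) : Sinf :=
  if pselect (exists w, Sym X w /\ compatible w cd) is left h
  then sval (cid h) else 1%g.
exists [seq pickw cd | cd <- enum {: colouring m X}].
  by rewrite size_map -cardE card_prod !card_ffun card_ord cardfE expnMn.
move=> w wX [c [cm cw]].
pose cd : colouring m X := ([ffun p : X => inord (c (val p))],
  [ffun q : X => inord (c (w^-1%g (val q)))]).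
have cdw : compatible w cd.
  split=> p q /=; rewrite !ffunE => pq.
    move/(congr1 val); rewrite /= !inordK => [cpq||]; last 2 first.
    - by rewrite ltnW // ltnS cm // fsvalP.
    - by rewrite ltnW // ltnS cm // fsvalP.
    exact: cw (fsvalP _) (fsvalP _) pq cpq.
  by rewrite -pq sinfK.
have -> : w = pickw cd.
  rewrite /pickw; case: pselect => [h|[]]; last by exists w.
  by case: (cid h) => w' /= [w'X w'c]; apply: compatible_inj cdw w'c.
by apply: map_f; rewrite mem_enum.
Qed.

(** Regev's argument. Multiplying an element of [I] by group elements permutes
    the values of [w] along a decreasing subsequence; every nontrivial
    rearrangement is lexicographically smaller, so a function killing [I] is
    determined by its values on permutations without long decreasing
    subsequences. *)
Lemma perp_determined (I : set (kSinf k)) m x X f : is_ideal I -> I x ->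
  carried (Sym (ival 0 m.+1)) x -> x@_1%g != 0 -> perp I X f ->
  (forall w, Sym X w ->
    (exists c : nat -> nat, (forall p, p \in X -> (c p < m)%N) /\
     forall p q, p \in X -> q \in X -> (p < q)%N -> c p = c q -> (w p < w q)%N) ->
    f w = 0) ->
  forall w, Sym X w -> f w = 0.
Proof.
move=> [_ _ IM] Ix xm x1 If f0 w0 w0X; apply: contrapT => /eqP fw0.
have [L XL] := Sym_finite X.
pose bad := [seq w <- L | `[< Sym X w /\ f w != 0 >]].
have badP w : w \in bad <-> Sym X w /\ f w != 0.
  rewrite mem_filter; split=> [/andP[/asboolP//]|wb].
  by apply/andP; split; [apply/asboolP|apply: XL; case: wb].
have w0b : w0 \in bad by apply/badP.
have [|w /badP[wX fw] wmin] := @lex_min bad.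
  by apply/eqP => b0; rewrite b0 in w0b.
have [good|[l [sl sol lX swl]]] := decreasing_or_coloured m X w.
  by rewrite f0 ?eqxx in fw.
have ul : uniq l := sorted_uniq ltn_trans ltnn sol.
pose Z := (X `|` ival 0 m.+1)%fset.
have sz : size l = size (iota 0 m.+1) by rewrite size_iota.
have sub1 : {subset l <= Z} by move=> i /lX iX; rewrite in_fsetU iX.
have sub2 : {subset iota 0 m.+1 <= Z}.
  by move=> i; rewrite mem_iota in_fsetU in_ival => ->; rewrite orbT.
have [r _ rE] := sym_ext_seq ul (iota_uniq _ _) sz sub1 sub2.
have rl i : (i < m.+1)%N -> r (nth 0%N l i) = i.
  by move=> im; rewrite rE ?sl // nth_iota // add0n.
have rV i : (i < m.+1)%N -> r^-1%g i = nth 0%N l i.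
  by move=> im; rewrite -{1}(rl i im) sinfK.
have rout q : q \notin l -> (m.+1 <= r q)%N.
  move=> ql; rewrite leqNgt; apply: contra ql => rq.
  by rewrite -(sinfK r q) rV // mem_nth // sl.
have cX s : Sym (ival 0 m.+1) s -> Sym X (r * s * r^-1)%g.
  move=> sm q qX; have ql : q \notin l by apply: contra qX => /lX.
  rewrite !sinfM sm ?sinfK //.
  by rewrite in_ival /= add0n -leqNgt rout.
(* The first position moved receives a value from further along the
   decreasing subsequence, hence a smaller one. *)
have small s : Sym (ival 0 m.+1) s -> s != 1%g -> f (r * s * r^-1 * w)%g = 0.
  move=> sm s1; apply: contrapT => /eqP fs.
  have inb : (r * s * r^-1 * w)%g \in bad.
    by apply/badP; split=> //; apply: SymM => //; apply: cX.
  apply: (wmin _ inb).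
  have ex : exists i, s i != i.
    apply: contrapT => /forallNP h; move/eqP: s1; apply; apply/sinfP => i.
    by apply/eqP; apply: contraT => /h.
  case: (ex_minnP ex) => i si imin.
  have fixed j : (j < i)%N -> s j = j.
    by move=> ji; apply/eqP; apply: contraTT ji => /imin; rewrite -leqNgt.
  have im : (i < m.+1)%N.
    by rewrite ltnNge; apply: contra si => mi; rewrite sm // in_ival /= add0n -leqNgt.
  have sim : (s i < m.+1)%N by have := SymP sm i; rewrite !in_ival /= add0n im.
  have isi : (i < s i)%N.
    case: (ltngtP i (s i)) => // [h|e]; last by rewrite -e eqxx in si.
    by have /(@sinf_inj s) e := fixed _ h; rewrite e eqxx in si.
  exists (nth 0%N l i); split.
    rewrite !sinfM rl // rV //.
    have := sorted_ltn_nth (rev_trans ltn_trans) 0%N swl i (s i).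
    rewrite !inE !size_map !sl => /(_ im sim isi).
    by rewrite !(nth_map 0%N) ?sl.
  move=> q qi; rewrite !sinfM; case: (boolP (q \in l)) => ql; last first.
    by rewrite sm ?sinfK // in_ival /= add0n -leqNgt rout.
  have [j jm qE] : exists2 j, (j < m.+1)%N & q = nth 0%N l j.
    by exists (index q l); [rewrite -sl index_mem|rewrite nth_index].
  subst q.
  have ji : (j < i)%N.
    rewrite ltnNge; apply/negP; rewrite leq_eqVlt => /orP[/eqP e|ij].
      by rewrite e ltnn in qi.
    have := sorted_ltn_nth ltn_trans 0%N sol i j; rewrite !inE sl => /(_ im jm ij).
    by move/(ltn_trans qi); rewrite ltnn.
  by rewrite rl // fixed // rV.
have X0 : X != fset0.
  apply/fset0Pn; exists (nth 0%N l 0); apply: lX; apply: mem_nth; by rewrite sl.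
have : ev f (gelt k r * x * gelt k r^-1%g * gelt k w) = 0.
  apply: If => //.
    have [h1 _] := IM (gelt k r) _ Ix.
    have [_ h2] := IM (gelt k r^-1%g) _ h1.
    by have [_] := IM (gelt k w) _ h2.
  move=> g g0; rewrite ev_mulr ev_mulr ev_mull; apply: xm => s sm.
  by apply: g0; apply: SymM => //; apply: cX.
rewrite ev_mulr ev_mulr ev_mull.
rewrite (carried_eq (g := fun s => (s == 1%g)%:R * f w) xm).
  by rewrite ev_linr mcoeff_ev => /eqP; rewrite mulf_eq0 (negbTE x1) (negbTE fw).
move=> s sm; case: eqP => [->|/eqP s1]; last by rewrite small // mul0r.
by rewrite mulg1 mulgV mul1g mul1r.
Qed.

(** A nonzero element may be translated to have a nonzero coefficient at the
    identity. Interpolation on the list of coloured permutations then bounds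
    the dimension by their number. *)
Lemma perp_exp_bounded (I : set (kSinf k)) : is_ideal I -> I <> [set 0] ->
  exists2 C, (0 < C)%N & exp_bounded (perp I) C.
Proof.
move=> Iid In0; have [I0 _ IM] := Iid.
have [x [Ix x0]] : exists x, I x /\ x <> 0.
  apply: contrapT => h; apply: In0; apply/seteqP; split=> x; last by move=> ->.
  by move=> Ix; apply: contrapT => x0; apply: h; exists x.
have [s xs] : exists s, x@_s != 0.
  apply: contrapT => h; apply: x0; apply/malgP => s; rewrite mcoeff0.
  by apply/eqP; apply: contraT => xs; case: h; exists s.
have [[|m] // m0 /(_ _ (leqnn _)) xm] := carried_ival x.
have sm : Sym (ival 0 m.+1) s by apply: carried_mcoeff xm _; rewrite -mcoeff_neq0.
pose y := x * gelt k s^-1%g.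
have Iy : I y by have [] := IM (gelt k s^-1%g) _ Ix.
have ym : carried (Sym (ival 0 m.+1)) y.
  move=> g g0; rewrite ev_mulr; apply: xm => t tm; apply: g0.
  by apply: SymM => //; apply: SymV.
have y1 : y@_1%g != 0.
  move: xs; rewrite -!mcoeff_ev ev_mulr; congr (ev _ x != 0).
  by apply/funext => t; rewrite divg_eq1.
exists (m.+1 * m.+1)%N => // X.
have [L Ls LX] := coloured_list m X.
have Pl := perp_lin I X; have [P0 PP] := Pl.
have [n [t [u [nL tL uU fE]]]] := interpolation 1%g L P0 PP.
exists u => f If; apply: (spanned_le (leq_trans nL Ls)).
exists (fun i => f (t i)) => w wX; apply/eqP; rewrite -subr_eq0; apply/eqP.
move: w wX; apply: (perp_determined Iid Iy ym y1).
  have := linear_set_sum n (fun i => f (t i)) Pl uU => Is.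
  have := PP (-1) _ _ Is If; congr (perp I X _); apply/funext => w.
  by rewrite mulN1r addrC.
by move=> w wX /(LX _ wX) wL; rewrite (fE _ If) // subrr.
Qed.

End Growth.

Section GrowthOperations.
Context {k : fieldType}.
Local Notation fn := (Sinf -> k).
Local Notation sys := ({fset nat} -> set fn).
Implicit Types (f g : fn) (X Y P : {fset nat}) (s t w : Sinf) (U V : sys).

Lemma prods_exp_bounded U V C D :
  exp_bounded U C -> exp_bounded V D -> exp_bounded (prods U V) (C * D).
Proof.
move=> UC VD X; have [[u uE] [v vE]] := (UC X, VD X).
set M := (C ^ #|` X|)%N in uE; set N := (D ^ #|` X|)%N in vE.
have [w wE] := spanned_fin X
  (fun ij : 'I_M * 'I_N => (fun s => u ij.1 s * v ij.2 s) : fn).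
exists w; rewrite expnMn -/M -/N.
rewrite card_prod !card_ord in wE.
suff h f : prods U V X f -> exists c : 'I_M * 'I_N -> k, forall s, Sym X s ->
    f s = \sum_ij c ij * (u ij.1 s * v ij.2 s).
  by move=> f /h[c cE]; apply: wE cE.
move: f; apply: prods_min => [|f g [c cE] fg|a b /uE[c cE] /vE[d dE]].
- split=> [|c f g [d dE] [e eE]].
    by exists (fun=> 0) => s sX; rewrite big1 // => ij _; rewrite mul0r.
  exists (fun ij => c * d ij + e ij) => s sX; rewrite dE // eE //.
  rewrite mulr_sumr -big_split; apply: eq_bigr => ij _ /=.
  by rewrite mulrDl mulrA.
- by exists c => s sX; rewrite -fg // cE.
exists (fun ij : 'I_M * 'I_N => c ij.1 * d ij.2) => s sX; rewrite cE // dE //.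
rewrite big_distrlr /= pair_bigA /=; apply: eq_bigr => ij _; exact: mulrACA.
Qed.

(** A translate of a block on [P] vanishes off the permutations carrying some
    [P2] to some [P1]. For each pair of subsets one such permutation is fixed,
    and the translate is expressed by blocks on [P1] at the corresponding
    translate: there are [4 ^ |X|] pairs, and the entries contribute the two
    other factors. *)
Lemma sums_exp_bounded U V C D : Tsystem U -> Tsystem V -> (0 < C)%N -> (0 < D)%N ->
  exp_bounded U C -> exp_bounded V D -> exp_bounded (sums U V) (2 * 2 * C * D).
Proof.
move=> TU TV C0 D0 UC VD X.
set M := (C ^ #|` X|)%N; set N := (D ^ #|` X|)%N.
have bU P : exists u : nat -> fn, {subset P <= X} -> forall f, U P f -> spanned P M u f.
  have [u uE] := UC P; exists u => PX f Uf; apply: spanned_le (uE f Uf).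
  by rewrite /M leq_pexp2l //; apply/fsubset_leq_card/fsubsetP.
have bV P : exists v : nat -> fn, forall g, V (X `\` P)%fset g ->
    spanned (X `\` P)%fset N v g.
  have [v vE] := VD (X `\` P)%fset; exists v => g Vg; apply: spanned_le (vE g Vg).
  by rewrite /N leq_pexp2l //; apply/fsubset_leq_card/fsubsetDl.
have [u uE] := choice bU; have [v vE] := choice bV.
have rex (PQ : {fset nat} * {fset nat}) : exists r, Sym X r /\
    ((exists2 s, Sym X s & maps s PQ.2 PQ.1) -> maps r PQ.2 PQ.1).
  have [[s sX sPQ]|h] := pselect (exists2 s, Sym X s & maps s PQ.2 PQ.1).
    by exists s.
  by exists 1%g.
have [r rP] := choice rex.
pose K := (((fpowerset X : finType) * (fpowerset X : finType)) * ('I_M * 'I_N))%type.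
pose gen (j : K) : fn := fun s =>
  block X (val j.1.1) (u (val j.1.1) j.2.1) (v (val j.1.1) j.2.2)
    (s * r (val j.1.1, val j.1.2))%g.
have [w wE] := spanned_fin X gen; exists w.
have cK : #|{: K}| = ((2 * 2 * C * D) ^ #|` X|)%N.
  by rewrite !card_prod !card_ord -!cardfE card_fpowerset !expnMn !mulnA.
rewrite -cK.
pose spn f := exists c : K -> k, forall s, Sym X s -> f s = \sum_j c j * gen j s.
have spn_lin : linear_set spn.
  split=> [|c f g [d dE] [e eE]].
    by exists (fun=> 0) => s sX; rewrite big1 // => ij _; rewrite mul0r.
  exists (fun ij => c * d ij + e ij) => s sX; rewrite dE // eE //.
  rewrite mulr_sumr -big_split; apply: eq_bigr => ij _ /=.
  by rewrite mulrDl mulrA.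
suff h f : sums U V X f -> forall s t, Sym X s -> Sym X t -> spn (fun z => f (s * z * t)%g).
  move=> f /h/(_ 1%g 1%g (@Sym1 _) (@Sym1 _))[c cE]; apply: (wE f c) => z zX.
  by rewrite -cE // mulg1 mul1g.
move: f; apply: (sums_min (A := [set f | forall s t, Sym X s -> Sym X t ->
    spn (fun z => f (s * z * t)%g)])).
  split=> [|f g f0 fg s t sX tX|q f qX f0 s t sX tX|q f qX f0 s t sX tX].
  - split=> [s t _ _|c f g f0 g0 s t sX tX]; first by case: spn_lin.
    by apply: spn_lin.2; [apply: f0|apply: g0].
  - have [c cE] := f0 s t sX tX; exists c => z zX; rewrite -cE // fg //.
    by apply: SymM tX; apply: SymM zX.
  - have [c cE] := f0 (q * s)%g t (SymM qX sX) tX; exists c => z zX.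
    by rewrite -cE // !mulgA.
  - have [c cE] := f0 s (t * q)%g sX (SymM tX qX); exists c => z zX.
    by rewrite -cE // !mulgA.
move=> P f g PX Uf Vg s t sX tX.
pose P1 := img s P; pose P2 := img t^-1%g P.
have sP : maps s P P1 := maps_img s P.
have tP : maps t P2 P by have := mapsV (maps_img t^-1%g P); rewrite invgK.
have P1X : {subset P1 <= X} := maps_subset (SymP sX) sP PX.
have P2X : {subset P2 <= X} := maps_subset (SymP (SymV tX)) (maps_img t^-1%g P) PX.
have [qX qP] := rP (P1, P2); set q := r (P1, P2) in qX qP.
have {}qP : maps q P2 P1.
  by apply: qP; exists (t * s)%g; [apply: SymM|apply: mapsM sP].
(* The translated block is a block on [P1] at [z * q], up to the stabiliser
   element [d]. *)
pose d := (s * q^-1 * t)%g.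
have dX : Sym X d by apply: SymM => //; apply: SymM => //; apply: SymV.
have dP : maps d P P by apply: mapsM tP; apply: mapsM sP _; apply: mapsV.
have Uf1 := ts_conj TU sP (ts_right TU (restr_Sym dP) Uf).
have Vg1 := ts_conj TV (mapsD (SymP sX) sP) (ts_right TV (restr_Sym (mapsC PX dX dP)) Vg).
have [c cE] := uE P1 P1X _ Uf1; have [c' c'E] := vE P1 _ Vg1.
have P1p : P1 \in fpowerset X by rewrite fpowersetE; apply/fsubsetP.
have P2p : P2 \in fpowerset X by rewrite fpowersetE; apply/fsubsetP.
exists (fun j : K => if j.1 == ([` P1p]%fset, [` P2p]%fset) then c j.2.1 * c' j.2.2 else 0).
move=> z zX.
have -> : (s * z * t = s * (z * q) * s^-1 * d)%g.
  by rewrite /d !mulgA mulgVK mulgK.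
have zqX : Sym X (z * q)%g by apply: SymM.
rewrite block_mulr //; last by apply: Sym_conj (SymP sX) zqX.
rewrite (block_conj _ _ _ (SymP sX) zqX) -/P1.
rewrite -(pair_bigA _ (fun (a : (fpowerset X : finType) * (fpowerset X : finType))
   (b : 'I_M * 'I_N) => (if a == ([` P1p]%fset, [` P2p]%fset)
   then c b.1 * c' b.2 else 0) * gen (a, b) z)) /=.
rewrite (bigD1 ([` P1p]%fset, [` P2p]%fset)) //= [X in _ + X]big1 ?addr0; last first.
  by move=> a /negbTE ->; rewrite big1 // => b _; rewrite mul0r.
under eq_bigr do rewrite eqxx.
rewrite /gen /= -/q.
have -> : block X P1 (fun t0 => f (s * t0 * s^-1 * restr P d)%g)
    (fun t0 => g (s * t0 * s^-1 * restr (X `\` P)%fset d)%g) (z * q)%g =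
  block X P1 (fun t0 => \sum_(i < M) c i * u P1 i t0)
    (fun t0 => \sum_(j < N) c' j * v P1 j t0) (z * q)%g.
  exact: block_loc.
rewrite /block big_distrlr /= pair_bigA /= mulr_sumr; apply: eq_bigr => b _.
by ring.
Qed.

(** In degree [n] the group algebra has dimension [n!], so for large [n] it
    contains a nonzero element killed by an exponentially bounded system. *)
Lemma ideal_of_neq0 U C : Tsystem U -> exp_bounded U C -> ideal_of U <> [set 0].
Proof.
move=> TU UC; have [n n0 Cn] := exp_lt_fact C.
have [u uE] := UC (ival 0 n); rewrite card_ival in uE.
pose A := \matrix_(i < #|'S_n|, j < (C ^ n)%N) u j (ext_perm (enum_val i)).
have nK : kermx A != 0.
  rewrite -mxrank_eq0 mxrank_ker subn_eq0 -ltnNge.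
  by apply: leq_ltn_trans (rank_leq_col _) _; rewrite card_Sn.
have /existsNP[i Ki] : ~ forall i, row i (kermx A) = 0.
  by move=> K0; case/negP: nK; apply/eqP/row_matrixP => i; rewrite K0 row0.
pose K := row i (kermx A).
have KA : K *m A = 0 by rewrite /K -row_mul mulmx_ker row0.
pose x : kS k n := \sum_(j < #|'S_n|) K 0 j *: gelt k (enum_val j).
have evx (h : 'S_n -> k) : ev h x = \sum_(j < #|'S_n|) K 0 j * h (enum_val j).
  by rewrite /x ev_sum; apply: eq_bigr => j _; rewrite evZ ev_gelt.
have Ix : ideal_of U (kS_incl x).
  apply/(ideal_ofP TU (ival_neq0 0 n0) (carried_incl x)) => f /uE[c cE].
  rewrite ev_incl evx.
  transitivity (\sum_(l < C ^ n) c l * (K *m A) 0 l); last first.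
    by rewrite KA big1 // => l _; rewrite mxE mulr0.
  under [RHS]eq_bigr do rewrite mxE mulr_sumr.
  rewrite [RHS]exchange_big; apply: eq_bigr => j _ /=.
  rewrite cE; last exact: Sym_ext.
  by rewrite mulr_sumr; apply: eq_bigr => l _; rewrite [A j l]mxE mulrCA.
move=> I0; rewrite I0 in Ix; apply: Ki; apply/rowP => j.
have := evx (fun q : 'S_n => (q == enum_val j)%:R).
rewrite (bigD1 j) //= eqxx mulr1 big1 ?addr0 => [|l lj]; last first.
  by rewrite (inj_eq enum_val_inj) (negbTE lj) mulr0.
move=> Kj; rewrite [RHS]mxE -[LHS]Kj.
have -> : x = 0 by apply: kS_incl_eq0 => f; rewrite Ix ev0.
by rewrite ev0.
Qed.

End GrowthOperations.

(** * The semiring of T-prime ideals *)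

Section Semiring.
Context (k : fieldType).
Local Notation sys := ({fset nat} -> set (Sinf -> k)).
Implicit Types (I J K : set (kSinf k)) (U : sys).

Lemma sys_one_exp_bounded : exp_bounded (@sys_one k) 1.
Proof.
move=> X; exists (fun _ _ => 1) => f [c fc]; exists (fun=> c) => s sX.
by rewrite exp1n big_ord1 mulr1 fc.
Qed.

Lemma TSpec_perp I : TSpec k I -> Tsystem (perp I).
Proof. by case=> Iid IT _; apply: perp_Tsystem. Qed.

Lemma ideal_of_TSpec U : Tsystem U -> ideal_of U <> [set 0] -> TSpec k (ideal_of U).
Proof.
by move=> TU U0; split=> //; [apply: ideal_of_ideal|apply: ideal_of_T_prime].
Qed.

Lemma TSpec_zero : TSpec k (ideal_of (@sys_zero k)).
Proof.
apply: ideal_of_TSpec; first exact: sys_zero_Tsystem.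
have : ideal_of (@sys_zero k) 1.
  move=> X f X0 _ f0; rewrite [ev f 1](ev_gelt f 1%g); exact: f0 (@Sym1 X).
by move=> + I0; rewrite I0 => /eqP; rewrite oner_eq0.
Qed.

Lemma TSpec_one : TSpec k (ideal_of (@sys_one k)).
Proof.
apply: ideal_of_TSpec; first exact: sys_one_Tsystem.
exact: ideal_of_neq0 (@sys_one_Tsystem k) sys_one_exp_bounded.
Qed.

Lemma TSpec_add I J : TSpec k I -> TSpec k J ->
  TSpec k (ideal_of (sums (perp I) (perp J))).
Proof.
move=> TI TJ; have [PI PJ] := (TSpec_perp TI, TSpec_perp TJ).
apply: ideal_of_TSpec; first exact: sums_Tsystem.
case: TI TJ => Iid _ I0 [Jid _ J0].
have [C C0 IC] := perp_exp_bounded Iid I0; have [D D0 JD] := perp_exp_bounded Jid J0.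
exact: ideal_of_neq0 (sums_Tsystem PI PJ) (sums_exp_bounded PI PJ C0 D0 IC JD).
Qed.

Lemma TSpec_mul I J : TSpec k I -> TSpec k J ->
  TSpec k (ideal_of (prods (perp I) (perp J))).
Proof.
move=> TI TJ; have [PI PJ] := (TSpec_perp TI, TSpec_perp TJ).
apply: ideal_of_TSpec; first exact: prods_Tsystem.
case: TI TJ => Iid _ I0 [Jid _ J0].
have [C C0 IC] := perp_exp_bounded Iid I0; have [D D0 JD] := perp_exp_bounded Jid J0.
exact: ideal_of_neq0 (prods_Tsystem PI PJ) (prods_exp_bounded IC JD).
Qed.

(** A name for the carrier, on which the algebraic structures are declared. *)
Definition tspec := set_type (TSpec k).
HB.instance Definition _ := gen_eqMixin tspec.
HB.instance Definition _ := gen_choiceMixin tspec.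

Implicit Types (a b c : tspec).

Definition tideal a : set (kSinf k) := val a.

Lemma tidealP a : TSpec k (tideal a).
Proof. exact: set_mem (valP a). Qed.

Lemma tideal_inj a b : tideal a = tideal b -> a = b.
Proof. exact: val_inj. Qed.

Definition tspec_of I (TI : TSpec k I) : tspec := SigSub (mem_set TI).

Definition tzero := tspec_of TSpec_zero.
Definition tone := tspec_of TSpec_one.
Definition tadd a b := tspec_of (TSpec_add (tidealP a) (tidealP b)).
Definition tmul a b := tspec_of (TSpec_mul (tidealP a) (tidealP b)).

Definition tsys a : sys := perp (tideal a).

Lemma tsysP a : Tsystem (tsys a).
Proof. exact: TSpec_perp (tidealP a). Qed.

(** Laws may be checked on systems. *)
Lemma tsys_inj a b : tsys a = tsys b -> a = b.
Proof.
move=> ab; apply: tideal_inj; have [[Iid _ _] [Jid _ _]] := (tidealP a, tidealP b).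
by rewrite -(ideal_of_perp Iid) -(ideal_of_perp Jid) -/(tsys a) ab.
Qed.

Lemma perp_ideal_ofE U : Tsystem U -> perp (ideal_of U) = U.
Proof. by move=> TU; apply/funext => X; apply: perp_ideal_of. Qed.

Lemma tsys_zero : tsys tzero = @sys_zero k.
Proof. exact: perp_ideal_ofE (@sys_zero_Tsystem k). Qed.

Lemma tsys_one : tsys tone = @sys_one k.
Proof. exact: perp_ideal_ofE (@sys_one_Tsystem k). Qed.

Lemma tsys_add a b : tsys (tadd a b) = sums (tsys a) (tsys b).
Proof. exact: perp_ideal_ofE (sums_Tsystem (tsysP a) (tsysP b)). Qed.

Lemma tsys_mul a b : tsys (tmul a b) = prods (tsys a) (tsys b).
Proof. exact: perp_ideal_ofE (prods_Tsystem (tsysP a) (tsysP b)). Qed.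

Let tsysE := (tsys_zero, tsys_one, tsys_add, tsys_mul).

Fact taddA : associative tadd.
Proof. by move=> a b c; apply: tsys_inj; rewrite !tsysE sumsA //; apply: tsysP. Qed.

Fact taddC : commutative tadd.
Proof. by move=> a b; apply: tsys_inj; rewrite !tsysE sumsC. Qed.

Fact tadd0 : left_id tzero tadd.
Proof. by move=> a; apply: tsys_inj; rewrite !tsysE sums0s //; apply: tsysP. Qed.

Fact tmulA : associative tmul.
Proof. by move=> a b c; apply: tsys_inj; rewrite !tsysE prodsA //; apply: tsysP. Qed.

Fact tmulC : commutative tmul.
Proof. by move=> a b; apply: tsys_inj; rewrite !tsysE prodsC //; apply: tsysP. Qed.

Fact tmul1 : left_id tone tmul.
Proof. by move=> a; apply: tsys_inj; rewrite !tsysE prods1s //; apply: tsysP. Qed.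

Fact tmulDl : left_distributive tmul tadd.
Proof.
by move=> a b c; apply: tsys_inj; rewrite !tsysE prods_sumsDl //; apply: tsysP.
Qed.

Fact tmul0 : left_zero tzero tmul.
Proof. by move=> a; apply: tsys_inj; rewrite !tsysE prods0s //; apply: tsysP. Qed.

HB.instance Definition _ := GRing.isNmodule.Build tspec taddA taddC tadd0.
HB.instance Definition _ := GRing.Nmodule_isComPzSemiRing.Build tspec
  tmulA tmulC tmul1 tmulDl tmul0.

End Semiring.

Theorem theorem2p2p6 (k : fieldType) :
  exists C : GRing.ComPzSemiRing.axioms_ (TSpec k),
    let R := GRing.ComPzSemiRing.Pack C in
    forall I J : R,
      (forall n : nat, (0 < n)%N ->
         level (val (I + J)) n = dagger_level (val I) (val J) n)
      /\ val (I * J) = bowtie (val I) (val J).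
Proof.
exists (GRing.ComPzSemiRing.class (tspec k : comPzSemiRingType)) => R I J.
have [[Iid IT _] [Jid JT _]] := (tidealP (I : tspec k), tidealP (J : tspec k)).
split=> [n n0|]; first exact: dagger_levelE.
exact/esym/bowtieE.
Qed.
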